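(* Let $(E,\phi)$ be an Anderson $A$-module over $L$ with $A$-motive $\mathcal M$, $r=\mathrm{rk}(\mathcal M)$, and let $\mathfrak p\neq0$ be a prime ideal of $A$ such that $\mathcal M$ is free at $\mathfrak p$. Assume there is a rigid analytic trivialization $\Upsilon\in\mathrm{GL}_r(\mathbb T_{(\mathfrak p)})$ of $\mathcal M_{(\mathfrak p)}$ with respect to some $(A\otimes L)_{(\mathfrak p)}$-basis $\mathbf m=(m_1,\dots,m_r)^{\mathsf T}$ of $\mathcal M_{(\mathfrak p)}$, i.e. $\tau(\Upsilon\mathbf m)=\Upsilon\mathbf m$; regard $\Upsilon\in\mathrm{GL}_r((A\otimes\mathbb C_\infty)_\mathfrak p)$ via the natural embedding $\mathbb T_{(\mathfrak p)}\hookrightarrow(A\otimes\mathbb C_\infty)_\mathfrak p$. Then: \begin{enumerate} \item the entries of $\Upsilon$ lie in $(A\otimes L^{\mathrm{sep}})_\mathfrak p$; \item with respect to an appropriate $A_\mathfrak p$-basis of $T_\mathfrak p(E)$, the $\mathfrak p$-adic Galois representation $\varrho_\mathfrak p:\mathrm{Gal}(L^{\mathrm{sep}}/L)\to\mathrm{GL}_r(A_\mathfrak p)$ attached to $E$ is given by $\gamma\mapsto\Upsilon\cdot\gamma(\Upsilon)^{-1}$. \end{enumerate}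
   Context: $\mathbb F_q$ finite field, $C$ smooth projective geometrically irreducible curve over $\mathbb F_q$, $\infty\in C$ closed point, $A=H^0(C\setminus\{\infty\},\mathcal O_C)$, $K=\mathrm{Frac}(A)$, $\mathbb C_\infty$ the completion at a place above $\infty$ of an algebraic closure of $K$. Unlabeled tensors over $\mathbb F_q$. $K\subseteq L\subseteq\mathbb C_\infty$, $\ell:K\to L$ inclusion, $L^{\mathrm{sep}}$ the separable closure of $L$ in $\mathbb C_\infty$. Anderson $A$-module $(E,\phi)$ over $L$: $E\cong\mathbb G_{a,L}^d$ as $\mathbb F_q$-vector space schemes, $\phi:A\to\mathrm{End}_{\mathbb F_q\text{-v.s.}}(E)$ ring homomorphism with $d\phi_a-\ell(a)$ nilpotent on $\mathrm{Lie}\,E$. $A$-motive $\mathcal M=\mathrm{Hom}_{\mathbb F_q\text{-v.s.}}(E,\mathbb G_{a,L})$, an $A\otimes L$-module ($a$ acts by $m\mapsto m\circ\phi_a$, $L$ by scalars) with $\tau$-semilinear map $m\mapsto\mathrm{Frob}_q\circ m$, $\tau(a\otimes l)=a\otimes l^q$; $\mathrm{rk}(\mathcal M)=\dim_{\mathrm{Quot}(A\otimes L)}\mathrm{Quot}(A\otimes L)\otimes_{A\otimes L}\mathcal M$. For a domain $S\supseteq A$, $S_{(\mathfrak p)}$ denotes $\bigcap_{\mathfrak q}S_\mathfrak q\subseteq\mathrm{Quot}(S)$ over the primes $\mathfrak q$ of $S$ containing $\mathfrak pS$; $\mathcal M_{(\mathfrak p)}=(A\otimes L)_{(\mathfrak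 p)}\otimes_{A\otimes L}\mathcal M$, and $\mathcal M$ is free at $\mathfrak p$ if this is a free finitely generated module. $\mathbb T$ is the completion of $A\otimes\mathbb C_\infty$ for the Gauss norm $\|\sum_{a\in B(A)}a\otimes c_a\|=\max|c_a|$ ($B(A)$ an $\mathbb F_q$-basis of $A$), with $\tau$ extended continuously. For $F\in\{L^{\mathrm{sep}},\mathbb C_\infty\}$, $(A\otimes F)_\mathfrak p=\varprojlim_n(A/\mathfrak p^{n+1})\otimes F$; $\mathbb T_{(\mathfrak p)}$ embeds naturally into $(A\otimes\mathbb C_\infty)_\mathfrak p$ (extending the continuous extension of the projections). $A_\mathfrak p$ is the $\mathfrak p$-adic completion of $A$. $\mathrm{Gal}(L^{\mathrm{sep}}/L)$ acts on $(A\otimes L^{\mathrm{sep}})_\mathfrak p$ through the second tensor factor (extended continuously), and on matrices entrywise. The Tate module is $T_\mathfrak p(E)=\mathrm{Hom}_A(K_\mathfrak p/A_\mathfrak p,E(\mathbb C_\infty))=\mathrm{Hom}_A(K_\mathfrak p/A_\mathfrak p,E(L^{\mathrm{sep}}))$ ($K_\mathfrak p=\mathrm{Quot}(A_\mathfrak p)$, $A$ acting on $E$ via $\phi$), a free $A_\mathfrak p$-module on which $\mathrm{Gal}(L^{\mathrm{sep}}/L)$ acts via its action on $E(L^{\mathrm{sep}})$; $\varrho_\mathfrak p$ is the resulting representation. *)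

(* Defs.v *)
From HB Require Import structures.
From mathcomp Require Import all_boot all_order all_algebra all_field.
From mathcomp Require Import mpoly.
From mathcomp Require Import boolp classical_sets reals.
Import Order.TTheory GRing.Theory Num.Theory.

Set Implicit Arguments.
Unset Strict Implicit.
Unset Printing Implicit Defensive.

Local Open Scope classical_set_scope.
Local Open Scope ring_scope.

(* MathComp has neither infinite-dimensional tensor products nor inverse limits
   nor completions of rings.  Here such an object is a ring (or module) together
   with its structure maps and its defining universal property; theorems are
   stated for every such object.  A map that is determined by a property is
   written [xget default [set y | property]]; the default value is irrelevant. *)

Definition is_module_basis (S : nzRingType) (V : lmodType S) (n : nat)
    (b : 'I_n -> V) : Prop :=
  forall v, exists! c : 'rV[S]_n, v = \sum_i c 0 i *: b i.

(* [mu : M -> N] exhibits N as S \otimes_R M, for S an R-algebra through f. *)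
Definition is_base_change (R S : nzRingType) (f : R -> S) (M : lmodType R)
    (N : lmodType S) (mu : M -> N) : Prop :=
  [/\ forall x y, mu (x + y) = mu x + mu y,
      forall r x, mu (r *: x) = f r *: mu x &
      forall (V : lmodType S) (g : M -> V),
        (forall x y, g (x + y) = g x + g y) ->
        (forall r x, g (r *: x) = f r *: g x) ->
        exists! h : N -> V,
          (forall s x y, h (s *: x + y) = s *: h x + h y) /\
          (forall x, h (mu x) = g x)].

(* The sigma-semilinear map sigma \otimes tau on N = S \otimes_R M. *)
Definition base_change_frob (R S : nzRingType) (M : lmodType R) (N : lmodType S)
    (mu : M -> N) (sigma : S -> S) (tau : M -> M) : N -> N :=
  xget (fun=> 0) [set h : N -> N |
    [/\ forall x y, h (x + y) = h x + h y,
        forall s x, h (s *: x) = sigma s *: h x &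
        forall x, h (mu x) = mu (tau x)]].

(* T = A \otimes_k F, where A and F are k-algebras through iA and iF; the
   universal property is that of the tensor product of k-vector spaces. *)

Record tensor_product (k : fieldType) (A F : comNzRingType)
    (iA : k -> A) (iF : k -> F) (T : comNzRingType) := TensorProduct {
  tensl : {rmorphism A -> T};
  tensr : {rmorphism F -> T};
  tens_balanced : forall c, tensl (iA c) = tensr (iF c);
  tens_universal : forall (V : lmodType k) (beta : A -> F -> V),
    (forall a a' f, beta (a + a') f = beta a f + beta a' f) ->
    (forall a f f', beta a (f + f') = beta a f + beta a f') ->
    (forall c a f, beta (iA c * a) f = c *: beta a f) ->
    (forall c a f, beta a (iF c * f) = c *: beta a f) ->
    exists! h : T -> V,
      [/\ forall x y, h (x + y) = h x + h y,
          forall c x, h (tensl (iA c) * x) = c *: h x &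
          forall a f, h (tensl a * tensr f) = beta a f] }.

Definition tens (k : fieldType) (A F : comNzRingType) (iA : k -> A)
    (iF : k -> F) (T : comNzRingType) (t : tensor_product iA iF T)
    (a : A) (f : F) : T := tensl t a * tensr t f.

Definition tensor_map (k : fieldType) (A F A' F' : comNzRingType)
    (iA : k -> A) (iF : k -> F) (iA' : k -> A') (iF' : k -> F')
    (T T' : comNzRingType) (t : tensor_product iA iF T)
    (t' : tensor_product iA' iF' T') (u : A -> A') (v : F -> F') : T -> T' :=
  xget (fun=> 0) [set h : T -> T' |
    (forall x y, h (x + y) = h x + h y) /\
    (forall a f, h (tens t a f) = tens t' (u a) (v f))].

Definition is_basis (k : fieldType) (A : comNzRingType) (iA : k -> A)
    (B : set A) : Prop :=
  (forall (s : seq A) (c : A -> k), uniq s -> {in s, forall a, B a} ->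
     \sum_(a <- s) iA (c a) * a = 0 -> {in s, forall a, c a = 0}) /\
  (forall x, exists (s : seq A) (c : A -> k),
     [/\ uniq s, {in s, forall a, B a} & x = \sum_(a <- s) iA (c a) * a]).

Section Norms.
Variable R : realType.

Definition ultrametric_norm (Y : nzRingType) (N : Y -> R) : Prop :=
  [/\ forall x, 0 <= N x, forall x, N x = 0 <-> x = 0,
      forall x, N (- x) = N x, forall x y, N (x + y) <= Num.max (N x) (N y) &
      forall x y, N (x * y) <= N x * N y].

Definition norm_cvg (Y : nzRingType) (N : Y -> R) (u : nat -> Y) (l : Y) : Prop :=
  forall e : R, 0 < e -> exists n0, forall n, (n0 <= n)%N -> N (u n - l) < e.

Definition norm_complete (Y : nzRingType) (N : Y -> R) : Prop :=
  forall u : nat -> Y,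
    (forall e : R, 0 < e -> exists n0, forall m n,
       (n0 <= m)%N -> (n0 <= n)%N -> N (u m - u n) < e) ->
    exists l, norm_cvg N u l.

Definition is_completion (X Y : nzRingType) (NX : X -> R) (NY : Y -> R)
    (j : X -> Y) : Prop :=
  [/\ ultrametric_norm NY, forall x, NY (j x) = NX x,
      forall (y : Y) (e : R), 0 < e -> exists x, NY (y - j x) < e &
      norm_complete NY].

(* The continuous extension of [h : X -> Z] to the completion Y of X. *)
Definition continuous_extension (X Y Z : nzRingType) (NY : Y -> R) (j : X -> Y)
    (NZ : Z -> R) (h : X -> Z) (y : Y) : Z :=
  xget 0 [set z | forall u : nat -> X,
    norm_cvg NY (j \o u) y -> norm_cvg NZ (h \o u) z].

(* The Gauss norm |sum_(a in B) a \otimes c_a| = max |c_a|. *)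
Definition gauss_norm (k : fieldType) (A F : comNzRingType) (iA : k -> A)
    (iF : k -> F) (T : comNzRingType) (t : tensor_product iA iF T)
    (abs : F -> R) (B : set A) (x : T) : R :=
  xget 0 [set v | exists (s : seq A) (c : A -> F),
    [/\ uniq s, {in s, forall a, B a},
        x = \sum_(a <- s) tens t a (c a) &
        v = \big[Num.max/0]_(a <- s) abs (c a)]].

(* When A is finite over k, A \otimes F is a finite-dimensional F-space and this
   norm, for an arbitrary k-basis of A, defines its canonical topology. *)
Definition fin_norm (k : fieldType) (A F : comNzRingType) (iA : k -> A)
    (iF : k -> F) (T : comNzRingType) (t : tensor_product iA iF T)
    (abs : F -> R) : T -> R :=
  gauss_norm t abs (xget set0 [set B | is_basis iA B]).

End Norms.

(* [semilocal P] is S_(P), the intersection in Quot(S) of the local rings S_q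
   over all primes q of S containing P. *)

Section Semilocalization.
Variables (S : idomainType) (P : set S).

Definition semilocal_set : {pred {fraction S}} := fun x =>
  `[< forall q : prime_idealr S, (forall s, P s -> s \in q) ->
        exists a b : S, b \notin q /\ x = tofrac a / tofrac b >].

Lemma semilocal_subring : subring_closed semilocal_set.
Proof.
split=> [|x y /asboolP hx /asboolP hy|x y /asboolP hx /asboolP hy];
  apply/asboolP => q hq.
- by exists 1, 1; rewrite idealr1 rmorph1 divr1.
- have [a [b [bq ->]]] := hx q hq; have [c [d [dq ->]]] := hy q hq.
  exists (a * d - c * b), (b * d); rewrite prime_idealrM negb_or bq dq; split=> //.
  have nz z : z \notin q -> tofrac z != 0.
    by rewrite tofrac_eq0; apply: contraNneq => ->; exact: idealr0.
  by rewrite -[- (_ / tofrac d)]mulNr addf_div ?nz // mulNr rmorphB !rmorphM.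
- have [a [b [bq ->]]] := hx q hq; have [c [d [dq ->]]] := hy q hq.
  exists (a * c), (b * d); rewrite prime_idealrM negb_or bq dq; split=> //.
  by rewrite mulf_div !rmorphM.
Qed.

Definition semilocal := {x : {fraction S} | semilocal_set x}.

HB.instance Definition _ := SubChoice.on semilocal.
HB.instance Definition _ :=
  GRing.SubChoice_isSubComNzRing.Build _ _ semilocal semilocal_subring.

Definition semilocal_unit : {pred semilocal} :=
  fun x => `[< exists y, y * x = 1 >].
Definition semilocal_inv (x : semilocal) : semilocal :=
  xget x [set y | y * x = 1].

Lemma semilocal_mulVx : {in semilocal_unit, left_inverse 1 semilocal_inv *%R}.
Proof.
by move=> x /asboolP ux; rewrite /semilocal_inv; case: xgetP => // n; case: ux => y /n.
Qed.
Lemma semilocal_unitPl (x y : semilocal) : y * x = 1 -> semilocal_unit x.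
Proof. by move=> yx; apply/asboolP; exists y. Qed.
Lemma semilocal_invr_out : {in [predC semilocal_unit], semilocal_inv =1 id}.
Proof.
move=> x /asboolPn nu; rewrite /semilocal_inv; case: xgetP => // y _ yx.
by case: nu; exists y.
Qed.
HB.instance Definition _ := GRing.ComNzRing_hasMulInverse.Build semilocal
  semilocal_mulVx semilocal_unitPl semilocal_invr_out.

Lemma semilocal_tofrac (s : S) : semilocal_set (tofrac s).
Proof.
by apply/asboolP => q _; exists s, 1; rewrite idealr1 rmorph1 divr1.
Qed.
Definition to_semilocal (s : S) : semilocal := Sub (tofrac s) (semilocal_tofrac s).

End Semilocalization.

(* The map a / b |-> f a / f b between such rings. *)
Definition semilocal_map (S S' : idomainType) (P : set S) (P' : set S')
    (f : S -> S') (x : semilocal P) : semilocal P' :=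
  xget 0 [set y | forall a b : S, b != 0 -> val x = tofrac a / tofrac b ->
    val y = tofrac (f a) / tofrac (f b)].

Section IdealPower.
Variables (A : comNzRingType) (p : idealr A).

(* The power p^(n+1): finite sums of products of n+1 elements of p. *)
Definition ideal_power (n : nat) : A -> bool := fun x =>
  `[< exists (m : nat) (a : 'I_m -> 'I_n.+1 -> A),
        (forall i j, a i j \in p) /\ x = \sum_i \prod_j a i j >].

Lemma ideal_power_idealr n : idealr_closed (ideal_power n).
Proof.
split.
- apply/asboolP; exists 0%N, (fun _ _ => 0); split=> [[]//|].
  by rewrite big_ord0.
- apply/asboolPn => -[m [a [ap e]]].
  suff: 1 \in p by rewrite idealr1.
  rewrite e rpred_sum // => i _; rewrite big_ord_recl mulrC.
  exact: idealMr.
- move=> c u v /asboolP [m [a [ap ->]]] /asboolP [m' [a' [ap' ->]]].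
  apply/asboolP; exists (m + m')%N.
  exists (fun i j => match split i with
    | inl i => if j == ord0 then c * a i j else a i j | inr i => a' i j end).
  split=> [i j|]; first by case: split => // k; case: ifP => // _; exact: idealMr.
  have eL (i : 'I_m) : split (lshift m' i) = inl i := unsplitK (inl i).
  have eR (i : 'I_m') : split (rshift m i) = inr i := unsplitK (inr i).
  rewrite big_split_ord /= mulr_sumr; congr (_ + _); apply: eq_bigr => i _.
  + rewrite !big_ord_recl /= eL ?eqxx mulrA; congr (_ * _).
  + by apply: eq_bigr => j _; rewrite eR.
Qed.

HB.instance Definition _ n := isIdealr.Build A (ideal_power n) (ideal_power_idealr n).

(* The ring A / p^(n+1). *)
Definition quo (n : nat) : comNzRingType := {ideal_quot (ideal_power n : idealr A)}.
Definition to_quo (n : nat) : A -> quo n := \pi_(quo n)%qT.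
Definition quo_trans (n : nat) (x : quo n.+1) : quo n := to_quo n (repr x).

End IdealPower.

Record inverse_limit (S : nat -> comNzRingType) (tr : forall n, S n.+1 -> S n)
    (Y : comNzRingType) := InverseLimit {
  lim_proj : forall n, {rmorphism Y -> S n};
  lim_compat : forall n y, tr n (lim_proj n.+1 y) = lim_proj n y;
  lim_universal : forall s : (forall n, S n), (forall n, tr n (s n.+1) = s n) ->
    exists! y, forall n, lim_proj n y = s n }.

Definition lim_lift (X : Type) (S : nat -> comNzRingType)
    (tr : forall n, S n.+1 -> S n) (Y : comNzRingType) (l : inverse_limit tr Y)
    (h : forall n, X -> S n) (x : X) : Y :=
  xget 0 [set y | forall n, lim_proj l n y = h n x].

Section Adic.
Variables (k : fieldType) (A : comNzRingType) (iA : k -> A) (p : idealr A).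

Definition quo_const (n : nat) (c : k) : quo p n := to_quo p n (iA c).

(* [adic_tensor p iF Y]: Y is (A \otimes F)_p = lim_n (A / p^(n+1)) \otimes F. *)
Record adic_tensor (F : comNzRingType) (iF : k -> F) (Y : comNzRingType) :=
  AdicTensor {
    level : nat -> comNzRingType;
    level_tensor : forall n, tensor_product (quo_const n) iF (level n);
    level_limit : inverse_limit (fun n => tensor_map (level_tensor n.+1)
                    (level_tensor n) (@quo_trans A p n) id) Y }.

(* [adic_ring p Ap]: Ap is the p-adic completion of A. *)
Definition adic_ring (Ap : comNzRingType) : Type :=
  inverse_limit (@quo_trans A p) Ap.

Definition to_adic (Ap : comNzRingType) (l : adic_ring Ap) : A -> Ap :=
  lim_lift l (to_quo p).

(* The structure map A_p -> (A \otimes F)_p. *)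
Definition adic_incl (Ap : comNzRingType) (l : adic_ring Ap) (F : comNzRingType)
    (iF : k -> F) (Y : comNzRingType) (t : adic_tensor iF Y) : Ap -> Y :=
  lim_lift (level_limit t) (fun n x => tensl (level_tensor t n) (lim_proj l n x)).

(* The map (A \otimes F)_p -> (A \otimes F')_p induced by g : F -> F'. *)
Definition adic_map (F F' : comNzRingType) (iF : k -> F) (iF' : k -> F')
    (Y Y' : comNzRingType) (t : adic_tensor iF Y) (t' : adic_tensor iF' Y')
    (g : F -> F') : Y -> Y' :=
  lim_lift (level_limit t') (fun n y =>
    tensor_map (level_tensor t n) (level_tensor t' n) id g
      (lim_proj (level_limit t) n y)).

End Adic.

(* A smooth projective geometrically irreducible curve C over Fq is given by its
   function field K; closed points of C are the places of K, and the functions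
   regular on an open subset U are those with nonnegative valuation at every
   place in U. *)

Section Curve.
Variables (Fq : finFieldType) (K : fieldType) (iK : {rmorphism Fq -> K}).

(* K is finite over Fq(x) for some transcendental x, and Fq is algebraically
   closed in K (geometric irreducibility, as Fq is perfect). *)
Definition is_function_field : Prop :=
  (exists x : K, ~ algebraicOver iK x /\
     exists (n : nat) (e : 'I_n -> K), forall y : K,
       exists (d : {poly Fq}) (c : 'I_n -> {poly Fq}),
         (map_poly iK d).[x] != 0 /\
         (map_poly iK d).[x] * y = \sum_i (map_poly iK (c i)).[x] * e i) /\
  (forall y : K, algebraicOver iK y -> exists c, y = iK c).

(* Normalized discrete valuations of K trivial on Fq; the value at 0 is
   meaningless. *)
Record place := Place {
  ord_at :> K -> int;
  ord_const : forall c, c != 0 -> ord_at (iK c) = 0;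
  ord_mul : forall x y, x != 0 -> y != 0 -> ord_at (x * y) = ord_at x + ord_at y;
  ord_add : forall x y, x != 0 -> y != 0 -> x + y != 0 ->
    Num.min (ord_at x) (ord_at y) <= ord_at (x + y);
  ord_surj : exists2 x, x != 0 & ord_at x = 1 }.

Definition same_place (v w : place) : Prop := forall x, x != 0 -> v x = w x.

Variable oo : place.

Definition regular_away : {pred K} := fun x =>
  `[< forall v : place, ~ same_place v oo -> x != 0 -> 0 <= v x >].

Lemma regular_away_subring : subring_closed regular_away.
Proof.
have v1 (v : place) : v 1 = 0 by rewrite -(rmorph1 iK) ord_const ?oner_neq0.
have vN1 (v : place) : v (-1) = 0.
  by rewrite -(rmorph1 iK) -rmorphN ord_const ?oppr_eq0 ?oner_neq0.
split=> [|x y /asboolP hx /asboolP hy|x y /asboolP hx /asboolP hy];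
  apply/asboolP => v hv nz.
- by rewrite v1.
- have [x0|x0] := eqVneq x 0.
    move: nz; rewrite x0 sub0r oppr_eq0 => y0.
    by rewrite -mulN1r ord_mul ?oppr_eq0 ?oner_neq0 // vN1 add0r hy.
  have [y0|y0] := eqVneq y 0; first by rewrite y0 subr0 hx.
  apply: le_trans (ord_add v x0 _ nz); last by rewrite oppr_eq0.
  rewrite le_min hx //= -mulN1r ord_mul ?oppr_eq0 ?oner_neq0 // vN1 add0r.
  exact: hy.
- by move: nz; rewrite mulf_eq0 negb_or => /andP [x0 y0];
    rewrite ord_mul // addr_ge0 ?hx ?hy.
Qed.

(* The ring A = H^0(C \ {oo}, O_C). *)
Definition affine_ring := {x : K | regular_away x}.

HB.instance Definition _ := SubChoice.on affine_ring.
HB.instance Definition _ :=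
  GRing.SubChoice_isSubComNzRing.Build _ _ affine_ring regular_away_subring.

Lemma regular_const (c : Fq) : regular_away (iK c).
Proof.
by apply/asboolP => v _; rewrite fmorph_eq0 => c0; rewrite ord_const.
Qed.
Definition affine_const (c : Fq) : affine_ring := Sub (iK c) (regular_const c).

End Curve.

(* C is the completion, at a place above oo, of an algebraic closure of K; its
   absolute value extends the one attached to oo. *)
Definition is_C_infty (R : realType) (Fq : finFieldType) (K C : fieldType)
    (iK : {rmorphism Fq -> K}) (oo : place iK) (iKC : {rmorphism K -> C})
    (abs : C -> R) : Prop :=
  [/\ forall x y, abs (x * y) = abs x * abs y,
      exists2 rho : R, 0 < rho < 1 &
        forall x, x != 0 -> abs (iKC x) = rho ^ (oo x) &
      exists (Kbar : fieldType) (i : {rmorphism K -> Kbar})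
             (j : {rmorphism Kbar -> C}),
        [/\ GRing.closed_field_axiom Kbar, forall y, algebraicOver i y,
            forall x, j (i x) = iKC x &
            is_completion (fun y => abs (j y)) abs j]].

Definition is_separable_closure_in (L Ls C : fieldType)
    (iLLs : {rmorphism L -> Ls}) (iLsC : {rmorphism Ls -> C}) : Prop :=
  forall x : C, (exists y, x = iLsC y) <->
    (exists2 f : {poly L}, separable_poly f & root (map_poly (iLsC \o iLLs) f) x).

Definition is_galois (L Ls : fieldType) (iLLs : {rmorphism L -> Ls})
    (g : {rmorphism Ls -> Ls}) : Prop :=
  bijective g /\ forall x, g (iLLs x) = iLLs x.

Section Anderson.
Variables (Fq : finFieldType) (A : comNzRingType) (iA : Fq -> A).
Variables (L : fieldType) (iL : {rmorphism Fq -> L}) (l : {rmorphism A -> L}).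

(* The polynomial f, as a morphism G_a^d -> G_a over L, is a morphism of
   Fq-vector space schemes: it is Fq-linear on S-points for every L-algebra S. *)
Definition Fq_linear (d : nat) (f : {mpoly L[d]}) : Prop :=
  forall (S : comNzRingType) (g : {rmorphism L -> S}) (x y : 'I_d -> S) (c : Fq),
    mmap g (fun i => x i + y i) f = mmap g x f + mmap g y f /\
    mmap g (fun i => g (iL c) * x i) f = g (iL c) * mmap g x f.

(* The matrix of the tangent map at 0 of an endomorphism of G_a^d. *)
Definition lie (d : nat) (f : 'I_d -> {mpoly L[d]}) : 'M[L]_d :=
  \matrix_(i, j) (mderiv j (f i)).@[fun=> 0].

(* In coordinates E = G_a^d; phi a is the d-tuple of polynomials defining the
   endomorphism phi_a. *)
Record anderson_module (d : nat) := AndersonModule {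
  am_phi :> A -> 'I_d -> {mpoly L[d]};
  am_linear : forall a i, Fq_linear (am_phi a i);
  am_one : forall i, am_phi 1 i = 'X_i;
  am_add : forall a b i, am_phi (a + b) i = am_phi a i + am_phi b i;
  am_mul : forall a b i,
    am_phi (a * b) i = am_phi a i \mPo [tuple am_phi b j | j < d];
  am_lie : forall a, exists n, (lie (am_phi a) - (l a)%:M) ^+ n = 0 }.

Variables (d : nat) (E : anderson_module d).

(* The action of a on E(F) = F^d, for L -> F. *)
Definition am_act (F : fieldType) (iF : L -> F) (a : A) (x : 'rV[F]_d) : 'rV[F]_d :=
  \row_i mmap iF (x 0) (E a i).

Variables (AL : idomainType) (tAL : tensor_product iA iL AL).

(* M is Hom(E, G_a), an A \otimes L-module where A acts by m |-> m \o phi_a. *)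
Record motive (M : lmodType AL) := Motive {
  mot_hom : M -> {mpoly L[d]};
  mot_add : forall m m', mot_hom (m + m') = mot_hom m + mot_hom m';
  mot_inj : injective mot_hom;
  mot_range : forall f, Fq_linear f <-> exists m, mot_hom m = f;
  mot_actA : forall a m,
    mot_hom (tensl tAL a *: m) = mot_hom m \mPo [tuple E a j | j < d];
  mot_actL : forall c m, mot_hom (tensr tAL c *: m) = c *: mot_hom m }.

Definition motive_frob (M : lmodType AL) (H : motive M) (m : M) : M :=
  xget 0 [set m' | mot_hom H m' = mot_hom H m ^+ #|Fq|].

Definition motive_rank (M : lmodType AL) (r : nat) : Prop :=
  exists (V : lmodType {fraction AL}) (mu : M -> V),
    is_base_change (@tofrac AL) mu /\
    exists b : 'I_r -> V, is_module_basis b.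

(* id \otimes Frob_q on A \otimes F *)
Definition tens_frob (F : fieldType) (iF : Fq -> F) (T : comNzRingType)
    (t : tensor_product iA iF T) : T -> T :=
  tensor_map t t id (fun c : F => c ^+ #|Fq|).

End Anderson.

Section Tate.
Variables (Fq : finFieldType) (A : comNzRingType).
Variables (L : fieldType) (iL : {rmorphism Fq -> L}) (l : {rmorphism A -> L}).
Variables (d : nat) (E : anderson_module iL l d).
Variables (p : idealr A) (Ap : idomainType) (lAp : adic_ring p Ap).
Variables (Ls : fieldType) (iLLs : {rmorphism L -> Ls}).

(* A-linear maps K_p / A_p -> E(Ls), as maps on K_p = Quot(A_p) killing A_p. *)
Record tate_module := TateModule {
  tate_fun :> {fraction Ap} -> 'rV[Ls]_d;
  tate_add : forall x y, tate_fun (x + y) = tate_fun x + tate_fun y;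
  tate_lin : forall a x,
    tate_fun (tofrac (to_adic lAp a) * x) = am_act E iLLs a (tate_fun x);
  tate_int : forall x : Ap, tate_fun (tofrac x) = 0 }.

(* t_1, ..., t_r is an A_p-basis; (c . t)(x) = t (c x). *)
Definition tate_basis (r : nat) (t : 'I_r -> tate_module) : Prop :=
  forall s : tate_module, exists! c : 'rV[Ap]_r,
    forall x, s x = \sum_i t i (tofrac (c 0 i) * x).

(* P is the matrix, in the basis t, of the action of g on the Tate module: its
   j-th column contains the coordinates of g . t_j. *)
Definition galois_matrix (r : nat) (t : 'I_r -> tate_module) (g : Ls -> Ls)
    (P : 'M[Ap]_r) : Prop :=
  forall j x, map_mx g (t j x) = \sum_i t i (tofrac (P i j) * x).

End Tate.

Definition ideal_image (A S : nzRingType) (i : A -> S) (p : {pred A}) : set S :=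
  [set s | exists2 a, a \in p & s = i a].

Section Tate_algebra.
Variables (R : realType) (k : finFieldType) (A : comNzRingType) (iA : k -> A).
Variables (C : fieldType) (iC : k -> C) (abs : C -> R).
Variables (AC : comNzRingType) (tAC : tensor_product iA iC AC).
Variables (TT : idomainType) (normT : TT -> R) (jT : {rmorphism AC -> TT}).
Variable p : idealr A.

Definition tate_frob : TT -> TT :=
  continuous_extension normT jT normT (jT \o tens_frob tAC).

Definition tate_prime : set TT := ideal_image (jT \o tensl tAC) p.

Variables (ACp : comUnitRingType) (tACp : adic_tensor iA p iC ACp).

(* TT -> (A \otimes C)_p, extending continuously the projections
   A \otimes C -> (A / p^(n+1)) \otimes C. *)
Definition tate_to_adic : TT -> ACp :=
  lim_lift (level_limit tACp) (fun n =>
    continuous_extension normT jT (fin_norm (level_tensor tACp n) abs)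
      (tensor_map tAC (level_tensor tACp n) (to_quo p n) id)).

(* The embedding of TT_(p) in (A \otimes C)_p. *)
Definition tate_semilocal_to_adic (x : semilocal tate_prime) : ACp :=
  xget 0 [set y | forall a b : TT, b != 0 -> val x = tofrac a / tofrac b ->
    y * tate_to_adic b = tate_to_adic a].

End Tate_algebra.

(* tau (U m) = U m in S' \otimes_S M, for a column m of elements of M. *)
Definition is_trivialization (S S' : nzRingType) (i : S -> S') (sigma : S' -> S')
    (M : lmodType S) (tau : M -> M) (r : nat) (m : 'I_r -> M) (U : 'M[S']_r) : Prop :=
  exists (W : lmodType S') (w : M -> W),
    is_base_change i w /\
    forall i, base_change_frob w sigma tau (\sum_j U i j *: w (m j)) =
              \sum_j U i j *: w (m j).

(* Main.v *)
Require Import Defs.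
From HB Require Import structures.
From mathcomp Require Import all_boot all_order all_algebra all_field.
From mathcomp Require Import mpoly.
From mathcomp Require Import boolp classical_sets reals.
Import Order.TTheory GRing.Theory Num.Theory.

(* Write tau m = Theta m with Theta over (A \otimes L)_(p); the trivialization says
   tau(Upsilon) Theta = Upsilon.  Modulo p^(n+1) this is a system u = u^(q) D over L
   for the coordinates u of Upsilon, hence etale, so all its solutions are separable
   over L: this gives the first part.  The rows of Upsilon m are then a tau-invariant
   basis of (A \otimes Ls)_p \otimes M.  As E(Ls) = Hom_L^tau(M, Ls), and as the
   K_p / A_p-torsion is governed by the duality between K_p / A_p and A_p, whose dual
   has a generator lambda, a Tate vector is the same as a tau-equivariant A_p-linear
   map M -> (A \otimes Ls)_p: x |-> (m |-> (lambda_x \otimes id) (Z m)).  The basis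
   dual to Upsilon m gives a basis of the Tate module, and the Galois action on it is
   read off gamma(Upsilon).  The fixed points of tau on (A \otimes Ls)_p are A_p. *)

Set Implicit Arguments.
Unset Strict Implicit.
Unset Printing Implicit Defensive.

Local Open Scope ring_scope.
Local Open Scope classical_set_scope.

(** * Linear functionals and tensor products *)

(** Three facts taken for granted above carry much of the work. First, the ring A is known only
    through places, so the structure of A_p is derived from two properties of A: families
    independent modulo a A have bounded length, because K is finite over k(x), and an element w of K
    with all w^m a in A lies in A, because a pole of w would be amplified by the powers. The bound
    also makes A / p^(n+1) finite over k, so every level of (A \otimes F)_p is a finite-dimensional
    F-space on which matrices and norms are at hand. Second, lambda is not a residue of a
    differential: a k-linear functional on K_p that kills A_p and takes the value 1 at P^-1, for a
    uniformizer P, already makes the form (b, b') |-> lambda(b b' P^-(n+1)) on A / p^(n+1)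
    nondegenerate, and a nondegenerate form on each level is what the duality amounts to. Third, an
    element of S_(p) is a fraction whose denominator is 1 modulo p S. Such denominators become units
    p-adically, and at each finite level their inverses are polynomials in them, so that there Theta
    has entries from A \otimes L itself. *)

Lemma zorn_nonempty (T : Type) (P : set (set T)) (H : set T) :
  P H ->
  (forall F : set (set T), F !=set0 -> F `<=` P -> total_on F subset ->
     P (\bigcup_(X in F) X)) ->
  exists A, P A /\ forall B, A `<=` B -> P B -> B = A.
Proof.
move=> PH Pchain.
pose P' X := X = set0 \/ P X.
have [] := @Zorn_bigcup _ P'.
  move=> F FP totF.
  have [[X [FX PX]]|nP] := pselect (exists X, F X /\ P X); last first.
    left; apply/seteqP; split=> // t [X FX Xt].
    by case: (FP X FX) => [X0|PX]; [rewrite X0 in Xt | case: nP; exists X].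
  right; have -> : \bigcup_(Y in F) Y = \bigcup_(Y in F `&` P) Y.
    apply/seteqP; split=> t [Y FY Yt].
      by case: (FP Y FY) => [Y0|PY]; [rewrite Y0 in Yt | exists Y].
    by case: FY => FY _; exists Y.
  apply: Pchain; first by exists X.
    by move=> Y [].
  by move=> Y Z [FY _] [FZ _]; exact: totF.
move=> A [PA maxA].
have {}PA : P A.
  case: PA => // A0; have [H0|H0] := pselect (H = set0); first by rewrite A0 -H0.
  case: (maxA H); last by right.
  rewrite A0; split=> [//|sH]; apply: H0.
  by apply/seteqP; split.
exists A; split=> // B AB PB; apply: contrapT => nBA.
apply: (maxA B); last by right.
by split=> // BA; apply: nBA; apply/seteqP; split.
Qed.

Section Additive.
Variables (U V : zmodType) (f : U -> V).
Hypothesis fD : forall x y, f (x + y) = f x + f y.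

Lemma additive0 : f 0 = 0.
Proof. by apply: (addrI (f 0)); rewrite -fD !addr0. Qed.
Lemma additiveN x : f (- x) = - f x.
Proof. by apply: (addrI (f x)); rewrite -fD !subrr additive0. Qed.
End Additive.

(** The maps of the definitions are bare functions obtained by choice. Each is shown equal to a
    bundled morphism, by which it is then rewritten. *)
Lemma rmorphism_of (R S : nzRingType) (f : R -> S) :
  (forall x y, f (x + y) = f x + f y) -> (forall x y, f (x * y) = f x * f y) ->
  f 1 = 1 -> exists h : {rmorphism R -> S}, f = h.
Proof.
move=> fD fM f1.
have fB : zmod_morphism f by move=> x y; rewrite fD additiveN.
pose h := HB.pack_for {rmorphism R -> S} f
  (GRing.isZmodMorphism.Build R S f fB)
  (GRing.isMonoidMorphism.Build R S f (conj f1 fM)).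
by exists h.
Qed.

(* A functional vanishing on a maximal subspace H' with z \notin H': as H' + k z
   is everything, the coefficient of z is well defined. *)
Lemma separating_functional (k : fieldType) (V : lmodType k) (H : set V) (z : V) :
  (forall x y, H x -> H y -> H (x + y)) -> (forall c x, H x -> H (c *: x)) ->
  H 0 -> ~ H z ->
  exists phi : V -> k, [/\ forall x y, phi (x + y) = phi x + phi y,
     forall c x, phi (c *: x) = c * phi x, forall x, H x -> phi x = 0 & phi z = 1].
Proof.
move=> HD HZ H0 Hz.
pose P X := [/\ forall x y, X x -> X y -> X (x + y),
  forall c x, X x -> X (c *: x), H `<=` X & ~ X z].
have [|F [X0 FX0] FP totF|A [[AD AZ HA Az] maxA]] := @zorn_nonempty _ P H.
- by split.
- split.
  + move=> x y [X FX Xx] [Y FY Yy].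
    case: (totF X Y FX FY) => s; [exists Y | exists X] => //.
      by case: (FP Y FY) => D _ _ _; apply: D => //; exact: s.
    by case: (FP X FX) => D _ _ _; apply: D => //; exact: s.
  + by move=> c x [X FX Xx]; exists X => //; case: (FP X FX) => _ Z _ _; exact: Z.
  + by move=> x Hx; exists X0 => //; case: (FP X0 FX0) => _ _ s _; exact: s.
  + by move=> [X FX Xz]; case: (FP X FX).
have AN x : A x -> A (- x) by move=> Ax; rewrite -scaleN1r; exact: AZ.
have Zi c c' x : A (x - c *: z) -> A (x - c' *: z) -> c = c'.
  move=> h h'; apply/eqP; rewrite -subr_eq0; apply/eqP; apply: contrapT => /eqP nz.
  apply: Az; rewrite -[z]scale1r -(mulVf nz) -scalerA; apply: AZ.
  have -> : (c - c') *: z = (x - c' *: z) - (x - c *: z).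
    by rewrite opprB [RHS]addrC addrA subrK scalerBl.
  by apply: AD h' _; apply: AN.
have ex x : exists c, A (x - c *: z).
  have [Ax|nAx] := pselect (A x); first by exists 0; rewrite scale0r subr0.
  pose B y := exists a c, A a /\ y = a + c *: x.
  have sAB : A `<=` B by move=> a Aa; exists a, 0; rewrite scale0r addr0.
  have Bz : B z.
    apply: contrapT => nBz.
    have PB : P B.
      split=> //.
      - move=> y y' [a [c [Aa ->]]] [a' [c' [Aa' ->]]].
        exists (a + a'), (c + c'); split; first exact: AD.
        by rewrite scalerDl addrACA.
      - move=> d y [a [c [Aa ->]]]; exists (d *: a), (d * c).
        by split; [exact: AZ | rewrite scalerDr scalerA].
      - by move=> y /HA /sAB.
    have Bx : B x by exists 0, 1; rewrite scale1r add0r; split=> //; exact: HA.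
    by apply: nAx; rewrite -(maxA B sAB PB).
  case: Bz => a [c [Aa zE]].
  have c0 : c != 0 by apply/eqP => c0; apply: Az; rewrite zE c0 scale0r addr0.
  exists c^-1; rewrite zE scalerDr scalerA mulVf // scale1r opprD addrCA subrr addr0.
  by apply: AN; exact: AZ.
pose phi x := xget 0 [set c | A (x - c *: z)].
have phiP x : A (x - phi x *: z).
  by rewrite /phi; case: xgetP => // ne; case: (ex x) => c /ne.
exists phi; split.
- move=> x y; apply: Zi (phiP _) _.
  rewrite scalerDl opprD addrACA; exact: AD (phiP x) (phiP y).
- move=> c x; apply: Zi (phiP _) _.
  by rewrite -scalerA -scalerBr; exact: AZ.
- move=> x Hx; apply: Zi (phiP _) _.
  by rewrite scale0r subr0; exact: HA.
- by apply: Zi (phiP _) _; rewrite scale1r subrr; exact: HA.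
Qed.

(** A universal property over [R] accepts only [R]-modules as targets; this alias lets an [S]-module
    serve, also with its scalars twisted by a Frobenius. *)
Definition restrict_scalars (R S : nzRingType) (f : R -> S) (V : lmodType S) : Type := V.

Section RestrictScalars.
Variables (R S : nzRingType) (f : {rmorphism R -> S}) (V : lmodType S).
HB.instance Definition _ := GRing.Zmodule.on (restrict_scalars f V).
Let scale (r : R) (v : restrict_scalars f V) : restrict_scalars f V := f r *: (v : V).
Fact restrict_scalarsA a b v : scale a (scale b v) = scale (a * b) v.
Proof. by rewrite /scale rmorphM scalerA. Qed.
Fact restrict_scalars1 : left_id 1 scale.
Proof. by move=> v; rewrite /scale rmorph1 scale1r. Qed.
Fact restrict_scalarsDr : right_distributive scale +%R.
Proof. by move=> a u v; rewrite /scale scalerDr. Qed.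
Fact restrict_scalarsDl v : {morph scale^~ v : a b / a + b}.
Proof. by move=> a b; rewrite /scale rmorphD scalerDl. Qed.
HB.instance Definition _ := GRing.Zmodule_isLmodule.Build R (restrict_scalars f V)
  restrict_scalarsA restrict_scalars1 restrict_scalarsDr restrict_scalarsDl.
Lemma restrict_scalarsE r (v : V) : r *: (v : restrict_scalars f V) = f r *: v.
Proof. by []. Qed.
End RestrictScalars.

Section Tensor.
Variables (k : fieldType) (A F T : comNzRingType).
Variables (iA : {rmorphism k -> A}) (iF : {rmorphism k -> F}).
Variable t : tensor_product iA iF T.

Lemma tensDl a a' f : tens t (a + a') f = tens t a f + tens t a' f.
Proof. by rewrite /tens rmorphD mulrDl. Qed.
Lemma tensDr a f f' : tens t a (f + f') = tens t a f + tens t a f'.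
Proof. by rewrite /tens rmorphD mulrDr. Qed.
Lemma tens_constl c a f : tens t (iA c * a) f = tensl t (iA c) * tens t a f.
Proof. by rewrite /tens rmorphM mulrA. Qed.
Lemma tens_constr c a f : tens t a (iF c * f) = tensl t (iA c) * tens t a f.
Proof. by rewrite /tens rmorphM -tens_balanced mulrCA. Qed.
Lemma tensM a f a' f' : tens t a f * tens t a' f' = tens t (a * a') (f * f').
Proof. by rewrite /tens !rmorphM mulrACA. Qed.
Lemma tens11 : tens t 1 1 = 1.
Proof. by rewrite /tens !rmorph1 mulr1. Qed.
Lemma tens1l f : tens t 1 f = tensr t f.
Proof. by rewrite /tens rmorph1 mul1r. Qed.
Lemma tens1r a : tens t a 1 = tensl t a.
Proof. by rewrite /tens rmorph1 mulr1. Qed.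
Lemma tens0l f : tens t 0 f = 0.
Proof. by rewrite /tens rmorph0 mul0r. Qed.
Lemma tens0r a : tens t a 0 = 0.
Proof. by rewrite /tens rmorph0 mulr0. Qed.

(** A tensor outside the span could be separated from it by a functional; this functional and 0
    would both solve the universal problem of the zero bilinear map. *)
Lemma tens_span z : exists s : seq (A * F), z = \sum_(x <- s) tens t x.1 x.2.
Proof.
apply: contrapT => nz.
pose T' : lmodType k := restrict_scalars (tensl t \o iA) T^o.
pose H : set T' := fun z => exists s : seq (A * F), z = \sum_(x <- s) tens t x.1 x.2.
have HT a f : H (tens t a f) by exists [:: (a, f)]; rewrite big_seq1.
have [|c x [s ->]||//|phi [phiD phiZ phiH phiz]] := @separating_functional k T' H z.
- by move=> _ _ [s ->] [s' ->]; exists (s ++ s'); rewrite big_cat.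
- exists [seq (iA c * x.1, x.2) | x <- s]; rewrite big_map restrict_scalarsE /=.
  by rewrite scaler_sumr; apply: eq_bigr => i _; rewrite tens_constl.
- by exists [::]; rewrite big_nil.
have [|||| h [_ hu]] := @tens_universal _ _ _ _ _ _ t k^o (fun _ _ => 0).
- by rewrite addr0.
- by rewrite addr0.
- by move=> *; rewrite scaler0.
- by move=> *; rewrite scaler0.
have h0 : h = fun=> 0.
  by apply: hu; split=> *; rewrite ?addr0 ?scaler0.
have : h = phi.
  apply: hu; split=> [x y|c x|a f].
  - exact: phiD.
  - exact: phiZ.
  - exact/phiH/HT.
by rewrite h0 => /(congr1 (@^~ z)) /esym; rewrite phiz => /eqP; rewrite oner_eq0.
Qed.

Lemma tens_ind (P : T -> Prop) :
  P 0 -> (forall x y, P x -> P y -> P (x + y)) -> (forall a f, P (tens t a f)) ->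
  forall z, P z.
Proof.
move=> P0 PD Pt z; have [s ->] := tens_span z.
by elim/big_ind: _ => // -[].
Qed.

Lemma tens_ext (V : zmodType) (g h : T -> V) :
  (forall x y, g (x + y) = g x + g y) -> (forall x y, h (x + y) = h x + h y) ->
  (forall a f, g (tens t a f) = h (tens t a f)) -> g =1 h.
Proof.
move=> gD hD gh; elim/tens_ind => //.
- by rewrite !additive0.
- by move=> x y gx gy; rewrite gD hD gx gy.
Qed.

Lemma tens_rmorph_ext (S : pzSemiRingType) (g h : {rmorphism T -> S}) :
  (forall a f, g (tens t a f) = h (tens t a f)) -> g =1 h.
Proof.
by move=> gh; elim/tens_ind => // [|x y gx gy]; rewrite ?rmorph0 // !rmorphD gx gy.
Qed.

(** This is [mu \otimes id]. Coordinate functionals [mu] read off the coefficients of a tensor;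
    functionals built from lambda give the pairing with K_p / A_p. *)
Definition contract (mu : A -> k) : T -> F :=
  xget (fun=> 0) [set h : T -> F | (forall x y, h (x + y) = h x + h y) /\
     (forall a f, h (tens t a f) = iF (mu a) * f)].

Section Contract.
Variable mu : A -> k.
Hypothesis muD : forall a b, mu (a + b) = mu a + mu b.
Hypothesis muZ : forall c a, mu (iA c * a) = c * mu a.

Lemma contract_spec : (forall x y, contract mu (x + y) = contract mu x + contract mu y) /\
  (forall a f, contract mu (tens t a f) = iF (mu a) * f).
Proof.
rewrite /contract; case: xgetP => // ne; exfalso.
have [|||| h [[hD _ hT] _]] := @tens_universal _ _ _ _ _ _ t
   (restrict_scalars iF F^o) (fun a f => iF (mu a) * f).
- by move=> *; rewrite muD rmorphD mulrDl.
- by move=> *; rewrite mulrDr.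
- by move=> c a f; rewrite muZ rmorphM -mulrA.
- by move=> c a f; rewrite restrict_scalarsE mulrCA.
exact: (ne h).
Qed.

Lemma contractD x y : contract mu (x + y) = contract mu x + contract mu y.
Proof. exact: contract_spec.1. Qed.
Lemma contractT a f : contract mu (tens t a f) = iF (mu a) * f.
Proof. exact: contract_spec.2. Qed.
Lemma contract0 : contract mu 0 = 0.
Proof. exact/additive0/contractD. Qed.
Lemma contractN x : contract mu (- x) = - contract mu x.
Proof. exact/additiveN/contractD. Qed.
Lemma contractB x y : contract mu (x - y) = contract mu x - contract mu y.
Proof. by rewrite contractD contractN. Qed.
Lemma contract_sum (I : Type) (s : seq I) (P : pred I) G :
  contract mu (\sum_(i <- s | P i) G i) = \sum_(i <- s | P i) contract mu (G i).
Proof. exact: (big_morph _ contractD contract0). Qed.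
Lemma contractZ f x : contract mu (tensr t f * x) = f * contract mu x.
Proof.
elim/tens_ind: x => [|x y hx hy|a g].
- by rewrite mulr0 contract0 mulr0.
- by rewrite mulrDr !contractD hx hy mulrDr.
- by rewrite -tens1l tensM mul1r !contractT mulrCA.
Qed.
End Contract.

End Tensor.

(** Naturality in the second factor, used both for the inclusion of [Ls] in [C] and for Frobenius
    maps. *)
Lemma contract_tensor_map (k : fieldType) (A F F' T T' : comNzRingType)
    (iA : {rmorphism k -> A}) (iF : {rmorphism k -> F}) (iF' : {rmorphism k -> F'})
    (t : tensor_product iA iF T) (t' : tensor_product iA iF' T')
    (j : {rmorphism F -> F'}) (h : {rmorphism T -> T'}) (mu : A -> k) :
  (forall a b, mu (a + b) = mu a + mu b) -> (forall c a, mu (iA c * a) = c * mu a) ->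
  (forall c, j (iF c) = iF' c) -> (forall a f, h (tens t a f) = tens t' a (j f)) ->
  forall z, contract t' mu (h z) = j (contract t mu z).
Proof.
move=> muD muZ jc hT z.
have D := contractD t muD muZ; have D' := contractD t' muD muZ.
apply: (tens_ext (t := t) (g := contract t' mu \o h) (h := j \o contract t mu)).
- by move=> x y; rewrite /= rmorphD D'.
- by move=> x y; rewrite /= D rmorphD.
- move=> a f; rewrite /= hT (contractT t muD muZ) (contractT t' muD muZ).
  by rewrite rmorphM jc.
Qed.

Section TensorMap.
Variables (k : fieldType) (A F A' F' T T' : comNzRingType).
Variables (iA : {rmorphism k -> A}) (iF : {rmorphism k -> F}).
Variables (iA' : {rmorphism k -> A'}) (iF' : {rmorphism k -> F'}).
Variable t : tensor_product iA iF T.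
Variable t' : tensor_product iA' iF' T'.

Lemma tensor_map_rmorph (u : {rmorphism A -> A'}) (v : {rmorphism F -> F'}) :
  (forall c, u (iA c) = iA' c) -> (forall c, v (iF c) = iF' c) ->
  exists h : {rmorphism T -> T'}, tensor_map t t' u v = h /\
     forall a f, h (tens t a f) = tens t' (u a) (v f).
Proof.
move=> uc vc.
suff : (forall x y, tensor_map t t' u v (x + y) = tensor_map t t' u v x + tensor_map t t' u v y) /\
       (forall a f, tensor_map t t' u v (tens t a f) = tens t' (u a) (v f)).
  move=> [hD hT]; have [|| h hE] := rmorphism_of hD.
  - move=> x y; move: x y; move: (tensor_map _ _ _ _) hD hT => h hD hT x y.
    have h0 : h 0 = 0 by exact/additive0/hD.
    elim/(@tens_ind _ _ _ _ _ _ t): x => [|x x' hx hx'|a f]; first by rewrite mul0r h0 mul0r.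
      by rewrite mulrDl !hD hx hx' mulrDl.
    elim/(@tens_ind _ _ _ _ _ _ t): y => [|y y' hy hy'|b g]; first by rewrite mulr0 h0 mulr0.
      by rewrite mulrDr !hD hy hy' mulrDr.
    by rewrite tensM !hT tensM !rmorphM.
  - by rewrite -(tens11 t) hT !rmorph1 tens11.
  by exists h; split=> // a f; rewrite -hE hT.
rewrite /tensor_map; case: xgetP => // ne; exfalso.
have [|||| h [[hD _ hT] _]] := @tens_universal _ _ _ _ _ _ t
   (restrict_scalars (tensl t' \o iA') T'^o) (fun a f => tens t' (u a) (v f)).
- by move=> *; rewrite rmorphD tensDl.
- by move=> *; rewrite rmorphD tensDr.
- by move=> c a f; rewrite rmorphM uc tens_constl.
- by move=> c a f; rewrite rmorphM vc tens_constr.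
exact: (ne h).
Qed.

End TensorMap.

(** * Inverse limits and adic completions *)

Lemma dependent_choice (I : Type) (X : I -> Type) (P : forall i, X i -> Prop) :
  (forall i, exists x, P i x) -> exists f : forall i, X i, forall i, P i (f i).
Proof.
by move=> H; exists (fun i => projT1 (cid (H i))) => i; case: (cid (H i)).
Qed.

Section InverseLimit.
Variables (S : nat -> comNzRingType) (tr : forall n, S n.+1 -> S n).
Variables (Y : comNzRingType) (l : inverse_limit tr Y).

Lemma lim_ext x y : (forall n, lim_proj l n x = lim_proj l n y) -> x = y.
Proof.
move=> xy; have [z [_ zu]] := @lim_universal _ _ _ l (fun n => lim_proj l n x)
  (fun n => lim_compat l n x).
by rewrite -(zu x) // -(zu y) // => n; rewrite xy.
Qed.

Lemma lim_liftP (X : Type) (h : forall n, X -> S n) x :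
  (forall n, tr (h n.+1 x) = h n x) ->
  forall n, lim_proj l n (lim_lift l h x) = h n x.
Proof.
move=> ht; rewrite /lim_lift; case: xgetP => // ne.
have [y [yP _]] := lim_universal l ht.
by case: (ne y).
Qed.

Lemma lim_lift_rmorph (X : nzRingType) (h : forall n, {rmorphism X -> S n})
    (h' : forall n, X -> S n) :
  (forall n, h' n = h n) -> (forall n x, tr (h n.+1 x) = h n x) ->
  exists g : {rmorphism X -> Y}, lim_lift l h' = g /\
    forall n x, lim_proj l n (g x) = h n x.
Proof.
move=> hh ht; have P x n : lim_proj l n (lim_lift l h' x) = h n x.
  by rewrite lim_liftP ?hh // => m; rewrite !hh.
have [||| g gE] := @rmorphism_of X Y (lim_lift l h').
- by move=> x y; apply: lim_ext => n; rewrite !(P, rmorphD).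
- by move=> x y; apply: lim_ext => n; rewrite !(P, rmorphM).
- by apply: lim_ext => n; rewrite !(P, rmorph1).
by exists g; split=> // n x; rewrite -gE P.
Qed.
End InverseLimit.

Section LimUnit.
Variables (S : nat -> comNzRingType) (tr : forall n, S n.+1 -> S n).
Variables (htr : forall n, {rmorphism S n.+1 -> S n}) (trE : forall n, @tr n = htr n).

(** Inverses are unique, so those chosen level by level are automatically compatible. *)
Lemma lim_unit (Y : comUnitRingType) (l : inverse_limit tr Y) (y : Y) :
  (forall n, exists s, s * lim_proj l n y = 1) -> y \is a GRing.unit.
Proof.
move=> inv; pose s n := xget 0 [set s | s * lim_proj l n y = 1].
have sP n : s n * lim_proj l n y = 1.
  by rewrite /s; case: xgetP => // ne; have [x /ne] := inv n.
have [n|z [zP _]] := @lim_universal _ _ _ l s.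
  have := congr1 (@tr n) (sP n.+1).
  rewrite trE rmorphM rmorph1 -trE lim_compat => h.
  by rewrite -[RHS]mul1r -h trE -!mulrA [lim_proj _ _ _ * _]mulrC sP mulr1.
apply/unitrP; exists z; rewrite [y * z]mulrC; suff -> : z * y = 1 by [].
by apply: (lim_ext (l := l)) => n; rewrite rmorphM zP sP rmorph1.
Qed.
End LimUnit.

Section Quotients.
Variables (A : comNzRingType) (p : idealr A).

HB.instance Definition _ n := GRing.RMorphism.copy (@to_quo A p n) (\pi_(quo p n)%qT).

Lemma to_quo_repr n (x : quo p n) : to_quo p n (repr x) = x.
Proof. exact: reprK. Qed.

Lemma to_quo_eq0 n a : (to_quo p n a == 0) = (a \in ideal_power p n).
Proof.
rewrite -[a in RHS]subr0 /to_quo.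
by rewrite (Quotient.idealrBE (ideal_power p n : idealr A)) rmorph0.
Qed.

Lemma ideal_power_prod n (a : 'I_n.+1 -> A) :
  (forall i, a i \in p) -> \prod_i a i \in ideal_power p n.
Proof.
move=> ap; apply/asboolP; exists 1%N, (fun _ => a); split=> //.
by rewrite big_ord1.
Qed.

Lemma ideal_power0 a : (a \in ideal_power p 0) = (a \in p).
Proof.
apply/idP/idP => [/asboolP [m [b [bp ->]]]|ap].
  by apply: rpred_sum => i _; rewrite big_ord1.
by have := @ideal_power_prod 0 (fun _ => a) (fun _ => ap); rewrite big_ord1.
Qed.

Lemma ideal_powerS n a : a \in ideal_power p n.+1 -> a \in ideal_power p n.
Proof.
move=> /asboolP [m [b [bp ->]]]; apply/asboolP.
(* The first two factors of each product are merged into one. *)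
exists m, (fun i j => if j == ord0 then b i ord0 * b i (lift ord0 j) else b i (lift ord0 j)).
split=> [i j|]; first by case: ifP => // _; exact: idealMr.
apply: eq_bigr => i _; rewrite !big_ord_recl /= mulrA; congr (_ * _).
Qed.

(** As [ideal_power p n] stands for p^(n+1), the index of the product is n + m + 1. *)
Lemma ideal_powerM n m a b :
  a \in ideal_power p n -> b \in ideal_power p m -> a * b \in ideal_power p (n + m).+1.
Proof.
move=> /asboolP [m1 [u [up ->]]] /asboolP [m2 [v [vp ->]]].
rewrite mulr_suml; apply: rpred_sum => i _; rewrite mulr_sumr; apply: rpred_sum => j _.
have e : (n.+1 + m.+1)%N = (n + m).+2 by rewrite addSn addnS.
pose w (s : 'I_(n.+1 + m.+1)) := match fintype.split s with inl s => u i s | inr s => v j s end.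
have -> : (\prod_j0 u i j0) * \prod_j0 v j j0 = \prod_s w s.
  rewrite big_split_ord /w; congr (_ * _); apply: eq_bigr => s _.
    by rewrite (unsplitK (inl s : _ + 'I_m.+1)).
  by rewrite (unsplitK (inr s : 'I_n.+1 + _)).
have wp s : w s \in p by rewrite /w; case: fintype.split.
by move: w wp; rewrite e => w wp; exact: ideal_power_prod.
Qed.

Lemma ideal_power_exp n a : a \in p -> a ^+ n.+1 \in ideal_power p n.
Proof.
move=> ap; have := @ideal_power_prod n (fun _ => a) (fun _ => ap).
by rewrite prodr_const card_ord.
Qed.

Lemma quo_trans_to_quo n a : quo_trans (to_quo p n.+1 a) = to_quo p n a.
Proof.
apply/eqP; rewrite /quo_trans -subr_eq0 -rmorphB to_quo_eq0; apply: ideal_powerS.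
by rewrite -to_quo_eq0 rmorphB /= to_quo_repr subrr.
Qed.

Lemma quo_ind n (P : quo p n -> Prop) : (forall a, P (to_quo p n a)) -> forall x, P x.
Proof. by move=> h x; rewrite -(to_quo_repr x). Qed.

Fact quo_trans_is_zmod_morphism n : zmod_morphism (@quo_trans A p n).
Proof.
move=> x y; elim/quo_ind: x => a; elim/quo_ind: y => b.
by rewrite -rmorphB !quo_trans_to_quo rmorphB.
Qed.
Fact quo_trans_is_monoid_morphism n : monoid_morphism (@quo_trans A p n).
Proof.
split=> [|x y]; first by rewrite -(rmorph1 (to_quo p n.+1)) quo_trans_to_quo rmorph1.
elim/quo_ind: x => a; elim/quo_ind: y => b.
by rewrite -rmorphM !quo_trans_to_quo rmorphM.
Qed.
HB.instance Definition _ n := GRing.isZmodMorphism.Build _ _ (@quo_trans A p n)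
  (@quo_trans_is_zmod_morphism n).
HB.instance Definition _ n := GRing.isMonoidMorphism.Build _ _ (@quo_trans A p n)
  (@quo_trans_is_monoid_morphism n).

Variables (k : fieldType) (iA : {rmorphism k -> A}).
HB.instance Definition _ n := GRing.RMorphism.copy (quo_const iA p n) (to_quo p n \o iA).

Lemma quo_trans_const n c : quo_trans (quo_const iA p n.+1 c) = quo_const iA p n c.
Proof. exact: quo_trans_to_quo. Qed.

Section Completion.
Variables (Ap : comNzRingType) (l : adic_ring p Ap).

Lemma to_adic_rmorph : exists h : {rmorphism A -> Ap}, to_adic l = h /\
  forall n a, lim_proj l n (h a) = to_quo p n a.
Proof.
exact: (@lim_lift_rmorph _ _ _ l A (fun n => to_quo p n) (to_quo p)
  (fun _ => erefl) quo_trans_to_quo).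
Qed.

Lemma to_adicE n a : lim_proj l n (to_adic l a) = to_quo p n a.
Proof. by have [h [-> ->]] := to_adic_rmorph. Qed.

End Completion.
End Quotients.

Section AdicTensor.
Variables (k : fieldType) (A : comNzRingType) (iA : {rmorphism k -> A}) (p : idealr A).

Section One.
Variables (F : comNzRingType) (iF : {rmorphism k -> F}).
Variables (Y : comNzRingType) (t : adic_tensor iA p iF Y).

Lemma adic_trans_rmorph : exists h : forall n, {rmorphism level t n.+1 -> level t n},
  forall n, tensor_map (level_tensor t n.+1) (level_tensor t n) (@quo_trans A p n) id = h n
   /\ forall a f, h n (tens (level_tensor t n.+1) a f) = tens (level_tensor t n) (quo_trans a) f.
Proof.
have H n : exists h : {rmorphism level t n.+1 -> level t n},
   tensor_map (level_tensor t n.+1) (level_tensor t n) (@quo_trans A p n) id = h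
   /\ forall a f, h (tens (level_tensor t n.+1) a f) = tens (level_tensor t n) (quo_trans a) f.
  have [||h hP] := tensor_map_rmorph (level_tensor t n.+1) (level_tensor t n)
    (u := @quo_trans A p n) (v := idfun); last by exists h.
  - by move=> c; exact: quo_trans_const.
  - by [].
by have [h hP] := dependent_choice H; exists h.
Qed.

Variables (Ap : comNzRingType) (l : adic_ring p Ap).

Lemma adic_incl_rmorph : exists h : {rmorphism Ap -> Y}, adic_incl l t = h /\
  forall n x, lim_proj (level_limit t) n (h x) = tensl (level_tensor t n) (lim_proj l n x).
Proof.
have [h hP] := adic_trans_rmorph.
have [|g gP] := @lim_lift_rmorph _ _ _ (level_limit t) Ap
   (fun n => tensl (level_tensor t n) \o lim_proj l n)
   (fun n x => tensl (level_tensor t n) (lim_proj l n x)) (fun _ => erefl); last by exists g.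
move=> n x /=; rewrite (hP n).1 -tens1r (hP n).2 tens1r.
by rewrite lim_compat.
Qed.
End One.

Lemma adic_unit (F : comNzRingType) (iF : {rmorphism k -> F}) (Y : comUnitRingType)
    (t : adic_tensor iA p iF Y) (y : Y) :
  (forall n, exists s, s * lim_proj (level_limit t) n y = 1) -> y \is a GRing.unit.
Proof.
have [h hP] := adic_trans_rmorph t.
exact: (@lim_unit _ _ h (fun n => (hP n).1) Y (level_limit t)).
Qed.

Section Map.
Variables (F F' : comNzRingType) (iF : {rmorphism k -> F}) (iF' : {rmorphism k -> F'}).
Variables (Y Y' : comNzRingType) (t : adic_tensor iA p iF Y) (t' : adic_tensor iA p iF' Y').

(** [G] is the limit of the maps [id \otimes g]. This relation replaces the chosen map [adic_map] in
    the arguments below: it composes, and it determines [G]. *)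
Definition levelwise (g : F -> F') (G : Y -> Y') (h : forall n, level t n -> level t' n) : Prop :=
  forall n, (forall a f, h n (tens (level_tensor t n) a f) = tens (level_tensor t' n) a (g f)) /\
   forall y, lim_proj (level_limit t') n (G y) = h n (lim_proj (level_limit t) n y).

Lemma adic_map_rmorph (g : {rmorphism F -> F'}) : (forall c, g (iF c) = iF' c) ->
  exists (G : {rmorphism Y -> Y'}) (h : forall n, {rmorphism level t n -> level t' n}),
    adic_map t t' g = G /\ levelwise g G h.
Proof.
move=> gc; have H n : exists h : {rmorphism level t n -> level t' n},
   tensor_map (level_tensor t n) (level_tensor t' n) id g = h
   /\ forall a f, h (tens (level_tensor t n) a f) = tens (level_tensor t' n) a (g f).
  by have [||h hP] := tensor_map_rmorph (level_tensor t n) (level_tensor t' n)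
    (u := idfun) (v := g); last exists h.
have [h hP] := dependent_choice H.
have [r rP] := adic_trans_rmorph t; have [r' rP'] := adic_trans_rmorph t'.
have [||G [GE GP]] := @lim_lift_rmorph _ _ _ (level_limit t') Y
   (fun n => h n \o lim_proj (level_limit t) n) (fun n y =>
    tensor_map (level_tensor t n) (level_tensor t' n) id g
      (lim_proj (level_limit t) n y)).
- by move=> n; rewrite (hP n).1.
- move=> n x /=; rewrite (rP' n).1 -(lim_compat _ n x) (rP n).1.
  move: (lim_proj _ _ _) => z.
  apply: (tens_rmorph_ext (t := level_tensor t n.+1) (g := r' n \o h n.+1) (h := h n \o r n)) => a f /=.
  by rewrite (hP n.+1).2 (rP' n).2 (rP n).2 (hP n).2.
exists G, h; split=> // n; split; first exact: (hP n).2.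
by move=> y; rewrite GP.
Qed.

End Map.
End AdicTensor.

(** * Semilocal rings *)

Lemma frac_repr (S : idomainType) (x : {fraction S}) :
  exists a b : S, b != 0 /\ x = tofrac a / tofrac b.
Proof.
exists (frac (repr x)).1, (frac (repr x)).2.
have b0 := denom_ratioP (repr x); split=> //.
apply: (canRL (mulfK _)); first by rewrite tofrac_eq0.
rewrite -[X in X * _ = _](reprK x) /tofrac; unlock FracField.tofrac.
transitivity (FracField.mul (\pi_(FracField.type S) (repr x))%qT
  (\pi_(FracField.type S) (Ratio (frac (repr x)).2 1))%qT) => //.
rewrite -FracField.pi_mul; apply/eqP; rewrite FracField.equivf_def.
by rewrite /FracField.mulf !numden_Ratio ?oner_neq0 ?mulr1 ?mulf_neq0 ?oner_neq0 // mulrC.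
Qed.

Lemma frac_eqE (S : idomainType) (a b c d : S) : b != 0 -> d != 0 ->
  tofrac a / tofrac b = tofrac c / tofrac d -> a * d = c * b.
Proof.
move=> b0 d0 /eqP; rewrite eqr_div ?tofrac_eq0 // -!rmorphM tofrac_eq.
by move/eqP.
Qed.

(** Zorn's lemma gives an ideal [Q] maximal among the proper ones. If u is not in [Q] then [Q + S u]
    contains 1; multiplying this by v shows that u v in [Q] forces v in [Q]. *)
Lemma exists_prime_idealr (S : comNzRingType) (I : set S) :
  I 0 -> (forall x y, I x -> I y -> I (x + y)) -> (forall a x, I x -> I (a * x)) ->
  ~ I 1 -> exists q : prime_idealr S, forall x, I x -> x \in q.
Proof.
move=> I0 ID IM I1.
pose P X := [/\ forall x y, X x -> X y -> X (x + y),
  forall c x, X x -> X (c * x), I `<=` X & ~ X 1].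
have [|F [X0 FX0] FP totF|Q [[QD QM IQ Q1] maxQ]] := @zorn_nonempty _ P I.
- by split.
- split.
  + move=> x y [X FX Xx] [Y FY Yy].
    case: (totF X Y FX FY) => s; [exists Y | exists X] => //.
      by case: (FP Y FY) => D _ _ _; apply: D => //; exact: s.
    by case: (FP X FX) => D _ _ _; apply: D => //; exact: s.
  + by move=> c x [X FX Xx]; exists X => //; case: (FP X FX) => _ Z _ _; exact: Z.
  + by move=> x Hx; exists X0 => //; case: (FP X0 FX0) => _ _ s _; exact: s.
  + by move=> [X FX Xz]; case: (FP X FX).
pose q : S -> bool := fun x => `[< Q x >].
have qi : idealr_closed q.
  split; first by apply/asboolP; exact: IQ.
    by apply/asboolPn.
  by move=> a x y /asboolP Qx /asboolP Qy; apply/asboolP; apply: QD => //; exact: QM.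
have qp : prime_idealr_closed q.
  move=> u v /asboolP Quv; apply/orP.
  have [Qu|nQu] := pselect (Q u); first by left; apply/asboolP.
  right; apply/asboolP.
  pose B y := exists a c, Q a /\ y = a + c * u.
  have sQB : Q `<=` B by move=> a Qa; exists a, 0; rewrite mul0r addr0.
  have [[a [c [Qa e]]]|nB1] := pselect (B 1).
    rewrite -[v]mul1r e mulrDl -mulrA; apply: QD; last exact: QM.
    by rewrite mulrC; exact: QM.
  have PB : P B.
    split=> //.
    - move=> y y' [a [c [Aa ->]]] [a' [c' [Aa' ->]]].
      exists (a + a'), (c + c'); split; first exact: QD.
      by rewrite mulrDl addrACA.
    - move=> d y [a [c [Aa ->]]]; exists (d * a), (d * c).
      by split; [exact: QM | rewrite mulrDr mulrA].
    - by move=> y /IQ /sQB.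
  have Bu : B u by exists 0, 1; rewrite mul1r add0r; split=> //; exact: IQ.
  by case: nQu; rewrite -(maxQ B sQB PB).
exists (HB.pack_for (prime_idealr S) q (isIdealr.Build S q qi)
  (isPrimeIdealrClosed.Build S q qp)).
by move=> x Ix; apply/asboolP; exact: IQ.
Qed.

Section Generated.
Variables (S : comNzRingType) (P : set S).

Definition generated_ideal : set S := fun z =>
  exists2 s : seq (S * S), (forall x, x \in s -> P x.2) & z = \sum_(x <- s) x.1 * x.2.

Lemma generated_ideal0 : generated_ideal 0.
Proof. by exists [::] => [x|]; rewrite ?in_nil ?big_nil. Qed.
Lemma generated_idealD x y :
  generated_ideal x -> generated_ideal y -> generated_ideal (x + y).
Proof.
move=> [s sP ->] [s' sP' ->]; exists (s ++ s'); last by rewrite big_cat.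
by move=> z; rewrite mem_cat => /orP[/sP|/sP'].
Qed.
Lemma generated_idealM a x : generated_ideal x -> generated_ideal (a * x).
Proof.
move=> [s sP ->]; exists [seq (a * z.1, z.2) | z <- s].
  by move=> _ /mapP [z zs ->]; exact: (sP z).
by rewrite big_map mulr_sumr; apply: eq_bigr => i _; rewrite mulrA.
Qed.
Lemma generated_ideal_mem x : P x -> generated_ideal x.
Proof.
move=> Px; exists [:: (1, x)]; last by rewrite big_seq1 mul1r.
by move=> z; rewrite inE => /eqP ->.
Qed.
Lemma generated_ideal_sub (q : idealr S) : (forall x, P x -> x \in q) ->
  forall x, generated_ideal x -> x \in q.
Proof.
move=> Pq x [s sP ->]; rewrite big_seq; apply: rpred_sum => z /sP /Pq.
exact: idealMr.
Qed.
End Generated.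

Lemma generated_ideal_map (S S' : comNzRingType) (P : set S) (P' : set S')
    (f : {rmorphism S -> S'}) : (forall s, P s -> P' (f s)) ->
  forall x, generated_ideal P x -> generated_ideal P' (f x).
Proof.
move=> fP x [s sP ->]; exists [seq (f z.1, f z.2) | z <- s].
  by move=> _ /mapP [z /sP zs ->]; exact: (fP z.2).
by rewrite big_map rmorph_sum; apply: eq_bigr => i _; rewrite rmorphM.
Qed.

(** The power w^(m+1) is a combination of values [v a] with a in p^(m+1), and for m = n these
    vanish. *)
Lemma generated_ideal_nilpotent (A S Z : comNzRingType) (p : idealr A) (i : A -> S)
    (h : {rmorphism S -> Z}) (n : nat) (v : {rmorphism A -> Z}) :
  (forall a, h (i a) = v a) -> (forall a, a \in ideal_power p n -> v a = 0) ->
  forall z, generated_ideal (ideal_image i p) z -> h z ^+ n.+1 = 0.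
Proof.
move=> hi vn z [s sP ->].
have {sP} : generated_ideal [set v a | a in [set` p]] (h (\sum_(x <- s) x.1 * x.2)).
  exists [seq (h z.1, h z.2) | z <- s].
    by move=> _ /mapP [x /sP [a ap xa] ->]; exists a => //=; rewrite xa hi.
  by rewrite big_map rmorph_sum; apply: eq_bigr => j _; rewrite rmorphM.
move: (h _) => w wP.
suff H m : generated_ideal [set v a | a in [set` ideal_power p m]] (w ^+ m.+1).
  have [t tP ->] := H n; rewrite big_seq big1 // => x /tP [a ap <-].
  by rewrite vn ?mulr0.
elim: m => [|m [t tP IH]].
  rewrite expr1; case: wP => t tP ->; exists t => // x /tP [a ap <-].
  by exists a => //; rewrite /= ideal_power0.
rewrite exprSr IH; case: wP => u uP ->.
have -> : (\sum_(x <- t) x.1 * x.2) * (\sum_(y <- u) y.1 * y.2) =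
   \sum_(x <- t) \sum_(y <- u) (x.1 * y.1) * (x.2 * y.2).
  rewrite mulr_suml; apply: eq_bigr => x _; rewrite mulr_sumr; apply: eq_bigr => y _.
  by rewrite mulrACA.
rewrite big_seq; elim/big_ind: _ => [||x xt]; first exact: generated_ideal0.
  exact: generated_idealD.
rewrite big_seq; elim/big_ind: _ => [||y yu]; first exact: generated_ideal0.
  exact: generated_idealD.
apply: generated_idealM; apply: generated_ideal_mem.
have [a ap <-] := tP x xt; have [b bp <-] := uP y yu.
exists (a * b); last by rewrite rmorphM.
rewrite /= -[m]addn0; apply: ideal_powerM => //.
by rewrite ideal_power0.
Qed.

Section Semilocal.
Variables (S : idomainType) (P : set S).

(** The ideal of denominators of [x] together with [P] lies in no prime containing [P], hence
    contains 1 = d + g. The denominator d is then 1 modulo the ideal generated by [P], uniformly for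
    all these primes. *)
Lemma semilocal_frac (x : semilocal P) : exists a b : S,
  [/\ b != 0, generated_ideal P (1 - b) & val x = tofrac a / tofrac b].
Proof.
pose D b := exists a, val x * tofrac b = tofrac a.
have DD u v : D u -> D v -> D (u + v).
  by move=> [a ea] [b eb]; exists (a + b); rewrite !rmorphD /= -ea -eb mulrDr.
have DM c u : D u -> D (c * u).
  by move=> [a ea]; exists (c * a); rewrite !rmorphM /= -ea mulrCA.
have [a0 [b0 [b0nz xE]]] := frac_repr (val x).
have Db0 : D b0 by exists a0; rewrite xE mulfVK // tofrac_eq0.
have key b : D b -> b != 0 -> exists a, val x = tofrac a / tofrac b.
  move=> [a e] bnz; exists a; rewrite -e mulfK // tofrac_eq0 //.
pose I z := exists d g, [/\ D d, generated_ideal P g & z = d + g].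
have [[d [g [Dd Pg e]]]|nI1] := pselect (I 1).
  (* Here 1 itself is in the ideal generated by [P], so every denominator qualifies. *)
  have [d0|dnz] := eqVneq d 0.
    exists a0, b0; split=> //; rewrite -[1 - b0]mulr1; apply: generated_idealM.
    by rewrite e d0 add0r.
  have [a xa] := key d Dd dnz; exists a, d; split=> //.
  by rewrite e addrC addKr.
have [||||q qI] := @exists_prime_idealr S I.
- exists 0, 0; split; last by rewrite addr0.
    by exists 0; rewrite rmorph0 mulr0.
  exact: generated_ideal0.
- move=> _ _ [d [g [Dd gP ->]]] [d' [g' [Dd' gP' ->]]].
  exists (d + d'), (g + g'); split; [exact: DD|exact: generated_idealD|].
  by rewrite addrACA.
- move=> a _ [d [g [Dd gP ->]]].
  exists (a * d), (a * g); split; [exact: DM|exact: generated_idealM|].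
  by rewrite mulrDr.
- by [].
have [|a [b [bq e]]] := asboolP _ (valP x) q.
  move=> s Ps; apply: qI; exists 0, s; split; last by rewrite add0r.
    by exists 0; rewrite rmorph0 mulr0.
  exact: generated_ideal_mem.
case/negP: bq; apply: qI; exists b, 0; split; last by rewrite addr0.
  have [->|bnz] := eqVneq b 0; first by exists 0; rewrite rmorph0 mulr0.
  by exists a; rewrite e mulfVK // tofrac_eq0.
exact: generated_ideal0.
Qed.

Fact to_semilocal_is_zmod_morphism : zmod_morphism (@to_semilocal S P).
Proof. by move=> x y; apply: val_inj; rewrite /= !rmorphB. Qed.
Fact to_semilocal_is_monoid_morphism : monoid_morphism (@to_semilocal S P).
Proof. by split=> [|x y]; apply: val_inj; rewrite /= ?rmorph1 ?rmorphM. Qed.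
HB.instance Definition _ := GRing.isZmodMorphism.Build _ _ (@to_semilocal S P)
  to_semilocal_is_zmod_morphism.
HB.instance Definition _ := GRing.isMonoidMorphism.Build _ _ (@to_semilocal S P)
  to_semilocal_is_monoid_morphism.

Lemma semilocal_mul_denom (x : semilocal P) (a b : S) : b != 0 ->
  val x = tofrac a / tofrac b -> x * to_semilocal P b = to_semilocal P a.
Proof. by move=> b0 e; apply: val_inj; rewrite rmorphM /= e mulfVK // tofrac_eq0. Qed.

(** Denominators that are 1 modulo [P] become units and define [rho]. The formula is multiplied out
    so that it holds for every fraction, even when [eta b] is not invertible, as in
    [tate_semilocal_to_adic]. *)
Lemma semilocal_extend (Y : comUnitRingType) (eta : {rmorphism S -> Y}) :
  (forall b, generated_ideal P (1 - b) -> eta b \is a GRing.unit) ->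
  exists rho : {rmorphism semilocal P -> Y}, forall (x : semilocal P) (a b : S), b != 0 ->
    val x = tofrac a / tofrac b -> rho x * eta b = eta a.
Proof.
move=> eu.
have H (x : semilocal P) : exists y, forall a b : S, b != 0 -> val x = tofrac a / tofrac b -> y * eta b = eta a.
  have [a [b [bnz gb xE]]] := semilocal_frac x.
  exists (eta a / eta b) => c d dnz xE'.
  apply: (mulIr (eu b gb)); rewrite mulrAC divrK ?eu // -!rmorphM.
  by congr (eta _); apply: frac_eqE => //; rewrite -xE -xE'.
have [rho rhoP] := choice H.
have main (x : semilocal P) y z b c a : generated_ideal P (1 - b) -> generated_ideal P (1 - c) ->
   b != 0 -> c != 0 -> val x = tofrac a / tofrac (b * c) ->
   z * eta (b * c) = eta a -> y = z -> rho x = y.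
  move=> gb gc b0 c0 xE zE ->; have := rhoP x a (b * c) (mulf_neq0 b0 c0) xE.
  rewrite -zE !rmorphM !mulrA => /(mulIr (eu c gc)).
  exact: (mulIr (eu b gb)).
have [|||r rE] := @rmorphism_of _ _ rho.
- move=> x y.
  have [a [b [b0 gb xE]]] := semilocal_frac x; have [c [d [d0 gd yE]]] := semilocal_frac y.
  apply: (@main _ _ _ b d (a * d + c * b)) (erefl _) => //.
    by rewrite raddfD /= xE yE addf_div ?tofrac_eq0 // rmorphD !rmorphM.
  rewrite mulrDl rmorphD !rmorphM -(rhoP _ _ _ b0 xE) -(rhoP _ _ _ d0 yE); congr (_ + _).
    by rewrite mulrA.
  by rewrite mulrA mulrAC.
- move=> x y.
  have [a [b [b0 gb xE]]] := semilocal_frac x; have [c [d [d0 gd yE]]] := semilocal_frac y.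
  apply: (@main _ _ _ b d (a * c)) (erefl _) => //.
    by rewrite rmorphM /= xE yE mulf_div !rmorphM.
  by rewrite !rmorphM -(rhoP _ _ _ b0 xE) -(rhoP _ _ _ d0 yE) mulrACA.
- have := rhoP 1 1 1 (oner_neq0 _); rewrite rmorph1 mulr1; apply.
  by rewrite /= rmorph1 divr1.
by exists r => x a b; rewrite -rE; exact: rhoP.
Qed.

Lemma semilocal_rmorph_ext (Y : comUnitRingType) (f g : {rmorphism semilocal P -> Y}) :
  (forall b, generated_ideal P (1 - b) -> f (to_semilocal P b) \is a GRing.unit) ->
  (forall s, f (to_semilocal P s) = g (to_semilocal P s)) -> forall x, f x = g x.
Proof.
move=> fu fg x; have [a [b [b0 gb xE]]] := semilocal_frac x.
apply: (mulIr (fu b gb)); rewrite [in RHS]fg -!rmorphM.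
by rewrite (semilocal_mul_denom b0 xE) fg.
Qed.

(* [b * \sum_(i < n) (1 - b) ^+ i = 1 - (1 - b) ^+ n], so b is invertible modulo
   the n-th power of any ideal containing 1 - b. *)
Lemma semilocal_approx (Z : comNzRingType) (h : {rmorphism semilocal P -> Z}) (n : nat) :
  (forall z, generated_ideal P z -> h (to_semilocal P z) ^+ n = 0) ->
  forall x, exists s, h x = h (to_semilocal P s).
Proof.
move=> hn x; have [a [b [b0 gb xE]]] := semilocal_frac x.
exists (a * \sum_(i < n) (1 - b) ^+ i).
have -> : to_semilocal P (a * \sum_(i < n) (1 - b) ^+ i) =
    x * to_semilocal P (b * \sum_(i < n) (1 - b) ^+ i).
  by rewrite [in LHS]rmorphM [in RHS]rmorphM /= -(semilocal_mul_denom b0 xE) mulrA.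
have -> : b * (\sum_(i < n) (1 - b) ^+ i) = 1 - (1 - b) ^+ n.
  have := subrX1 (1 - b) n; rewrite addrAC subrr add0r mulNr.
  by move/(congr1 -%R); rewrite opprK opprB.
rewrite [in RHS]rmorphM; suff -> : h (to_semilocal P (1 - (1 - b) ^+ n)) = 1 by rewrite mulr1.
rewrite (rmorphB (to_semilocal P)) rmorph1 (rmorphXn (to_semilocal P)).
by rewrite (rmorphB h) rmorph1 (rmorphXn h) /= hn // subr0.
Qed.

End Semilocal.

Lemma semilocal_map_rmorph (S S' : idomainType) (P : set S) (P' : set S')
    (f : {rmorphism S -> S'}) : injective f -> (forall s, P s -> P' (f s)) ->
  exists h : {rmorphism semilocal P -> semilocal P'},
    semilocal_map P' f = h /\ forall s, h (to_semilocal P s) = to_semilocal P' (f s).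
Proof.
move=> fi fP.
have f0 b : b != 0 -> tofrac (f b) != 0.
  by rewrite tofrac_eq0 -(rmorph0 f) (inj_eq fi).
have H (x : semilocal P) (a b : S) : b != 0 -> val x = tofrac a / tofrac b ->
    val (semilocal_map (P := P) P' f x) = tofrac (f a) / tofrac (f b).
  rewrite /semilocal_map; case: xgetP => [y _ yP|ne]; first exact: yP.
  exfalso; have [c [d [d0 gd xE]]] := semilocal_frac x.
  (* Since d is 1 modulo [P], its image is 1 modulo [P'] and avoids every prime containing [P']. *)
  have sl : semilocal_set P' (tofrac (f c) / tofrac (f d)).
    apply/asboolP => q qP'; exists (f c), (f d); split=> //.
    apply/negP => fdq; have : 1 \in q.
      rewrite -(rmorph1 f) -[1](subrK d) rmorphD; apply: rpredD => //.
      apply: (generated_ideal_sub (P := P')) => //.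
      exact: (generated_ideal_map fP).
    by rewrite idealr1.
  apply: (ne (Sub _ sl)) => a' b' b'0 xE' /=.
  apply/eqP; rewrite eqr_div ?f0 // -!rmorphM; apply/eqP; congr (tofrac (f _)).
  by apply: frac_eqE => //; rewrite -xE.
have [|||h hE] := @rmorphism_of _ _ (semilocal_map (P := P) P' f).
- move=> x y; have [a [b [b0 _ xE]]] := semilocal_frac x.
  have [c [d [d0 _ yE]]] := semilocal_frac y; apply: val_inj.
  rewrite raddfD /= (H _ _ _ b0 xE) (H _ _ _ d0 yE) addf_div ?f0 //.
  rewrite (@H _ (a * d + c * b) (b * d)) ?mulf_neq0 // ?rmorphD ?rmorphM //.
  by rewrite /= xE yE addf_div ?tofrac_eq0 // !rmorphM.
- move=> x y; have [a [b [b0 _ xE]]] := semilocal_frac x.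
  have [c [d [d0 _ yE]]] := semilocal_frac y; apply: val_inj.
  rewrite rmorphM /= (H _ _ _ b0 xE) (H _ _ _ d0 yE) mulf_div.
  rewrite (@H _ (a * c) (b * d)) ?mulf_neq0 // ?rmorphM //.
  by rewrite /= xE yE mulf_div.
- apply: val_inj; rewrite (@H _ 1 1) ?oner_neq0 // ?rmorph1 ?divr1 //=.
exists h; split=> // s; apply: val_inj; rewrite -hE (@H _ s 1) ?oner_neq0 //=.
  by rewrite !rmorph1 divr1.
by rewrite rmorph1 divr1.
Qed.

(** * Gauss norms *)

Section BasisCoordinates.
Variables (k : fieldType) (A : comNzRingType) (iA : {rmorphism k -> A}).

Definition basis_coord (B : set A) (coord : A -> A -> k) : Prop :=
  [/\ forall b, B b -> (forall x y, coord b (x + y) = coord b x + coord b y) /\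
        (forall c x, coord b (iA c * x) = c * coord b x),
      forall b b', B b -> B b' -> coord b b' = (b' == b)%:R &
      forall x, exists s : seq A, [/\ uniq s, {in s, forall a, B a} &
        x = \sum_(a <- s) iA (coord a x) * a]].

(** The coordinate at [b] is a functional that separates [b] from the span of the other basis
    vectors. *)
Lemma basis_coord_exists (B : set A) : is_basis iA B -> exists coord, basis_coord B coord.
Proof.
move=> [Bfree Bspan].
pose A' : lmodType k := restrict_scalars iA A^o.
have H b : exists phi : A -> k, B b -> [/\ forall x y, phi (x + y) = phi x + phi y,
    forall c x, phi (iA c * x) = c * phi x & forall b', B b' -> phi b' = (b' == b)%:R].
  have [Bb|nB] := pselect (B b); last by exists (fun=> 0).
  pose Hb : set A' := fun z => exists2 s : seq (k * A),
    (forall x, x \in s -> B x.2 /\ x.2 != b) & z = \sum_(x <- s) iA x.1 * x.2.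
  have [||||phi [phiD phiZ phiH phib]] := @separating_functional k A' Hb b.
  - move=> _ _ [s sP ->] [s' sP' ->]; exists (s ++ s'); last by rewrite big_cat.
    by move=> x; rewrite mem_cat => /orP[/sP|/sP'].
  - move=> c _ [s sP ->]; exists [seq (c * x.1, x.2) | x <- s].
      by move=> _ /mapP [x /sP xP ->].
    rewrite big_map restrict_scalarsE scaler_sumr; apply: eq_bigr => x _ /=.
    by rewrite rmorphM -mulrA.
  - by exists [::] => [x|]; rewrite ?in_nil ?big_nil.
  - move=> [s sP be].
    (* If [b] were a combination of the others, collecting equal vectors would give a relation with
       coefficient -1 at [b]. *)
    pose u := undup [seq x.2 | x <- s].
    pose c a := if a == b then -1 else \sum_(x <- s | x.2 == a) x.1.
    have bu : b \notin u.
      by rewrite mem_undup; apply/negP => /mapP [x /sP [_ xb] e]; rewrite e eqxx in xb.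
    have := Bfree (b :: u) c; rewrite /= bu undup_uniq => /(_ isT) h.
    have {}h := h _ _ b (mem_head _ _).
    have : c b = 0.
      apply: h.
        move=> a; rewrite inE mem_undup => /predU1P [->//|/mapP [x /sP [Bx _] ->]].
        exact: Bx.
      rewrite big_cons {1}/c eqxx rmorphN1 mulN1r {1}be.
      have -> : \sum_(x <- s) iA x.1 * x.2 =
                \sum_(x <- s) \sum_(a <- u | a == x.2) iA x.1 * a.
        apply: eq_big_seq => x xs.
        rewrite -big_filter (_ : filter _ u = [:: x.2]) ?big_seq1 //.
        by apply: filter_pred1_uniq; rewrite ?undup_uniq // mem_undup; apply/mapP; exists x.
      rewrite (exchange_big_dep xpredT) //= addrC; apply/eqP; rewrite subr_eq0; apply/eqP.
      apply: eq_big_seq => a au; rewrite /c ifN; last by apply: contraNneq bu => <-.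
      rewrite rmorph_sum mulr_suml; apply: eq_bigl => x.
      by rewrite eq_sym.
    by rewrite /c eqxx => /eqP; rewrite oppr_eq0 oner_eq0.
  exists phi => _; split=> //.
  move=> b' Bb'; have [->//|bb'] := eqVneq b' b; rewrite phiH //.
  exists [:: (1, b')]; last by rewrite big_seq1 rmorph1 mul1r.
  by move=> x; rewrite inE => /eqP ->.
have [coord cP] := choice H; exists coord; split.
- by move=> b Bb; have [] := cP b Bb.
- by move=> b b' Bb; have [_ _] := cP b Bb; apply.
- move=> x; have [s [c [us sB xE]]] := Bspan x; exists s; split=> //.
  rewrite {1}xE; apply: eq_big_seq => a sa; congr (iA _ * _).
  have [aD aZ ab] := cP a (sB a sa).
  have a0 : coord a 0 = 0 by rewrite -(mul0r 0) -(rmorph0 iA) aZ mul0r.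
  rewrite xE (big_morph _ aD a0) (bigD1_seq a) //= aZ ab ?eqxx ?mulr1; last exact: sB.
  rewrite big_seq_cond big1 ?addr0 // => b /andP[sb ba].
  by rewrite aZ ab ?(negPf ba) ?mulr0; last exact: sB.
Qed.

End BasisCoordinates.

Section Gauss.
Variable R : realType.
Variables (k : fieldType) (A F T : comNzRingType).
Variables (iA : {rmorphism k -> A}) (iF : {rmorphism k -> F}).
Variable t : tensor_product iA iF T.
Variable abs : F -> R.
Hypothesis abs_ultra : ultrametric_norm abs.
Hypothesis absM : forall x y, abs (x * y) = abs x * abs y.
Hypothesis abs_const : forall c, abs (iF c) <= 1.
Variables (B : set A) (coord : A -> A -> k).
Hypothesis BP : basis_coord iA B coord.

Local Notation contr b := (contract t (coord b)).
Local Notation N := (gauss_norm t abs B).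

Let cD b (Bb : B b) : forall x y, coord b (x + y) = coord b x + coord b y.
Proof. by case: BP => h _ _; case: (h b Bb). Qed.
Let cZ b (Bb : B b) : forall c x, coord b (iA c * x) = c * coord b x.
Proof. by case: BP => h _ _; case: (h b Bb). Qed.
Let cB b b' (Bb : B b) (Bb' : B b') : coord b b' = (b' == b)%:R.
Proof. by case: BP => _ h _; apply: h. Qed.

Lemma contract_sum_basis (s : seq A) (c : A -> F) b : uniq s -> {in s, forall a, B a} ->
  B b -> contr b (\sum_(a <- s) tens t a (c a)) = if b \in s then c b else 0.
Proof.
move=> us sB Bb; have CT := contractT t (cD Bb) (cZ Bb).
rewrite (contract_sum t (cD Bb) (cZ Bb)).
case: ifP => bs; last first.
  rewrite big_seq big1 // => a sa; rewrite CT cB //; last exact: sB.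
  by rewrite (_ : a == b = false) ?rmorph0 ?mul0r //; apply: contraFF bs => /eqP <-.
rewrite (bigD1_seq b) //= CT cB // eqxx rmorph1 mul1r.
rewrite big_seq_cond big1 ?addr0 // => a /andP[sa ab].
by rewrite CT cB ?(negPf ab) ?rmorph0 ?mul0r //; exact: sB.
Qed.

Lemma tens_basis_sum x : exists s : seq A, [/\ uniq s, {in s, forall a, B a} &
   x = \sum_(a <- s) tens t a (contr a x)].
Proof.
have ext (s s' : seq A) y : uniq s -> uniq s' -> {in s, forall a, B a} ->
   {in s', forall a, B a} ->
   {subset s <= s'} -> y = \sum_(a <- s) tens t a (contr a y) ->
   y = \sum_(a <- s') tens t a (contr a y).
  move=> us us' sB sB' ss' yE; rewrite {1}yE.
  have -> : \sum_(a <- s) tens t a (contr a y) =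
            \sum_(a <- s' | a \in s) tens t a (contr a y).
    rewrite -[RHS]big_filter; apply: perm_big; apply: uniq_perm => //.
      exact: filter_uniq.
    by move=> a; rewrite mem_filter; case: (boolP (a \in s)) => //= /ss' ->.
  rewrite big_mkcond /=; apply: eq_big_seq => a as'; case: ifP => // ns.
  by rewrite [in RHS]yE (contract_sum_basis _ us sB (sB' a as')) ns tens0r.
elim/(@tens_ind _ _ _ _ _ _ t): x => [|x y [s [us sB xE]] [s' [us' sB' yE]]|a f].
- by exists [::]; split; rewrite // big_nil.
- have sB'' : {in undup (s ++ s'), forall a, B a}.
    by move=> a; rewrite mem_undup mem_cat => /orP[/sB|/sB'].
  exists (undup (s ++ s')); split; rewrite ?undup_uniq //.
  rewrite {1}(ext s (undup (s ++ s')) x) ?undup_uniq //; last first.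
    by move=> a sa; rewrite mem_undup mem_cat sa.
  rewrite {1}(ext s' (undup (s ++ s')) y) ?undup_uniq //; last first.
    by move=> a sa; rewrite mem_undup mem_cat sa orbT.
  rewrite -big_split; apply: eq_big_seq => a /sB'' Ba /=.
  by rewrite (contractD t (cD Ba) (cZ Ba)) tensDr.
- have [_ _ /(_ a) [s [us sB aE]]] := BP; exists s; split=> //.
  rewrite {1}aE; have tD := big_morph (fun a => tens t a f) (fun x y => tensDl t x y f) (tens0l t f).
  rewrite tD; apply: eq_big_seq => b /sB Bb.
  by rewrite (contractT t (cD Bb) (cZ Bb)) tens_constl tens_constr.
Qed.

(** Every expansion over [B] has the contractions as its coefficients, so the choice made in
    [gauss_norm] is immaterial. *)
Lemma gauss_normE x : exists s : seq A, [/\ uniq s, {in s, forall a, B a},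
   x = \sum_(a <- s) tens t a (contr a x),
   forall b, B b -> b \notin s -> contr b x = 0 &
   N x = \big[Num.max/0]_(a <- s) abs (contr a x)].
Proof.
rewrite /gauss_norm; case: xgetP => [v _ [s [c [us sB xE ->]]]|ne]; last first.
  have [s [us sB xE]] := tens_basis_sum x; exfalso.
  by apply: (ne (\big[Num.max/0]_(a <- s) abs (contr a x))); exists s, (fun a => contr a x).
have cE b : B b -> contr b x = if b \in s then c b else 0.
  by move=> Bb; rewrite xE contract_sum_basis.
exists s; split=> //.
- by rewrite {1}xE; apply: eq_big_seq => a sa; rewrite cE ?sa //; exact: sB.
- by move=> b /cE -> /negPf ->.
- by apply: eq_big_seq => a sa; rewrite cE ?sa //; exact: sB.
Qed.

Lemma bigmax_seq_ge (s : seq A) (g : A -> R) b : b \in s ->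
  g b <= \big[Num.max/0]_(a <- s) g a.
Proof.
elim: s => // a s IH; rewrite inE big_cons le_max => /predU1P [->|/IH ->].
  by rewrite lexx.
by rewrite orbT.
Qed.

Lemma gauss_ge0 x : 0 <= N x.
Proof.
have [s [_ _ _ _ ->]] := gauss_normE x.
by elim: s => [|a s IH]; rewrite ?big_nil // big_cons le_max IH orbT.
Qed.

Lemma gauss_ge b x : B b -> abs (contr b x) <= N x.
Proof.
move=> Bb; have [s [us sB xE x0 NE]] := gauss_normE x.
case: (boolP (b \in s)) => bs; first by rewrite NE; exact: (bigmax_seq_ge (fun a => abs (contr a x))).
rewrite x0 //; have [_ /(_ 0) [_ ->//] _ _ _] := abs_ultra; exact: gauss_ge0.
Qed.

Lemma gauss_le x M : 0 <= M -> (forall b, B b -> abs (contr b x) <= M) -> N x <= M.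
Proof.
move=> M0 h; have [s [us sB xE x0 ->]] := gauss_normE x.
rewrite big_seq; elim/big_ind: _ => // [y z hy hz|a /sB]; last exact: h.
by rewrite ge_max hy hz.
Qed.

Lemma gauss_attained x : N x = 0 \/ exists2 b, B b & abs (contr b x) = N x.
Proof.
have [s [us sB xE x0 ->]] := gauss_normE x.
elim: s {us xE x0} sB => [|a s IH] sB; first by left; rewrite big_nil.
rewrite big_cons /Order.max; case: ifP => _; last by right; exists a => //; apply: sB; rewrite mem_head.
by apply: IH => b bs; apply: sB; rewrite inE bs orbT.
Qed.

Lemma gauss_eq0 x : N x = 0 -> x = 0.
Proof.
move=> Nx; have [s [us sB xE x0 _]] := gauss_normE x.
rewrite xE big_seq big1 // => a /sB Ba.
have := gauss_ge x Ba; rewrite Nx => h.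
have [a0 az _ _ _] := abs_ultra.
have -> : contr a x = 0 by apply/az/le_anti; rewrite h a0.
exact: tens0r.
Qed.

Lemma gauss_tens a f : N (tens t a f) <= abs f.
Proof.
have [a0 az _ _ _] := abs_ultra.
apply: gauss_le => // b Bb; rewrite (contractT t (cD Bb) (cZ Bb)) absM.
by apply: ler_piMl.
Qed.

Lemma gauss_ultra x y : N (x + y) <= Num.max (N x) (N y).
Proof.
have [a0 az aN au _] := abs_ultra.
apply: gauss_le; first by rewrite le_max gauss_ge0.
move=> b Bb; rewrite (contractD t (cD Bb) (cZ Bb)).
by apply: le_trans (au _ _) _; apply: le_max2; exact: gauss_ge.
Qed.

Lemma gaussN x : N (- x) = N x.
Proof.
have [a0 az aN au _] := abs_ultra.
have H y : N (- y) <= N y.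
  apply: gauss_le; first exact: gauss_ge0.
  by move=> b Bb; rewrite (contractN t (cD Bb) (cZ Bb)) aN; exact: gauss_ge.
by apply: le_anti; rewrite H -{1}[x]opprK H.
Qed.

Lemma gauss0 : N 0 = 0.
Proof.
have [a0 az aN au _] := abs_ultra.
apply: le_anti; rewrite gauss_ge0 andbT; apply: gauss_le => // b Bb.
by rewrite (contract0 t (cD Bb) (cZ Bb)) (az 0).2.
Qed.

Lemma gauss_sum_le (I : eqType) (s : seq I) (g : I -> T) M : 0 <= M ->
  (forall i, i \in s -> N (g i) <= M) -> N (\sum_(i <- s) g i) <= M.
Proof.
move=> M0 h; rewrite big_seq; elim/big_ind: _ => [|x y hx hy|i]; last exact: h.
  by rewrite gauss0.
by apply: le_trans (gauss_ultra _ _) _; rewrite ge_max hx hy.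
Qed.

Lemma gaussM x y : N (x * y) <= N x * N y.
Proof.
have [a0 az aN au _] := abs_ultra.
have [s [_ sB xE _ _]] := gauss_normE x; have [s' [_ sB' yE _ _]] := gauss_normE y.
rewrite {1}xE {1}yE mulr_suml; apply: gauss_sum_le => [|a /sB Ba].
  by rewrite mulr_ge0 ?gauss_ge0.
rewrite mulr_sumr; apply: gauss_sum_le => [|b /sB' Bb].
  by rewrite mulr_ge0 ?gauss_ge0.
rewrite tensM; apply: le_trans (gauss_tens _ _) _; rewrite absM.
by apply: ler_pM => //; exact: gauss_ge.
Qed.

Lemma gauss_ultrametric : ultrametric_norm N.
Proof.
split; [exact: gauss_ge0| |exact: gaussN|exact: gauss_ultra|exact: gaussM].
by move=> x; split=> [/gauss_eq0//|->]; exact: gauss0.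
Qed.

(** Frobenius raises every coordinate to the power q, and this power commutes with the maximum of
    the absolute values. The lower bound uses a coordinate where the maximum is attained. *)
Lemma gauss_frob (q : nat) (phi : {rmorphism F -> F}) (tau : T -> T) : (0 < q)%N ->
  (forall c, phi c = c ^+ q) -> (forall c, phi (iF c) = iF c) ->
  (forall x y, tau (x + y) = tau x + tau y) ->
  (forall a f, tau (tens t a f) = tens t a (phi f)) ->
  forall x, N (tau x) = N x ^+ q.
Proof.
move=> q0 phiE phic tauD tauT x; have [a0 az aN au _] := abs_ultra.
have ct b y : B b -> contr b (tau y) = contr b y ^+ q.
  move=> Bb; have CD := contractD t (cD Bb) (cZ Bb); rewrite -phiE.
  apply: (tens_ext (t := t) (g := contr b \o tau) (h := phi \o contr b)).
  - by move=> *; rewrite /= tauD CD.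
  - by move=> *; rewrite /= CD rmorphD.
  - by move=> a f; rewrite /= tauT !(contractT t (cD Bb) (cZ Bb)) rmorphM phic.
have aX z n : abs (z ^+ n.+1) = abs z ^+ n.+1.
  by elim: n => // n IH; rewrite exprS absM IH -exprS.
rewrite -(prednK q0) in ct *; apply: le_anti; apply/andP; split.
  apply: gauss_le => [|b Bb]; first by rewrite exprn_ge0 ?gauss_ge0.
  by rewrite ct // aX lerXn2r ?nnegrE ?gauss_ge0 //; exact: gauss_ge.
case: (gauss_attained x) => [->|[b Bb <-]]; first by rewrite expr0n gauss_ge0.
by rewrite -aX -ct //; exact: gauss_ge.
Qed.

Lemma norm_complete_gauss (s : seq A) : (forall b, B b <-> b \in s) -> uniq s ->
  norm_complete abs -> norm_complete N.
Proof.
move=> sB us Fc u uC; have [a0 az aN au _] := abs_ultra.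
have inB : {in s, forall a, B a} by move=> a /sB.
have H b : exists l, B b -> norm_cvg abs (fun n => contr b (u n)) l.
  have [Bb|nB] := pselect (B b); last by exists 0.
  have [|l lP] := Fc (fun n => contr b (u n)); last by exists l.
  move=> e /uC [n0 n0P]; exists n0 => m n hm hn.
  rewrite -(contractB t (cD Bb) (cZ Bb)); apply: le_lt_trans (n0P m n hm hn).
  exact: gauss_ge.
have [l lP] := choice H; exists (\sum_(b <- s) tens t b (l b)) => e e0.
(* [gauss_le] yields only a weak inequality; halving [e] makes the final one strict. *)
have e2 : 0 < e / 2 by rewrite divr_gt0.
have [n0 n0P] : exists n0, forall n, (n0 <= n)%N -> forall b, b \in s ->
    abs (contr b (u n) - l b) < e / 2.
  elim: (s) inB => [|b s' IH] inB; first by exists 0%N.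
  have [n1 n1P] := IH (fun a sa => inB a (mem_behead (s := b :: s') sa)).
  have [n2 n2P] := lP b (inB b (mem_head _ _)) _ e2.
  exists (maxn n1 n2) => n; rewrite geq_max => /andP[h1 h2] c.
  by rewrite inE => /predU1P [->|cs]; [exact: n2P | exact: n1P].
exists n0 => n hn; apply: (@le_lt_trans _ _ (e / 2)); last first.
  by rewrite ltr_pdivrMr // ltr_pMr // ltr1n.
apply: gauss_le => [|b Bb]; first exact: ltW.
rewrite (contractB t (cD Bb) (cZ Bb)) contract_sum_basis //.
have bs := (sB b).1 Bb; rewrite bs; apply/ltW; exact: n0P.
Qed.

End Gauss.

Section GaussMap.
Variable R : realType.
Variables (k : fieldType) (A F T A' F' T' : comNzRingType).
Variables (iA : {rmorphism k -> A}) (iF : {rmorphism k -> F}).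
Variables (iA' : {rmorphism k -> A'}) (iF' : {rmorphism k -> F'}).
Variable t : tensor_product iA iF T.
Variable t' : tensor_product iA' iF' T'.
Variables (abs : F -> R) (abs' : F' -> R).
Hypothesis abs_ultra : ultrametric_norm abs.
Hypothesis abs_ultra' : ultrametric_norm abs'.
Hypothesis absM' : forall x y, abs' (x * y) = abs' x * abs' y.
Hypothesis abs_const' : forall c, abs' (iF' c) <= 1.
Variables (B : set A) (coord : A -> A -> k).
Hypothesis BP : basis_coord iA B coord.
Variables (B' : set A') (coord' : A' -> A' -> k).
Hypothesis BP' : basis_coord iA' B' coord'.

(** With [h] the identity this compares the norms of two bases; with [h] a projection it gives
    continuity. *)
Lemma gauss_map_le (h : T -> T') (u : A -> A') (v : F -> F') :
  (forall x y, h (x + y) = h x + h y) ->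
  (forall a f, h (tens t a f) = tens t' (u a) (v f)) ->
  (forall f, abs' (v f) <= abs f) ->
  forall x, gauss_norm t' abs' B' (h x) <= gauss_norm t abs B x.
Proof.
move=> hD hT hv x; have [s [us sB xE _ _]] := gauss_normE t abs BP x.
have h0 : h 0 = 0 by exact/additive0/hD.
rewrite {1}xE (big_morph _ hD h0).
apply: (gauss_sum_le abs_ultra' BP') => [|a /sB Ba]; first exact: (gauss_ge0 _ _ BP).
rewrite hT; apply: le_trans (gauss_tens t' abs_ultra' absM' abs_const' BP' _ _) _.
by apply: le_trans (hv _) _; exact: (gauss_ge t abs_ultra BP).
Qed.
End GaussMap.

(** * Continuous extensions *)

Section UltrametricLimits.
Variable R : realType.

Lemma ultrametric_lt (Y : nzRingType) (N : Y -> R) : ultrametric_norm N ->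
  forall x y e, N x < e -> N y < e -> N (x + y) < e.
Proof.
move=> [_ _ _ NU _] x y e hx hy; apply: le_lt_trans (NU _ _) _.
by rewrite gt_max hx hy.
Qed.

Lemma ultrametric_eq (Y : nzRingType) (N : Y -> R) : ultrametric_norm N ->
  forall x y, N (x - y) < N y -> N x = N y.
Proof.
move=> [_ _ NN NU _] x y h; apply: le_anti; apply/andP; split.
  rewrite -{1}[x](subrK y); apply: le_trans (NU _ _) _.
  by rewrite ge_max lexx (ltW h).
have := NU x (- (x - y)); rewrite opprB addrC subrK le_max => /orP[//|].
by rewrite leNgt -opprB NN h.
Qed.

Lemma norm_cvg_unique (Y : nzRingType) (N : Y -> R) (u : nat -> Y) (x y : Y) :
  ultrametric_norm N -> norm_cvg N u x -> norm_cvg N u y -> x = y.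
Proof.
move=> NU ux uy; have [N0 Nz NN _ _] := NU.
apply/eqP; rewrite -subr_eq0; apply/eqP; apply/Nz; apply: contrapT => /eqP nz.
have e0 : 0 < N (x - y) by rewrite lt_def nz N0.
have [n1 h1] := ux _ e0; have [n2 h2] := uy _ e0.
have := h1 (maxn n1 n2) (leq_maxl _ _); have := h2 (maxn n1 n2) (leq_maxr _ _).
move=> hy; rewrite -NN opprB => hx; have := ultrametric_lt NU hx hy.
by rewrite addrA subrK ltxx.
Qed.

Lemma norm_cvgD (Y : nzRingType) (N : Y -> R) (u v : nat -> Y) (x y : Y) :
  ultrametric_norm N -> norm_cvg N u x -> norm_cvg N v y ->
  norm_cvg N (fun n => u n + v n) (x + y).
Proof.
move=> NU ux vy e e0; have [n1 h1] := ux _ e0; have [n2 h2] := vy _ e0.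
exists (maxn n1 n2) => n; rewrite geq_max => /andP[/h1 hn1 /h2 hn2].
by rewrite opprD addrACA; exact: ultrametric_lt.
Qed.

Lemma norm_cvgM (Y : nzRingType) (N : Y -> R) (u v : nat -> Y) (x y : Y) :
  ultrametric_norm N -> norm_cvg N u x -> norm_cvg N v y ->
  norm_cvg N (fun n => u n * v n) (x * y).
Proof.
move=> NU ux vy e e0; have [N0 _ _ _ NM] := NU.
(* [K] dominates 1, [N x] and [N y]. With both errors below min(1, e / K), each of the three terms
   of the expansion is below [e]. *)
pose K := N x + N y + 1.
have K0 : 0 < K by rewrite ltr_wpDl ?addr_ge0.
have K1 : 1 <= K by rewrite /K lerDr addr_ge0.
have d0 : 0 < Num.min 1 (e / K) by rewrite lt_min ltr01 divr_gt0.
have [n1 h1] := ux _ d0; have [n2 h2] := vy _ d0.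
exists (maxn n1 n2) => n; rewrite geq_max => /andP[/h1 + /h2].
rewrite !lt_min !ltr_pdivlMr // => /andP[a1 aK] /andP[b1 bK].
have -> : u n * v n - x * y = (u n - x) * (v n - y) + ((u n - x) * y + x * (v n - y)).
  by rewrite addrA -mulrDr subrK mulrBl mulrBr addrA subrK.
have xK : N x <= K by rewrite /K -addrA lerDl addr_ge0.
have yK : N y <= K by rewrite /K -addrA addrCA lerDl addr_ge0.
apply: (ultrametric_lt NU); last apply: (ultrametric_lt NU).
- apply: le_lt_trans (NM _ _) _; apply: le_lt_trans aK.
  by apply: ler_wpM2l => //; apply: le_trans (ltW b1) K1.
- apply: le_lt_trans (NM _ _) _; apply: le_lt_trans aK; exact: ler_wpM2l.
- by apply: le_lt_trans (NM _ _) _; apply: le_lt_trans bK; rewrite mulrC; exact: ler_wpM2l.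
Qed.

Definition continuous_at0 (Y Z : nzRingType) (NY : Y -> R) (NZ : Z -> R) (f : Y -> Z) : Prop :=
  forall e, 0 < e -> exists2 d, 0 < d & forall x, NY x < d -> NZ (f x) < e.

Lemma continuous_at0_comp (X Y Z : nzRingType) (NX : X -> R) (NY : Y -> R) (NZ : Z -> R)
    (f : X -> Y) (g : Y -> Z) :
  continuous_at0 NX NY f -> continuous_at0 NY NZ g -> continuous_at0 NX NZ (g \o f).
Proof.
by move=> fc gc e /gc [d /fc [d' d'0 h'] h]; exists d' => // x /h' /h.
Qed.

Lemma continuous_at0_le (Y Z : nzRingType) (NY : Y -> R) (NZ : Z -> R) (f : Y -> Z) :
  (forall x, NZ (f x) <= NY x) -> continuous_at0 NY NZ f.
Proof. by move=> h e e0; exists e => // x; exact: le_lt_trans. Qed.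

Lemma continuous_at0_exp (Y Z : nzRingType) (NY : Y -> R) (NZ : Z -> R) (f : Y -> Z) q :
  (0 < q)%N -> (forall x, 0 <= NY x) -> (forall x, NZ (f x) = NY x ^+ q) ->
  continuous_at0 NY NZ f.
Proof.
move=> q0 N0 h e e0; exists (Num.min 1 e); first by rewrite lt_min ltr01.
move=> x; rewrite lt_min h => /andP[x1 xe]; apply: le_lt_trans xe.
by rewrite -[leRHS]expr1; apply: ler_wiXn2l => //; exact: ltW.
Qed.

Lemma norm_cvg_continuous (Y Z : nzRingType) (NY : Y -> R) (NZ : Z -> R)
    (f : {rmorphism Y -> Z}) (u : nat -> Y) y :
  continuous_at0 NY NZ f -> norm_cvg NY u y -> norm_cvg NZ (f \o u) (f y).
Proof.
move=> fc uy e /fc [d d0 h]; have [n0 hn] := uy d d0.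
by exists n0 => n /hn /h; rewrite rmorphB.
Qed.

Section Extension.
Variables (X Y Z : nzRingType) (NX : X -> R) (NY : Y -> R) (NZ : Z -> R).
Variable j : {rmorphism X -> Y}.
Hypothesis jP : is_completion NX NY j.
Hypothesis NZU : ultrametric_norm NZ.

Let NYU : ultrametric_norm NY. Proof. by case: jP. Qed.

Lemma completion_seq y : exists u, norm_cvg NY (j \o u) y.
Proof.
have [_ _ jd _] := jP; have [_ _ NN _ _] := NYU.
have H n : exists x, NY (y - j x) < n.+1%:R^-1 by apply: jd; rewrite invr_gt0 ltr0Sn.
have [u uP] := choice H; exists u => e e0.
exists (Num.truncn e^-1) => n hn.
rewrite -NN opprB; apply: lt_le_trans (uP n) _.
rewrite invf_ple ?posrE ?ltr0Sn //; apply: ltW.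
apply: lt_le_trans (truncnS_gt _) _.
by rewrite ler_nat ltnS.
Qed.

Lemma dense_ext (f g : {rmorphism Y -> Z}) :
  continuous_at0 NY NZ f -> continuous_at0 NY NZ g ->
  (forall x, f (j x) = g (j x)) -> forall y, f y = g y.
Proof.
move=> fc gc fg y; have [u uy] := completion_seq y.
apply: (norm_cvg_unique NZU (norm_cvg_continuous fc uy)).
have -> : f \o (j \o u) = g \o (j \o u) by apply/funext => n; rewrite /= fg.
exact: (norm_cvg_continuous gc uy).
Qed.

Hypothesis NZC : norm_complete NZ.
Variable h : {rmorphism X -> Z}.
Hypothesis hc : forall e, 0 < e -> exists2 d, 0 < d & forall x, NY (j x) < d -> NZ (h x) < e.

Let norm_cvg_eq u v y : norm_cvg NY (j \o u) y -> norm_cvg NY (j \o v) y ->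
  forall e, 0 < e -> exists n0, forall n m, (n0 <= n)%N -> (n0 <= m)%N -> NZ (h (u n) - h (v m)) < e.
Proof.
move=> uy vy e /hc [d d0 hd]; have [n1 h1] := uy d d0; have [n2 h2] := vy d d0.
have [_ _ NN _ _] := NYU.
exists (maxn n1 n2) => n m; rewrite !geq_max => /andP[/h1 hn _] /andP[_ /h2 hm].
rewrite -rmorphB; apply: hd; rewrite rmorphB.
have -> : j (u n) - j (v m) = (j (u n) - y) - (j (v m) - y) by rewrite opprB addrA subrK.
by apply: (ultrametric_lt NYU) => //; rewrite NN.
Qed.

(** Two sequences with the same limit in [Y] have images whose difference tends to 0. The limit of
    one image sequence therefore serves for all, and the default value is never taken. *)
Lemma extension_cvg y u : norm_cvg NY (j \o u) y ->
  norm_cvg NZ (h \o u) (continuous_extension NY j NZ h y).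
Proof.
move: u; rewrite /continuous_extension; case: xgetP => [z _ //|ne].
have [v vy] := completion_seq y; exfalso.
have [|l lP] := NZC (u := h \o v).
  by move=> e /(norm_cvg_eq vy vy) [n0 n0P]; exists n0 => n m; exact: n0P.
apply: (ne l) => u uy e e0.
have [n1 h1] := norm_cvg_eq uy vy e0; have [n2 h2] := lP e e0.
exists (maxn n1 n2) => n; rewrite geq_max => /andP[hn1 hn2].
rewrite /= -[h (u n)](subrK (h (v n))) -addrA; apply: (ultrametric_lt NZU).
  exact: h1.
exact: h2.
Qed.

Lemma extension_rmorph : exists H : {rmorphism Y -> Z},
  [/\ continuous_extension NY j NZ h = H, forall x, H (j x) = h x & continuous_at0 NY NZ H].
Proof.
have [_ Nz NN _ _] := NYU; have [_ Zz ZN _ _] := NZU.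
have Ej x : continuous_extension NY j NZ h (j x) = h x.
  apply: (norm_cvg_unique NZU (u := h \o (fun=> x))); last first.
    by move=> e e0; exists 0%N => n _; rewrite /= subrr (Zz 0).2.
  by apply: extension_cvg => e e0; exists 0%N => n _; rewrite /= subrr (Nz 0).2.
have [|||H HE] := @rmorphism_of _ _ (continuous_extension NY j NZ h).
- move=> x y; have [u ux] := completion_seq x; have [v vy] := completion_seq y.
  have := extension_cvg (u := fun n => u n + v n) (y := x + y).
  have -> : j \o (fun n => u n + v n) = fun n => (j \o u) n + (j \o v) n.
    by apply/funext => n; rewrite /= rmorphD.
  move=> /(_ (norm_cvgD NYU ux vy)) /norm_cvg_unique; apply=> //.
  have -> : h \o (fun n => u n + v n) = fun n => (h \o u) n + (h \o v) n.
    by apply/funext => n; rewrite /= rmorphD.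
  by apply: norm_cvgD => //; exact: extension_cvg.
- move=> x y; have [u ux] := completion_seq x; have [v vy] := completion_seq y.
  have := extension_cvg (u := fun n => u n * v n) (y := x * y).
  have -> : j \o (fun n => u n * v n) = fun n => (j \o u) n * (j \o v) n.
    by apply/funext => n; rewrite /= rmorphM.
  move=> /(_ (norm_cvgM NYU ux vy)) /norm_cvg_unique; apply=> //.
  have -> : h \o (fun n => u n * v n) = fun n => (h \o u) n * (h \o v) n.
    by apply/funext => n; rewrite /= rmorphM.
  by apply: norm_cvgM => //; exact: extension_cvg.
- by rewrite -(rmorph1 j) Ej rmorph1.
exists H; split=> //; first by move=> x; rewrite -HE.
move=> e e0; have [d d0 hd] := hc e0; exists d => // y yd.
(* A late member of a sequence tending to [y] still has norm below [d], while its image is within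
   [e] of [H y]. *)
have [u uy] := completion_seq y.
have [n1 h1] := uy d d0; have [n2 h2] := extension_cvg uy e0.
have := h2 _ (leq_maxr n1 n2); rewrite /= -ZN opprB HE => c2.
rewrite -[H y](subrK (h (u (maxn n1 n2)))); apply: (ultrametric_lt NZU) => //.
apply: hd; rewrite -[j _](subrK y); apply: (ultrametric_lt NYU) => //.
by apply: (h1 _ (leq_maxl n1 n2)).
Qed.

End Extension.
End UltrametricLimits.

(** * The Tate algebra *)

Lemma card_finField (k : finFieldType) :
  exists p n, [/\ prime p, p \in [pchar k], (0 < n)%N & #|k| = (p ^ n)%N].
Proof.
have [p pp pchark] := finPcharP k; exists p, (logn p #|k|); split=> //.
  have := finNzRing_gt1 k; rewrite {1}(card_pprimeChar pchark) /=.
  by case: (logn p _).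
exact: (card_pprimeChar pchark).
Qed.

Lemma frobenius_rmorph (k : finFieldType) (F : fieldType) (iF : {rmorphism k -> F}) :
  exists phi : {rmorphism F -> F}, (fun c : F => c ^+ #|k|) = phi /\
    forall c, phi (iF c) = iF c.
Proof.
have [p [n [pp pchark _ kE]]] := card_finField k.
have pcharF : p \in [pchar F] by rewrite (fmorph_pchar iF).
have qp : [pchar F].-nat #|k|.
  by rewrite (eq_pnat _ (pcharf_eq pcharF)) kE pnatX pnat_id.
have [|||phi phiE] := @rmorphism_of F F (fun c : F => c ^+ #|k|).
- by move=> x y; exact: exprDn_pchar.
- by move=> x y; rewrite exprMn.
- by rewrite expr1n.
by exists phi; split=> // c; rewrite -phiE -rmorphXn /= expf_card.
Qed.

Section TateMaps.
Variables (R : realType) (k : finFieldType) (A : comNzRingType) (iA : {rmorphism k -> A}).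
Variables (C : fieldType) (iC : {rmorphism k -> C}) (abs : C -> R).
Variables (AC : comNzRingType) (tAC : tensor_product iA iC AC).
Variables (TT : idomainType) (normT : TT -> R) (jT : {rmorphism AC -> TT}).
Variable p : idealr A.
Variables (ACp : comUnitRingType) (tACp : adic_tensor iA p iC ACp).
Hypothesis abs_ultra : ultrametric_norm abs.
Hypothesis absM : forall x y, abs (x * y) = abs x * abs y.
Hypothesis absC : norm_complete abs.
Variable B : set A.
Hypothesis hB : is_basis iA B.
Hypothesis hT : is_completion (gauss_norm tAC abs B) normT jT.
Hypothesis hfin : forall n, exists s : seq (quo p n),
  uniq s /\ is_basis (quo_const iA p n) [set` s].

Let q := #|k|.
Let q0 : (0 < q)%N. Proof. by apply: ltn_trans (finNzRing_gt1 k). Qed.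

(** As c^q = c, an absolute value above 1 would be strictly smaller than its own q-th power. *)
Let abs_const c : abs (iC c) <= 1.
Proof.
rewrite leNgt; apply/negP => h.
have aX z n : abs (z ^+ n.+1) = abs z ^+ n.+1.
  by elim: n => // n IH; rewrite exprS absM IH -exprS.
have := aX (iC c) q.-1; rewrite prednK // -rmorphXn /= expf_card.
rewrite -(prednK q0) exprS => e.
have: abs (iC c) < abs (iC c) * abs (iC c) ^+ q.-1.
  rewrite ltr_pMr ?(lt_trans ltr01) // exprn_egt1 //.
  by rewrite -lt0n -ltnS prednK // finNzRing_gt1.
by rewrite -e ltxx.
Qed.

Let normTU : ultrametric_norm normT. Proof. by case: hT. Qed.
Let normTj x : normT (jT x) = gauss_norm tAC abs B x. Proof. by case: hT => _ ->. Qed.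
Let normTC : norm_complete normT. Proof. by case: hT. Qed.

Lemma tate_inj : injective jT.
Proof.
have [coord BP] := basis_coord_exists hB.
apply: raddf_inj => x jx0; have [_ z _ _ _] := normTU.
by apply: (gauss_eq0 (t := tAC) abs_ultra BP); rewrite -normTj jx0; apply/z.
Qed.

Lemma tens_frob_rmorph : exists phi : {rmorphism AC -> AC}, tens_frob tAC = phi /\
  forall a f, phi (tens tAC a f) = tens tAC a (f ^+ q).
Proof.
have [phi [phiE phic]] := frobenius_rmorph iC.
rewrite /tens_frob phiE.
have [||h [hE hT']] := tensor_map_rmorph tAC tAC (u := idfun) (v := phi) => //.
by exists h; split=> // a f; rewrite hT' -phiE.
Qed.

Lemma tate_frob_rmorph : exists tau : {rmorphism TT -> TT},
  [/\ tate_frob tAC normT jT = tau, injective tau,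
      forall x, tau (jT x) = jT (tens_frob tAC x) & continuous_at0 normT normT tau].
Proof.
have [coord BP] := basis_coord_exists hB.
have [frob [frobE frobT]] := tens_frob_rmorph.
have [phi [phiE phic]] := frobenius_rmorph iC.
have Nf x : normT (jT (frob x)) = normT (jT x) ^+ q.
  rewrite !normTj; apply: (gauss_frob (phi := phi) (t := tAC) abs_ultra absM BP q0) => //.
  - by move=> c; rewrite -phiE.
  - by move=> *; rewrite rmorphD.
  - by move=> a f; rewrite frobT -phiE.
have N0 x : 0 <= normT x by case: normTU.
rewrite /tate_frob frobE.
have hc e : 0 < e -> exists2 d, 0 < d & forall x, normT (jT x) < d -> normT ((jT \o frob) x) < e.
  move=> /(continuous_at0_exp (f := jT \o frob) (NY := fun x => normT (jT x)) q0) h.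
  by apply: h.
have [tau [tauE tauj tauc]] := extension_rmorph hT normTU normTC hc.
exists tau; split=> //.
(* Close to a nonzero [y] the norm is constant, so the Frobenius images of the approximations keep
   the norm [normT y ^+ q] and cannot tend to 0. *)
apply: raddf_inj => y ty; apply: contrapT => y0.
have [_ Nz _ _ _] := normTU.
have Ny : 0 < normT y by rewrite lt_def N0 andbT; apply/eqP => /Nz.
have [u uy] := completion_seq hT y.
have tuy := norm_cvg_continuous tauc uy.
have [n1 h1] := uy _ Ny; have [n2 h2] := tuy _ (exprn_gt0 q Ny).
have := h2 _ (leq_maxr n1 n2); rewrite ty subr0 /= tauj /= Nf.
by rewrite (ultrametric_eq normTU (h1 _ (leq_maxl n1 n2))) ltxx.
Qed.

Section Level.
Variable n : nat.
Local Notation t := (level_tensor tACp n).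
Local Notation N := (fin_norm t abs).
Local Notation Bn := (xget set0 [set B | is_basis (quo_const iA p n) B]%classic).

Let hBn : is_basis (quo_const iA p n) Bn.
Proof.
case: xgetP => [B' _ //|ne]; have [s [_ h]] := hfin n.
by case: (ne _ h).
Qed.

Lemma level_norm_ultra : ultrametric_norm N.
Proof.
have [coord BP] := basis_coord_exists hBn.
exact: (gauss_ultrametric t abs_ultra absM abs_const BP).
Qed.

Lemma level_norm_complete : norm_complete N.
Proof.
have [coord BP] := basis_coord_exists hBn.
have [s [us hs]] := hfin n; have [coord' BP'] := basis_coord_exists hs.
(* [fin_norm] uses an unspecified basis. The identity map bounds each of the two norms by the other,
   so the finite basis [s] may be used. *)
have -> : N = gauss_norm t abs [set` s]%classic.
  apply/funext => x; apply: le_anti; apply/andP; split.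
    by apply: (gauss_map_le (t := t) (t' := t) (abs := abs) (abs' := abs) abs_ultra abs_ultra
      absM abs_const BP' BP (h := id) (u := id) (v := id)).
  by apply: (gauss_map_le (t := t) (t' := t) (abs := abs) (abs' := abs) abs_ultra abs_ultra
    absM abs_const BP BP' (h := id) (u := id) (v := id)).
by apply: (norm_complete_gauss (s := s) (t := t) abs_ultra BP').
Qed.

Lemma level_proj_le (h : {rmorphism AC -> level tACp n}) :
  (forall a f, h (tens tAC a f) = tens t (to_quo p n a) f) ->
  forall x, N (h x) <= normT (jT x).
Proof.
move=> hh x; have [coord BP] := basis_coord_exists hBn.
have [coord' BP'] := basis_coord_exists hB; rewrite normTj.
by apply: (gauss_map_le (t := tAC) (t' := t) (abs := abs) (abs' := abs) abs_ultra abs_ultra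
  absM abs_const BP' BP (u := to_quo p n) (v := id)) => // *; rewrite rmorphD.
Qed.

Lemma level_frob_norm (h : {rmorphism level tACp n -> level tACp n}) :
  (forall a f, h (tens t a f) = tens t a (f ^+ q)) -> continuous_at0 N N h.
Proof.
move=> hh; have [coord BP] := basis_coord_exists hBn.
have [phi [phiE phic]] := frobenius_rmorph iC.
apply: (continuous_at0_exp q0); first by case: level_norm_ultra.
apply: (gauss_frob (phi := phi) (t := t) abs_ultra absM BP q0) => //.
- by move=> c; rewrite -phiE.
- by move=> *; rewrite rmorphD.
- by move=> a f; rewrite hh -phiE.
Qed.

End Level.

Lemma level_trans_norm n (h : {rmorphism level tACp n.+1 -> level tACp n}) :
  (forall a f, h (tens (level_tensor tACp n.+1) a f) = tens (level_tensor tACp n) (quo_trans a) f) ->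
  continuous_at0 (fin_norm (level_tensor tACp n.+1) abs) (fin_norm (level_tensor tACp n) abs) h.
Proof.
have hBn m : is_basis (quo_const iA p m) (xget set0 [set B | is_basis (quo_const iA p m) B]%classic).
  case: xgetP => [B' _ //|ne]; have [s [_ h']] := hfin m.
  by case: (ne _ h').
move=> hh; apply: continuous_at0_le => x.
have [coord BP] := basis_coord_exists (hBn n).
have [coord' BP'] := basis_coord_exists (hBn n.+1).
by apply: (gauss_map_le (t := level_tensor tACp n.+1) (t' := level_tensor tACp n)
  (abs := abs) (abs' := abs) abs_ultra abs_ultra absM abs_const BP' BP
  (u := @quo_trans A p n) (v := id)) => // *; rewrite rmorphD.
Qed.

(** At each level the maps are continuous, hence determined by their values on the dense image of A
    \otimes C. Both the compatibility of the levels and the commutation with Frobenius are checked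
    there on pure tensors. *)
Lemma tate_to_adic_rmorph : exists psi : {rmorphism TT -> ACp},
  [/\ tate_to_adic abs tAC normT jT tACp = psi,
    forall n a f, lim_proj (level_limit tACp) n (psi (jT (tens tAC a f))) =
      tens (level_tensor tACp n) (to_quo p n a) f &
    forall (T : {rmorphism ACp -> ACp})
      (h : forall n, {rmorphism level tACp n -> level tACp n}),
      levelwise (fun c => c ^+ q) T h ->
      forall y, psi (tate_frob tAC normT jT y) = T (psi y)].
Proof.
have H n : exists P : {rmorphism AC -> level tACp n},
    tensor_map tAC (level_tensor tACp n) (to_quo p n) id = P /\
    forall a f, P (tens tAC a f) = tens (level_tensor tACp n) (to_quo p n a) f.
  by have [||P PP] := tensor_map_rmorph tAC (level_tensor tACp n)
    (u := to_quo p n) (v := idfun) => //; exists P.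
have [P PP] := dependent_choice H.
have H' n : exists Q : {rmorphism TT -> level tACp n},
    [/\ continuous_extension normT jT (fin_norm (level_tensor tACp n) abs) (P n) = Q,
       forall x, Q (jT x) = P n x &
       continuous_at0 normT (fin_norm (level_tensor tACp n) abs) Q].
  apply: (extension_rmorph hT (level_norm_ultra n) (@level_norm_complete n)) => e e0.
  exists e => // x; apply: le_lt_trans; apply: level_proj_le.
  exact: (PP n).2.
have [Q QP] := dependent_choice H'.
have [r rP] := adic_trans_rmorph tACp.
have [||psi [psiE psiP]] := @lim_lift_rmorph _ _ _ (level_limit tACp) TT Q
   (fun n => continuous_extension normT jT (fin_norm (level_tensor tACp n) abs)
      (tensor_map tAC (level_tensor tACp n) (to_quo p n) id)).
- by move=> n; rewrite (PP n).1; have [] := QP n.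
- move=> n x; rewrite (rP n).1.
  have [_ Qj Qc] := QP n; have [_ Qj' Qc'] := QP n.+1.
  apply: (dense_ext hT (level_norm_ultra n) (f := r n \o Q n.+1)).
  + exact: continuous_at0_comp Qc' (level_trans_norm (rP n).2).
  + exact: Qc.
  + move=> y; rewrite /= Qj Qj'.
    apply: (tens_rmorph_ext (t := tAC) (g := r n \o P n.+1) (h := P n)) => a f.
    by rewrite /= (PP n.+1).2 (PP n).2 (rP n).2 quo_trans_to_quo.
exists psi; split=> //.
  by move=> n a f; rewrite psiP; have [_ -> _] := QP n; rewrite (PP n).2.
move=> T h hP y; apply: (lim_ext (l := level_limit tACp)) => n.
have [hT' ->] := hP n; rewrite !psiP.
have [tau [-> _ tauj tauc]] := tate_frob_rmorph; have [_ Qj Qc] := QP n.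
apply: (dense_ext hT (level_norm_ultra n) (f := Q n \o tau) (g := h n \o Q n)).
- exact: continuous_at0_comp tauc Qc.
- exact: continuous_at0_comp Qc (level_frob_norm hT').
move=> x; rewrite /= tauj !Qj.
have [frob [-> frobT]] := tens_frob_rmorph.
apply: (tens_rmorph_ext (t := tAC) (g := P n \o frob) (h := h n \o P n)) => a f.
by rewrite /= frobT !(PP n).2 hT'.
Qed.

End TateMaps.

(** * The ring A is Dedekind at p *)

Section IndependentFamilies.
Variables (k : fieldType) (A : comNzRingType) (iA : {rmorphism k -> A}).

Definition independent_mod (H : set A) (N : nat) (z : 'I_N -> A) : Prop :=
  forall c : 'I_N -> k, H (\sum_i iA (c i) * z i) -> forall i, c i = 0.

Lemma maximal_independent (Q H : set A) (D : nat) :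
  (forall x y, H x -> H y -> H (x + y)) -> (forall a x, H x -> H (a * x)) ->
  (forall N (z : 'I_N -> A), (forall i, Q (z i)) -> independent_mod H z -> (N <= D)%N) ->
  exists N (z : 'I_N -> A), [/\ forall i, Q (z i), independent_mod H z &
    forall x, Q x -> exists c : 'I_N -> k, H (x - \sum_i iA (c i) * z i)].
Proof.
move=> HD HM bound.
pose P N := `[< exists z : 'I_N -> A, (forall i, Q (z i)) /\ independent_mod H z >].
have P0 : exists N, P N.
  by exists 0%N; apply/asboolP; exists (fun=> 0); split=> [[]|c _ []].
have PD N : P N -> (N <= D)%N by move=> /asboolP [z [zQ zi]]; exact: (bound N z).
case: (ex_maxnP P0 PD) => N /asboolP [z [zQ zi]] maxN.
exists N, z; split=> // x Qx; apply: contrapT => nspan.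
suff /maxN : P N.+1 by rewrite ltnn.
apply/asboolP; exists (fun i => if unlift ord0 i is Some j then z j else x).
split=> [i|c]; first by case: unliftP.
rewrite big_ord_recl unlift_none => Hc.
have c0 : c ord0 = 0.
  apply/eqP; apply: contrapT => /negP c0; apply: nspan.
  exists (fun i => - (c ord0)^-1 * c (lift ord0 i)).
  have -> : x - \sum_i iA (- (c ord0)^-1 * c (lift ord0 i)) * z i =
     iA (c ord0)^-1 * (iA (c ord0) * x + \sum_i iA (c (lift ord0 i)) * z i).
    rewrite mulrDr mulrA -rmorphM mulVf // rmorph1 mul1r; congr (_ + _).
    rewrite mulr_sumr -sumrN; apply: eq_bigr => i _.
    by rewrite mulNr rmorphN mulNr opprK rmorphM mulrA.
  apply: HM; move: Hc; congr (H (_ + _)); apply: eq_bigr => i _.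
  by rewrite liftK.
move=> i; case: (unliftP ord0 i) => [j ->|->//].
apply: (zi (fun j => c (lift ord0 j))); move: Hc; rewrite c0 rmorph0 mul0r add0r.
by congr H; apply: eq_bigr => l _; rewrite liftK.
Qed.

End IndependentFamilies.

(** * Bounded independence modulo [a] in a function field *)

Section FunctionFieldBound.
Variables (k K : fieldType) (iK : {rmorphism k -> K}) (x : K) (n : nat) (e : 'I_n -> K).

Let ev (P : {poly k}) : K := (map_poly iK P).[x].
Let evD P Q : ev (P + Q) = ev P + ev Q. Proof. by rewrite /ev rmorphD hornerD. Qed.
Let evM P Q : ev (P * Q) = ev P * ev Q. Proof. by rewrite /ev rmorphM hornerM. Qed.
Let ev0 : ev 0 = 0. Proof. by rewrite /ev rmorph0 horner0. Qed.
Let evZ c P : ev (c *: P) = iK c * ev P.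
Proof. by rewrite /ev -mul_polyC rmorphM /= map_polyC hornerM hornerC. Qed.

Definition represented (B : nat) (y : K) : Prop :=
  exists2 c : 'I_n -> {poly k}, (forall l, (size (c l) <= B)%N) &
    y = \sum_l (map_poly iK (c l)).[x] * e l.

(** All coefficients together form a vector in a [k]-space of dimension [n * B], so a larger family
    has a nonzero relation, found in the kernel of a matrix. *)
Lemma represented_dependent (I : finType) (y : I -> K) (B : nat) :
  (n * B < #|I|)%N -> (forall i, represented B (y i)) ->
  exists c : I -> k, (exists i, c i != 0) /\ \sum_i iK (c i) * y i = 0.
Proof.
move=> hI yB.
have H i : exists c : 'I_n -> {poly k}, (forall l, (size (c l) <= B)%N) /\
    y i = \sum_l ev (c l) * e l by have [c cB ->] := yB i; exists c.
have [C CP] := choice H.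
pose Mx : 'M[k]_(#|I|, n * B) :=
  \matrix_i mxvec (\matrix_(l < n, s < B) (C (enum_val i) l)`_s).
have : kermx Mx != 0.
  rewrite -mxrank_eq0 mxrank_ker -lt0n subn_gt0.
  exact: leq_ltn_trans (rank_leq_col _) hI.
case/rowV0Pn => v vK v0.
have vM : v *m Mx = 0 by apply/sub_kermxP.
exists (fun i => v 0 (enum_rank i)); split.
  have [j vj] : exists j, v 0 j != 0.
    apply: contrapT => nv; case/eqP: v0; apply/rowP => j; rewrite mxE.
    by apply/eqP; apply: contrapT => /negP vj; apply: nv; exists j.
  by exists (enum_val j); rewrite enum_valK.
have C0 l : \sum_i v 0 (enum_rank i) *: C i l = 0.
  apply/polyP => s; rewrite coef0 coef_sum.
  have [sB|Bs] := ltnP s B; last first.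
    rewrite big1 // => i _; rewrite coefZ nth_default ?mulr0 //.
    exact: leq_trans ((CP i).1 l) Bs.
  transitivity ((v *m Mx) 0 (mxvec_index l (Ordinal sB))); last by rewrite vM mxE.
  rewrite [RHS]mxE (reindex (@enum_val I predT)) /=; last first.
    by apply: onW_bij; exact: enum_val_bij.
  apply: eq_bigr => i _; rewrite coefZ enum_valK; congr (_ * _).
  by rewrite mxE mxvecE mxE.
transitivity (\sum_l ev (\sum_i v 0 (enum_rank i) *: C i l) * e l); last first.
  by rewrite big1 // => l _; rewrite C0 ev0 mul0r.
under [RHS]eq_bigr => l _ do rewrite (big_morph ev evD ev0) mulr_suml.
rewrite exchange_big; apply: eq_bigr => i _.
rewrite (CP i).2 mulr_sumr; apply: eq_bigr => l _.
by rewrite evZ mulrA.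
Qed.

Lemma representedM (B s : nat) (P : {poly k}) y : (size P <= s)%N ->
  represented B y -> represented (s + B) ((map_poly iK P).[x] * y).
Proof.
move=> Ps [c cB ->]; exists (fun l => P * c l) => [l|].
  apply: leq_trans (size_polyMleq _ _) _; apply: leq_trans (leq_pred _) _.
  by rewrite leq_add.
rewrite mulr_sumr; apply: eq_bigr => l _.
by rewrite mulrA -/(ev P) -/(ev (c l)) -evM.
Qed.

Lemma represented_sum (I : Type) (r : seq I) (f : I -> K) (B : nat) :
  (forall i, represented B (f i)) -> represented B (\sum_(i <- r) f i).
Proof.
move=> fB; elim/big_ind: _ => //.
  exists (fun=> 0) => [l|]; first by rewrite size_poly0.
  by rewrite big1 // => l _; rewrite -/(ev 0) ev0 mul0r.
move=> _ _ [c cB ->] [c' cB' ->]; exists (fun l => c l + c' l) => [l|].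
  by apply: leq_trans (size_polyD _ _) _; rewrite geq_max cB cB'.
rewrite -big_split; apply: eq_bigr => l _ /=.
by rewrite -mulrDl -!/(ev _) evD.
Qed.

Hypothesis generating : forall y : K, exists (d : {poly k}) (c : 'I_n -> {poly k}),
  (map_poly iK d).[x] != 0 /\
  (map_poly iK d).[x] * y = \sum_i (map_poly iK (c i)).[x] * e i.

Lemma common_denominator (I : finType) (y : I -> K) : exists (d : {poly k}) (B : nat),
  (map_poly iK d).[x] != 0 /\ forall i, represented B ((map_poly iK d).[x] * y i).
Proof.
have H i : exists dB : {poly k} * nat, ev dB.1 != 0 /\ represented dB.2 (ev dB.1 * y i).
  have [d [c [d0 dy]]] := generating (y i).
  exists (d, \max_l size (c l)); split=> //=; exists c => // l.
  exact: (leq_bigmax l).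
have [dB dBP] := choice H.
pose D := \prod_i (dB i).1; have D0 : ev D != 0.
  have ev1 : ev 1 = 1 by rewrite /ev rmorph1 hornerC.
  rewrite /D (big_morph ev evM ev1); apply/prodf_neq0 => i _; exact: (dBP i).1.
pose D' i := \prod_(j | j != i) (dB j).1.
exists D, (\max_i (size (D' i) + (dB i).2)); split=> // i.
have -> : (map_poly iK D).[x] * y i = (map_poly iK (D' i)).[x] * (ev (dB i).1 * y i).
  by rewrite mulrA -/(ev D) -/(ev (D' i)) -evM; congr (ev _ * _); rewrite /D (bigD1 i) //= mulrC.
have [c cB ->] := representedM (leqnn (size (D' i))) (dBP i).2.
exists c => // l; apply: leq_trans (cB l) _.
exact: (leq_bigmax i).
Qed.

Variables (A : comNzRingType) (v : {rmorphism A -> K}) (iA : {rmorphism k -> A}).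
Hypothesis v_inj : injective v.
Hypothesis viA : forall c, v (iA c) = iK c.

(** Reducing a relation modulo [a] kills the coefficients of a^0; what is left is divisible by [a],
    and the quotient is a shorter relation. *)
Lemma independent_powers (a : A) (N J : nat) (z : 'I_N -> A) : a != 0 ->
  independent_mod iA [set a * w | w in setT]%classic z ->
  forall c : 'I_N -> 'I_J -> k, \sum_i \sum_j iA (c i j) * (a ^+ j * z i) = 0 ->
  forall i j, c i j = 0.
Proof.
move=> a0 zi; elim: J => [|J IH] c cz i; first by case.
have E : \sum_i \sum_j iA (c i j) * (a ^+ j * z i) =
    \sum_i iA (c i ord0) * z i +
    a * \sum_i \sum_(j < J) iA (c i (lift ord0 j)) * (a ^+ j * z i).
  rewrite mulr_sumr -big_split; apply: eq_bigr => l _ /=.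
  rewrite big_ord_recl expr0 mul1r mulr_sumr; congr (_ + _); apply: eq_bigr => j _.
  by rewrite lift0 exprS -mulrA mulrCA.
have c0 : forall i, c i ord0 = 0.
  apply: zi; exists (- \sum_i \sum_(j < J) iA (c i (lift ord0 j)) * (a ^+ j * z i)) => //.
  by rewrite mulrN; apply/eqP; rewrite eq_sym -addr_eq0 -E cz.
move: cz; rewrite E big1 ?add0r => [cz|l _]; last by rewrite c0 rmorph0 mul0r.
have {}cz : \sum_i \sum_(j < J) iA (c i (lift ord0 j)) * (a ^+ j * z i) = 0.
  apply: v_inj; rewrite rmorph0; apply/eqP; have := congr1 v cz.
  rewrite rmorphM rmorph0 => /eqP; rewrite mulf_eq0 => /orP[/eqP va|//].
  by case/eqP: a0; apply: v_inj; rewrite va rmorph0.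
move=> j; case: (unliftP ord0 j) => [l ->|->//].
exact: (IH (fun i l => c i (lift ord0 l))).
Qed.

(* With D a common denominator of the a e_l, the N J elements D^J D' a^j z_i are
   combinations of the e_l with polynomial coefficients of size at most s J + s',
   where only D' and s' depend on the family z; so N J <= n (s J + s') for all J. *)
Lemma independent_bound (a : A) : a != 0 -> exists D, forall N (z : 'I_N -> A),
  independent_mod iA [set a * w | w in setT]%classic z -> (N <= D)%N.
Proof.
move=> a0; have [d [s [d0 ds]]] := common_denominator (fun l => v a * e l).
pose S := maxn s (size d).
have stepd B y : represented B y -> represented (S + B) (ev d * y).
  by move=> yB; apply: representedM yB; exact: leq_maxr.
have stepa B y : represented B y -> represented (S + B) (ev d * (v a * y)).
  move=> [c cB ->]; rewrite !mulr_sumr; apply: represented_sum => l.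
  have -> : ev d * (v a * ((map_poly iK (c l)).[x] * e l)) =
     (map_poly iK (c l)).[x] * (ev d * (v a * e l)).
    by rewrite ![v a * _]mulrCA [LHS]mulrCA.
  have [c' cB' ->] := representedM (cB l) (ds l).
  exists c' => // m; apply: leq_trans (cB' m) _; rewrite addnC leq_add2r.
  exact: leq_maxl.
have stepJ B y J j : (j <= J)%N -> represented B y ->
    represented (S * J + B) (ev d ^+ J * (v a ^+ j * y)).
  elim: J j => [|J IH] j.
    by rewrite leqn0 => /eqP -> yB; rewrite !expr0 !mul1r muln0.
  move=> hj yB; rewrite mulnS -addnA.
  case: j hj => [|j] hj.
    have := stepd _ _ (IH 0%N (leq0n _) yB).
    by rewrite mulrA -exprS.
  have := stepa _ _ (IH j hj yB).
  by rewrite !exprS -!mulrA [v a * _]mulrCA.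
exists (n * S)%N => N z zi; rewrite leqNgt; apply/negP => hN.
have [d' [s' [d'0 ds']]] := common_denominator (fun i => v (z i)).
(* If N > n S then N J >= n S J + J, and J > n s' makes this exceed the dimension n (S J + s'). *)
pose J := (n * s').+1.
pose y (ij : 'I_N * 'I_J) := ev d ^+ J * (v a ^+ ij.2 * (ev d' * v (z ij.1))).
have [|ij|c [[[i j] cij] cy]] := @represented_dependent _ y (S * J + s').
- rewrite card_prod !card_ord mulnDr mulnA.
  apply: (@leq_trans ((n * S).+1 * J)); last by rewrite leq_mul2r hN orbT.
  by rewrite mulSn addnC ltn_add2r /J ltnS.
- by apply: stepJ (ds' _); apply: ltnW.
have := @independent_powers a N J z a0 zi (fun i j => c (i, j)) _ i j.
move=> H; move: cij; rewrite H ?eqxx //.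
apply: v_inj; rewrite rmorph0; apply/eqP.
rewrite -(mulrI_eq0 _ (mulfI (mulf_neq0 (expf_neq0 J d0) d'0))) -[X in _ == X]cy.
rewrite pair_big rmorph_sum mulr_sumr; apply/eqP; apply: eq_bigr => -[i' j'] _.
rewrite !rmorphM rmorphXn viA /y /= -/(ev d) -/(ev d').
by rewrite mulrCA -!mulrA; congr (_ * (_ * _)); rewrite mulrCA.
Qed.

End FunctionFieldBound.

Definition finite_basis (k : fieldType) (A : comNzRingType) (iA : k -> A) (N : nat)
    (e : 'I_N -> A) (mu : 'I_N -> A -> k) : Prop :=
  [/\ forall i, (forall x y, mu i (x + y) = mu i x + mu i y) /\
        (forall c x, mu i (iA c * x) = c * mu i x),
      forall i j, mu i (e j) = (i == j)%:R &
      forall x, x = \sum_i iA (mu i x) * e i].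

Lemma finite_basis_is_basis (k : fieldType) (A : comNzRingType) (iA : {rmorphism k -> A})
    (N : nat) (e : 'I_N -> A) (mu : 'I_N -> A -> k) : finite_basis iA e mu ->
  exists s : seq A, uniq s /\ is_basis iA [set` s]%classic.
Proof.
move=> [mulin mue span].
have mu0 i : mu i 0 = 0 by exact: additive0 (mulin i).1.
have ei : injective e.
  move=> i j eij; have := mue i i; rewrite eij mue eqxx.
  by case: eqP => // _ /esym/eqP; rewrite oner_eq0.
exists (codom e); split; first by rewrite map_inj_uniq ?enum_uniq.
split=> [s c us sB sc a sa|x].
  have /codomP [i ai] := sB a sa.
  have := congr1 (mu i) sc; rewrite (big_morph _ (mulin i).1 (mu0 i)) mu0.
  rewrite (bigD1_seq a) //= (mulin i).2 {2}ai mue eqxx mulr1.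
  rewrite big_seq_cond big1 ?addr0 // => b /andP[/sB /codomP [j bj] ba].
  rewrite (mulin i).2 bj mue; case: eqP => [ij|_]; last by rewrite mulr0.
  by rewrite bj ai ij eqxx in ba.
exists (codom e), (fun a => if [pick i | e i == a] is Some i then mu i x else 0).
split; first by rewrite map_inj_uniq ?enum_uniq.
  by [].
rewrite {1}[x]span big_map big_enum; apply: eq_bigr => i _.
case: pickP => [j /eqP/ei ->//|/(_ i)].
by rewrite eqxx.
Qed.

(** * Finite quotients of [A], and a uniformizer at [p] *)

Section Dedekind.
Variables (k K : fieldType) (A : comNzRingType) (iA : {rmorphism k -> A}).
Variable v : {rmorphism A -> K}.
Hypothesis v_inj : injective v.
Variables (p : prime_idealr A) (a : A).
Hypotheses (ap : a \in p) (a0 : a != 0).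
Hypothesis bound : forall a : A, a != 0 -> exists D, forall N (z : 'I_N -> A),
  independent_mod iA [set a * w | w in setT]%classic z -> (N <= D)%N.
Hypothesis closed : forall w (a : A), a != 0 -> (forall m, exists c, v c = w ^+ m * v a) ->
  exists c, v c = w.

Let mulA0 (x y : A) : x * y = 0 -> x != 0 -> y = 0.
Proof.
move=> xy /eqP x0; apply: v_inj; rewrite rmorph0; apply/eqP.
have /eqP := congr1 v xy; rewrite rmorphM rmorph0 mulf_eq0 => /orP[/eqP vx|//].
by case: x0; apply: v_inj; rewrite vx rmorph0.
Qed.

(** Since a^(n+1) lies in p^(n+1), a family independent modulo p^(n+1) is also independent modulo
    a^(n+1) A, which bounds its length. *)
Lemma quo_finite_basis n : exists N (e : 'I_N -> quo p n) (mu : 'I_N -> quo p n -> k),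
  finite_basis (quo_const iA p n) e mu.
Proof.
have an : a ^+ n.+1 != 0.
  apply/eqP => an; case/eqP: a0; apply: v_inj; rewrite rmorph0; apply/eqP.
  by have /eqP := congr1 v an; rewrite rmorphXn rmorph0 expf_eq0 => /andP[].
have [D hD] := bound an.
pose H : set A := [set x | x \in ideal_power p n]%classic.
have [||N z zi|N [z [_ zi zs]]] := @maximal_independent k A iA setT H D.
- by move=> x y /= *; exact: rpredD.
- by move=> c x /= *; exact: idealMr.
- move=> zH; apply: (hD N z) => c [w _ e]; apply: zH => /=.
  by rewrite -e mulrC; apply: idealMr; exact: ideal_power_exp.
have ex (x : quo p n) : exists c : 'I_N -> k, x = \sum_i quo_const iA p n (c i) * to_quo p n (z i).
  elim/quo_ind: x => x; have [c cP] := zs x I; exists c.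
  apply/eqP; rewrite -subr_eq0.
  move: cP; rewrite /H /= -to_quo_eq0 rmorphB rmorph_sum /=.
  by under eq_bigr => i _ do rewrite rmorphM.
have [c cP] := choice ex.
have un (d d' : 'I_N -> k) : \sum_i quo_const iA p n (d i) * to_quo p n (z i) =
    \sum_i quo_const iA p n (d' i) * to_quo p n (z i) -> forall i, d i = d' i.
  move=> dd i; apply/eqP; rewrite -subr_eq0; apply/eqP.
  apply: (zi (fun i => d i - d' i)); apply/idP; rewrite -to_quo_eq0 rmorph_sum /=.
  move/eqP: dd; rewrite -subr_eq0 -sumrB => /eqP dd; apply/eqP; rewrite -[RHS]dd.
  by apply: eq_bigr => j _; rewrite rmorphM rmorphB rmorphB mulrBl.
exists N, (fun i => to_quo p n (z i)), (fun i x => c x i); split=> [i|i j|//].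
- split=> [x y|d x].
    apply: (un (c (x + y)) (fun i => c x i + c y i)).
    rewrite -cP {1}[x]cP {1}[y]cP -big_split; apply: eq_bigr => l _.
    by rewrite rmorphD mulrDl.
  apply: (un (c _) (fun i => d * c x i)).
  rewrite -cP {1}[x]cP mulr_sumr; apply: eq_bigr => l _.
  by rewrite rmorphM mulrA.
- apply: (un (c _) (fun i => (i == j)%:R)).
  rewrite -cP (bigD1 j) //= eqxx rmorph1 mul1r big1 ?addr0 // => l lj.
  by rewrite (negPf lj) rmorph0 mul0r.
Qed.

Let const_notin (c : k) : c != 0 -> iA c \notin p.
Proof.
move=> c0; apply/negP => cp; have := idealMr (iA c^-1) cp.
by rewrite -rmorphM mulVf // rmorph1 idealr1.
Qed.

(** If [b] had no inverse modulo [p], its powers would be independent modulo [p], hence modulo a A,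
    against the bound. *)
Lemma prime_maximal b : b \notin p -> exists b', 1 - b * b' \in p.
Proof.
move=> bp; have [D hD] := bound a0.
apply: contrapT => nb.
suff : (D.+1 <= D)%N by rewrite ltnn.
apply: (hD _ (fun i : 'I_D.+1 => b ^+ i)) => c [w _ aw].
have {aw} : \sum_i iA (c i) * b ^+ i \in p by rewrite -aw mulrC; exact: idealMr.
elim: {hD} D.+1 c => [|m IH] c; first by move=> _ [].
rewrite big_ord_recl expr0 mulr1.
have -> : \sum_(i < m) iA (c (lift ord0 i)) * b ^+ lift ord0 i =
   b * \sum_(i < m) iA (c (lift ord0 i)) * b ^+ i.
  by rewrite mulr_sumr; apply: eq_bigr => i _; rewrite lift0 exprS mulrCA.
move: (IH (fun i => c (lift ord0 i))); set S := \sum_(i < m) _ => {}IH Sp.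
have c0 : c ord0 = 0.
  apply/eqP; apply: contrapT => /negP c0; apply: nb.
  exists (- (iA (c ord0)^-1 * S)).
  have -> : 1 - b * - (iA (c ord0)^-1 * S) = iA (c ord0)^-1 * (iA (c ord0) + b * S).
    by rewrite mulrDr -rmorphM mulVf // rmorph1 mulrN opprK mulrCA.
  exact: idealMr.
move=> i; case: (unliftP ord0 i) => [j ->|->//]; apply: IH.
move: Sp; rewrite c0 rmorph0 add0r prime_idealrM.
by rewrite (negPf bp).
Qed.

Let principal : set A := [set a * w | w in setT]%classic.
Let principalD x y : principal x -> principal y -> principal (x + y).
Proof. by move=> [w _ <-] [w' _ <-]; exists (w + w'); rewrite ?mulrDr. Qed.
Let principalM c x : principal x -> principal (c * x).
Proof. by move=> [w _ <-]; exists (c * w); rewrite // mulrCA. Qed.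

(* [outside b] says that b is not in a A_p.  If every such b had a multiple x b with
   x in p of the same kind, iterating would give elements independent mod a A. *)
Let outside b := forall s, s \notin p -> ~ principal (s * b).

(** [b] represents a nonzero element of the local ring at [p] modulo [a], annihilated by [p]; thus b
    / a carries [p] into the local ring without lying in it. *)
Let socle : exists b, outside b /\ forall x, x \in p -> exists2 s, s \notin p & principal (s * (x * b)).
Proof.
apply: contrapT => nb.
have H b : exists x, outside b -> x \in p /\ outside (x * b).
  have [ob|] := pselect (outside b); last by exists 0.
  apply: contrapT => nx; apply: nb; exists b; split=> // x xp.
  apply: contrapT => ns; apply: nx; exists x => _; split=> // s sp prin.
  by apply: ns; exists s.
have [g gP] := choice H.
pose b_ i := iter i (fun b => g b * b) 1.
have ob i : outside (b_ i).
  elim: i => [s sp [w _]|i IH]; last exact: (gP _ IH).2.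
  rewrite mulr1 => e; case/negP: sp; rewrite -e mulrC; exact: idealMr.
have step i d : exists2 w, w \in p & b_ (i + d.+1)%N = w * b_ i.
  elim: d => [|d [w wp e]].
    by exists (g (b_ i)); [exact: (gP _ (ob i)).1 | rewrite addn1].
  exists (g (b_ (i + d.+1)%N) * w); first exact: idealMr.
  by rewrite -mulrA -e [in LHS]addnS.
have [D hD] := bound a0.
suff : (D.+1 <= D)%N by rewrite ltnn.
apply: (hD _ (fun i : 'I_D.+1 => b_ i)) => c.
(* Later terms are multiples of [b_ s] by elements of [p]. A relation with nonzero first coefficient
   would therefore put (c' 0 + w) b_s in a A with w in [p], although c' 0 + w is outside [p]. *)
have key m : forall s (c : 'I_m -> k), principal (\sum_i iA (c i) * b_ (s + i)%N) -> forall i, c i = 0.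
  elim: m => [|m IH] s c' hp; first by case.
  have c0 : c' ord0 = 0.
    apply/eqP; apply: contrapT => /negP c0.
    have : exists2 w, w \in p & \sum_(i < m) iA (c' (lift ord0 i)) * b_ (s + lift ord0 i)%N = w * b_ s.
      have H' (i : 'I_m) : exists w, w \in p /\ b_ (s + lift ord0 i)%N = w * b_ s.
        by have [w wp e] := step s i; exists w; rewrite lift0.
      have [w wP] := choice H'.
      exists (\sum_i iA (c' (lift ord0 i)) * w i).
        by apply: rpred_sum => i _; apply: idealMr; exact: (wP i).1.
      rewrite mulr_suml; apply: eq_bigr => i _.
      by rewrite (wP i).2 mulrA.
    move=> [w wp e]; move: hp; rewrite big_ord_recl addn0 e -mulrDl.
    apply: ob; apply/negP => h; case/negP: (const_notin c0).
    by rewrite -(addrK w (iA _)); apply: rpredB.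
  move: hp; rewrite big_ord_recl c0 rmorph0 mul0r add0r => hp i.
  case: (unliftP ord0 i) => [j ->|->//].
  apply: (IH s.+1 (fun i => c' (lift ord0 i))).
  by move: hp; congr principal; apply: eq_bigr => l _; rewrite lift0 addnS.
by move=> hp; apply: (key _ 0%N).
Qed.

(** If b p were contained in a p, then (b / a)^m a would be in A for all m and [closed] would give b
    / a in A, contradicting the choice of [b]. Hence some [pi] in [p] has b pi = a u with [u]
    outside [p]. *)
Lemma local_generator : exists b u pi, [/\ pi \in p, u \notin p, b * pi = a * u &
  forall x, x \in p -> exists x', b * x = a * x'].
Proof.
have [b1 [ob1 b1P]] := socle.
have [D hD] := bound a0.
have [||N z zp zi|N [z [zp _ zs]]] := @maximal_independent k A iA [set x | x \in p]%classic principal D.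
- exact: principalD.
- exact: principalM.
- exact: (hD N z zi).
have H i : exists s, s \notin p /\ principal (s * (z i * b1)).
  by have [s sp h] := b1P _ (zp i); exists s.
have [s sP] := choice H.
(* Modulo a A the ideal [p] is spanned by finitely many elements, so one product clears the
   multipliers that the socle condition requires. *)
pose S := \prod_i s i.
have Sp : S \notin p.
  rewrite /S; elim/big_ind: _ => [|x y hx hy|i _]; first by rewrite idealr1.
    by rewrite prime_idealrM negb_or hx hy.
  exact: (sP i).1.
have bx x : x \in p -> exists x', (S * b1) * x = a * x'.
  move=> xp; suff [w _ e] : principal ((S * b1) * x) by exists w.
  have [c [w _ e]] := zs x xp.
  rewrite -(subrK (\sum_i iA (c i) * z i) x) -e mulrDr; apply: principalD.
    by exists (S * b1 * w); rewrite // mulrCA.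
  rewrite mulr_sumr; elim/big_ind: _ => [|//|i _].
  - by exists 0; rewrite // mulr0.
  - rewrite mulrCA -mulrA; apply: principalM.
    rewrite /S (bigD1 i) //= [b1 * _]mulrC -mulrA mulrCA.
    by apply: principalM; exact: (sP i).2.
set b := S * b1 in bx.
have nb : ~ principal b by exact: ob1.
clearbody b.
suff [pi [pip [u [up e]]]] : exists pi, pi \in p /\ exists u, u \notin p /\ b * pi = a * u.
  by exists b, u, pi.
apply: contrapT => nu; apply: nb.
have va : v a != 0.
  by apply/eqP => va; case/eqP: a0; apply: v_inj; rewrite va rmorph0.
have [|c vc] := @closed (v b / v a) a a0; last first.
  exists c => //; apply: v_inj; rewrite rmorphM vc mulrCA mulfV ?mulr1 //.
suff Hm m : exists2 c, c \in p & v c = (v b / v a) ^+ m * v a.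
  by move=> m; have [c _] := Hm m; exists c.
elim: m => [|m [c cp vc]]; first by exists a; rewrite // expr0 mul1r.
have [c' e] := bx c cp; exists c'.
  apply: contrapT => /negP c'p; apply: nu; exists c; split=> //.
  by exists c'.
apply: (mulfI va); rewrite -rmorphM -e rmorphM vc exprS -!mulrA.
by rewrite [v a * (v b * _)]mulrCA mulVKf.
Qed.

(** Locally pi / u is a / b. Both divisibility clauses are checked after multiplication by [a],
    using a u = b pi; in the last one [b] is absorbed by a factor of each product, which costs one
    power of [p]. *)
Lemma uniformizer : exists pi u, [/\ pi \in p, u \notin p,
  forall x, x \in p -> exists x', u * x = pi * x' &
  forall m z, pi * z \in ideal_power p m.+1 -> u * z \in ideal_power p m].
Proof.
have [b [u [pi [pip up e bx]]]] := local_generator; exists pi, u; split=> //.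
  move=> x xp; have [x' ex] := bx x xp; exists x'.
  apply/eqP; rewrite -subr_eq0; apply/eqP; apply: (@mulA0 a) => //.
  by rewrite mulrBr mulrA -e mulrCA -ex mulrCA -mulrA mulrCA mulrC -mulrA [x * _]mulrC subrr.
move=> m z /asboolP [N [c [cp ez]]].
have H i : exists x', b * c i ord0 = a * x' by exact: bx.
have [x' xE] := choice H.
have -> : u * z = \sum_i x' i * \prod_(j < m.+1) c i (lift ord0 j).
  apply/eqP; rewrite -subr_eq0; apply/eqP; apply: (@mulA0 a) => //.
  apply/eqP; rewrite mulrBr subr_eq0 mulrA -e -mulrA ez !mulr_sumr; apply/eqP.
  by apply: eq_bigr => i _; rewrite [in LHS]big_ord_recl mulrA xE mulrA.
apply: rpred_sum => i _; apply: idealMr; exact: ideal_power_prod.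
Qed.

Variables (Ap : idomainType) (l : adic_ring p Ap).

(** A representative c at level n is outside [p], so c c' is 1 modulo [p] for some c'. The
    difference is nilpotent modulo p^(n+1) and a finite geometric series inverts c c'. *)
Lemma adic_unit_of_notin (x : Ap) : lim_proj l 0 x != 0 -> x \is a GRing.unit.
Proof.
move=> x0; apply: (@lim_unit _ _ (fun n => @quo_trans A p n : {rmorphism _ -> _}) (fun n => erefl) Ap l).
move=> n; move: (erefl (lim_proj l n x)).
move: {2}(lim_proj l n x) => y; elim/quo_ind: y => c xc.
have cp : c \notin p.
  have : lim_proj l 0 x = to_quo p 0 c.
    elim: n xc => // n IH xc; apply: IH.
    by rewrite -(lim_compat l) xc quo_trans_to_quo.
  by move=> e; rewrite e to_quo_eq0 ideal_power0 in x0.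
have [c' cc'] := prime_maximal cp.
have nil : to_quo p n (1 - c * c') ^+ n.+1 = 0.
  by apply/eqP; rewrite -rmorphXn /= to_quo_eq0; exact: ideal_power_exp.
exists (to_quo p n c' * \sum_(i < n.+1) to_quo p n (1 - c * c') ^+ i).
rewrite xc mulrAC -rmorphM /= [c' * c]mulrC.
have := subrX1 (to_quo p n (1 - c * c')) n.+1; rewrite nil sub0r.
have -> : to_quo p n (1 - c * c') - 1 = - to_quo p n (c * c').
  by rewrite rmorphB rmorph1 addrAC subrr add0r.
by rewrite mulNr => /oppr_inj <-.
Qed.

Lemma adic_uniformizer : exists P : Ap, P != 0 /\
  forall n y, lim_proj l n y = 0 <-> exists z, y = P ^+ n.+1 * z.
Proof.
have [pi [u [pip up gen can]]] := uniformizer.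
have [h [_ hE]] := to_adic_rmorph l.
have U : h u \is a GRing.unit.
  by apply: adic_unit_of_notin; rewrite hE to_quo_eq0 ideal_power0.
have uquo n x : to_quo p n u * x = 0 -> x = 0.
  move=> ux; have : lim_proj l n (h u)^-1 * lim_proj l n (h u) = 1.
    by rewrite -rmorphM mulVr // rmorph1.
  by rewrite hE => e; rewrite -[x]mul1r -e -mulrA ux mulr0.
have can' n z : lim_proj l n.+1 (h pi * z) = 0 -> lim_proj l n z = 0.
  move=> /eqP; rewrite rmorphM hE.
  move: (erefl (lim_proj l n.+1 z)); move: {2}(lim_proj l n.+1 z) => y.
  elim/quo_ind: y => c zc; rewrite zc -rmorphM to_quo_eq0 => /can.
  rewrite -to_quo_eq0 rmorphM => /eqP/uquo e.
  by rewrite -(lim_compat l) zc quo_trans_to_quo.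
have sub0 n x : x \in ideal_power p n -> x \in ideal_power p 0.
  by elim: n => // n IH /ideal_powerS.
have step y : lim_proj l 0 y = 0 -> exists z, y = h pi * z.
  (* [c m] represents [y] modulo p^(m+2), one power more than level m sees, because cancelling [pi]
     in the comparison of the quotients [c' m] loses one. *)
  move=> y0; pose c m := repr (lim_proj l m.+1 y).
  have cE m : to_quo p m.+1 (c m) = lim_proj l m.+1 y by exact: to_quo_repr.
  have cE' m : to_quo p m (c m) = lim_proj l m y.
    by rewrite -(lim_compat l) -cE quo_trans_to_quo.
  have cp m : c m \in p.
    rewrite -ideal_power0 -to_quo_eq0 -y0; apply/eqP.
    elim: m {-2}m (leqnn m) => [|m IH] m' hm; first by move: hm; rewrite leqn0 => /eqP ->; exact: cE'.
    case: m' hm => [|m'] hm; first exact: cE'.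
    rewrite -(IH m') //; apply/eqP; rewrite -subr_eq0 -rmorphB to_quo_eq0.
    have : c m'.+1 - c m' \in ideal_power p m'.+1.
      by rewrite -to_quo_eq0 rmorphB /= cE cE' subrr.
    exact: sub0.
  have H m : exists c', u * c m = pi * c' by apply: gen.
  have [c' cc'] := choice H.
  have [|z [zP _]] := @lim_universal _ _ _ l (fun m => to_quo p m (c' m)).
    move=> m; rewrite quo_trans_to_quo; apply/eqP; rewrite -subr_eq0 -rmorphB /=; apply/eqP.
    apply: uquo; rewrite -rmorphM; apply/eqP; rewrite to_quo_eq0; apply: can.
    rewrite mulrBr -!cc' -mulrBr; apply: idealMr.
    by rewrite -to_quo_eq0 rmorphB /= cE cE' subrr.
  exists ((h u)^-1 * z); rewrite mulrCA; apply: (canRL (mulKr U)).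
  apply: (lim_ext (l := l)) => m; rewrite !rmorphM !hE zP -cE' -!rmorphM.
  by rewrite cc'.
have P0 : h pi != 0.
  apply/eqP => h0; have : lim_proj l 1 (h pi * 1) = 0 by rewrite h0 mul0r rmorph0.
  by move=> /can' /eqP; rewrite rmorph1 oner_eq0.
exists (h pi); split=> // n y; split; last first.
  move=> [z ->]; rewrite rmorphM -rmorphXn hE; apply/eqP.
  suff -> : to_quo p n (pi ^+ n.+1) = 0 by rewrite mul0r.
  by apply/eqP; rewrite to_quo_eq0; exact: ideal_power_exp.
elim: n y => [|n IH] y yn; first by have [z ->] := step y yn; exists z; rewrite expr1.
have [|z yz] := step y.
  elim: n.+1 yn => // m IHm yn; apply: IHm.
  by rewrite -(lim_compat l) yn rmorph0.
have [w zw] : exists w, z = h pi ^+ n.+1 * w by apply: IH; apply: can'; rewrite -yz.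
by exists w; rewrite yz zw mulrA -exprS.
Qed.

End Dedekind.

Section AffineRing.
Variables (Fq : finFieldType) (K : fieldType) (iK : {rmorphism Fq -> K}) (oo : place iK).
Local Notation A := (affine_ring oo).

Fact affine_const_is_zmod_morphism : zmod_morphism (@affine_const Fq K iK oo).
Proof. by move=> x y; apply: val_inj; rewrite /= !rmorphB. Qed.
Fact affine_const_is_monoid_morphism : monoid_morphism (@affine_const Fq K iK oo).
Proof. by split=> [|x y]; apply: val_inj; rewrite /= ?rmorph1 ?rmorphM. Qed.
HB.instance Definition _ := GRing.isZmodMorphism.Build _ _ (@affine_const Fq K iK oo)
  affine_const_is_zmod_morphism.
HB.instance Definition _ := GRing.isMonoidMorphism.Build _ _ (@affine_const Fq K iK oo)
  affine_const_is_monoid_morphism.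

Lemma place_exp (v : place iK) x m : x != 0 -> v (x ^+ m) = v x *+ m.
Proof.
move=> x0; elim: m => [|m IH].
  by rewrite expr0 -(rmorph1 iK) ord_const ?oner_neq0.
by rewrite exprS ord_mul ?expf_neq0 // IH mulrS.
Qed.

Lemma affine_ring_closed (w : K) (a : A) : a != 0 ->
  (forall m, exists c : A, val c = w ^+ m * val a) -> exists c : A, val c = w.
Proof.
move=> a0 h; suff rw : regular_away oo w by exists (Sub w rw).
have va0 : val a != 0.
  by apply: contraNneq a0 => e; apply/eqP/val_inj; rewrite e.
apply/asboolP => v voo w0; rewrite leNgt; apply/negP => vw.
(* With v w <= -1 this exponent gives v (w^m a) <= -1, which contradicts regularity at v. *)
have [c e] := h (`|v (val a)|%N.+1).
have vc : 0 <= v (val c).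
  by apply: (asboolP _ (valP c)) => //; rewrite e mulf_neq0 ?expf_neq0.
move: vc; rewrite e ord_mul ?expf_neq0 // place_exp //.
rewrite leNgt => /negP; apply.
have h1 : v w *+ (`|v (val a)|%N.+1) <= - (`|v (val a)|%N.+1)%:Z.
  rewrite -mulr_natr -[leRHS]mulN1r natz; apply: ler_wpM2r => //.
have h2 : v (val a) <= `|v (val a)|%N by rewrite abszE ler_norm.
apply: le_lt_trans (lerD h1 h2) _.
by rewrite -addn1 PoszD opprD addrAC addNr.
Qed.

Hypothesis hK : is_function_field iK.

Lemma affine_ring_bound (a : A) : a != 0 -> exists D, forall N (z : 'I_N -> A),
  independent_mod (@affine_const Fq K iK oo) [set a * w | w in setT]%classic z -> (N <= D)%N.
Proof.
have [[x [_ [n [e gen]]]] _] := hK.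
exact: (independent_bound gen (v := val) (iA := @affine_const Fq K iK oo) val_inj (fun c => erefl)).
Qed.
End AffineRing.

(** * Descent from C to the separable closure *)

Section Etale.
Variables (L Ls C : fieldType) (i : {rmorphism L -> Ls}) (j : {rmorphism Ls -> C}).
Hypothesis separable_in : forall x : C, (exists2 f : {poly L}, separable_poly f &
  root (map_poly (j \o i) f) x) -> exists y, x = j y.
Variables (q : nat) (phiL : {rmorphism L -> L}) (phiC : {rmorphism C -> C}).
Hypothesis q0 : q%:R = 0 :> L.
Hypothesis phiLE : forall x, phiL x = x ^+ q.
Hypothesis phiCE : forall x, phiC x = x ^+ q.

Local Notation iota := (j \o i).

Let phi_iota x : phiC (iota x) = iota (phiL x).
Proof. by rewrite phiCE phiLE rmorphXn. Qed.

(* The derivative of this polynomial is the nonzero constant c_0. *)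
Let separable_additive n (c : 'I_n.+1 -> L) x : c ord0 != 0 ->
  \sum_a iota (c a) * x ^+ (q ^ a) = 0 -> exists y, x = j y.
Proof.
move=> c0 cx; apply: separable_in.
pose f := \sum_(a < n.+1) c a *: 'X^(q ^ a).
exists f; last first.
  rewrite /root /f rmorph_sum horner_sum /=; apply/eqP; rewrite -[RHS]cx.
  apply: eq_bigr => a _.
  by rewrite -mul_polyC rmorphM /= map_polyC hornerM hornerC map_polyXn hornerXn.
have -> : separable_poly f = coprimep f f^`() by rewrite unlock.
suff -> : f^`() = c ord0 *: 1 by rewrite coprimepZr // coprimep1.
rewrite /f raddf_sum big_ord_recl /= derivZ expn0 expr1 derivX big1 ?addr0 // => a _.
rewrite derivZ derivXn /bump leq0n add1n expnS -mulr_natr natrM.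
by rewrite -polyC_natr q0 mul0r mulr0 scaler0.
Qed.

(** If the coordinates of [u] satisfy a linear relation over [L], fewer of them suffice and again
    solve such a system. Otherwise [D] is invertible, so that u^q = u G. Then every power
    (u_l)^(q^k) is an [L]-combination of the coordinates of [u], and the first linear dependence
    among these combinations gives an additive polynomial killing u_l, separable because its
    coefficient c_0 is nonzero. *)
Lemma etale_system (n : nat) (u : 'rV[C]_n) (D : 'M[L]_n) :
  u = map_mx phiC u *m map_mx iota D -> forall l, exists y, u 0 l = j y.
Proof.
elim/ltn_ind: n u D => n IH u D uE.
have [[c [c0 uc]]|indep] := pselect (exists c : 'cV[L]_n, c != 0 /\ u *m map_mx iota c = 0).
  have [m [lt [B [E uw]]]] : exists m, (m < n)%N /\ exists (B : 'M[L]_(m, n)) (E : 'M[L]_(n, m)),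
      u = u *m map_mx iota E *m map_mx iota B.
    exists (\rank (kermx c)); split.
      rewrite mxrank_ker ltn_subrL lt0n mxrank_eq0 c0 /=.
      case: n {u D uE IH uc} c c0 => // c; rewrite (_ : c = 0) ?eqxx //.
      by apply/colP => -[].
    exists (row_base (kermx c)), (pinvmx (row_base (kermx c))).
    rewrite map_pinvmx mulmxKpV //.
    have : (u <= kermx (map_mx iota c))%MS by apply/sub_kermxP.
    rewrite -map_kermx => /submx_trans; apply.
    have -> : map_mx iota (kermx c) =
        map_mx iota (col_base (kermx c)) *m map_mx iota (row_base (kermx c)).
      by rewrite -map_mxM mulmx_base.
    exact: submxMl.
  pose w := u *m map_mx iota E.
  have {}uw : u = w *m map_mx iota B by [].
  have wS := IH _ lt w (map_mx phiL B *m D *m E) _.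
  have {}wS : forall l, exists y, w 0 l = j y.
    apply: wS; rewrite {1}/w {1}uE {1}uw !map_mxM !mulmxA; congr (_ *m _ *m _ *m _).
    by apply/matrixP => a b; rewrite !mxE; exact: phi_iota.
  have [y yP] := choice wS.
  move=> l; rewrite uw mxE; exists (\sum_k y k * i (B k l)).
  by rewrite rmorph_sum; apply: eq_bigr => k _; rewrite yP mxE rmorphM.
have inj_u (c : 'cV[L]_n) : u *m map_mx iota c = 0 -> c = 0.
  by move=> uc; apply/eqP; apply: contrapT => /negP c0; apply: indep; exists c.
have Du : D \in unitmx.
  rewrite -unitmx_tr -row_free_unit -kermx_eq0; apply/eqP/row_matrixP => a.
  rewrite row0; set v := row a _.
  have vD : D *m v^T = 0.
    apply: trmx_inj; rewrite trmx_mul trmxK trmx0; apply/sub_kermxP; exact: row_sub.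
  apply: trmx_inj; rewrite trmx0; apply: inj_u.
  by rewrite uE -mulmxA -map_mxM vD map_mx0 mulmx0.
pose G := invmx D.
have uG : map_mx phiC u = u *m map_mx iota G.
  by rewrite [in RHS]uE -mulmxA -map_mxM mulmxV // map_mx1 mulmx1.
move=> l.
pose d := fix d k : 'cV[L]_n := if k is k'.+1 then G *m map_mx phiL (d k') else delta_mx l 0.
have ud k : u *m map_mx iota (d k) = const_mx (u 0 l ^+ (q ^ k)).
  elim: k => [|k IHk].
    apply/matrixP => a b; rewrite !mxE !ord1 expr1 (bigD1 l) //= big1 ?addr0.
      by rewrite !mxE !eqxx rmorph1 mulr1.
    by move=> m ml; rewrite !mxE (negPf ml) rmorph0 mulr0.
  rewrite /= map_mxM mulmxA -uG.
  have -> : map_mx iota (map_mx phiL (d k)) = map_mx phiC (map_mx iota (d k)).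
    by apply/matrixP => a b; rewrite !mxE; exact/esym/phi_iota.
  rewrite -map_mxM IHk; apply/matrixP => a b; rewrite !mxE phiCE -exprM.
  by rewrite expnSr.
pose X k : 'M[L]_(k, n) := \matrix_(a < k) (d a)^T.
have dep : exists k, ~~ row_free (X k.+1).
  by exists n; rewrite /row_free neq_ltn ltnS rank_leq_col.
case: (ex_minnP dep) => k notfree kmin.
have free : row_free (X k).
  case: k kmin {notfree} => [|k] kmin; first by rewrite /row_free flatmx0 mxrank0.
  by apply: contraT => /kmin; rewrite ltnn.
move: notfree; rewrite -kermx_eq0 => /rowV0Pn [c /sub_kermxP cX c0].
have cd : \sum_a c 0 a *: d a = 0.
  apply: trmx_inj; rewrite trmx0 -cX; apply/rowP => b.
  by rewrite !mxE summxE; apply: eq_bigr => a _; rewrite !mxE.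
apply: (@separable_additive k (fun a => c 0 a)); last first.
  have := congr1 (fun M => u *m map_mx iota M) cd.
  rewrite map_mx0 mulmx0 raddf_sum mulmx_sumr => /matrixP/(_ 0 0).
  rewrite summxE [RHS]mxE => e; rewrite -[RHS]e; apply: eq_bigr => a _.
  by rewrite /= map_mxZ -scalemxAr ud !mxE.
apply: contra c0 => /eqP c00.
pose c' : 'rV[L]_k := \row_a c 0 (lift ord0 a).
(* Were c_0 zero, cancelling the invertible [G] would leave a relation among the Frobenius twists of
   d 0, ..., d (k-1). These are still independent, as a field morphism preserves rank. *)
have c'0 : c' = 0.
  apply: (row_free_inj (A := map_mx phiL (X k))); first by rewrite row_free_map.
  rewrite mul0mx; apply: trmx_inj; rewrite trmx0.
  have Gu : G \in unitmx by rewrite unitmx_inv.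
  apply: (can_inj (mulKmx Gu)); rewrite mulmx0 -[RHS]cd big_ord_recl c00 scale0r add0r trmx_mul.
  have -> : (map_mx phiL (X k))^T *m c'^T = \sum_(a < k) c' 0 a *: map_mx phiL (d a).
    apply/colP => b; rewrite !mxE summxE; apply: eq_bigr => a _.
    by rewrite !mxE mulrC.
  rewrite mulmx_sumr; apply: eq_bigr => a _.
  by rewrite -scalemxAr !mxE.
apply/eqP/rowP => a; rewrite mxE; case: (unliftP ord0 a) => [b ->|->//].
by have := congr1 (fun M : 'rV_k => M 0 b) c'0; rewrite !mxE.
Qed.
End Etale.

Section FiniteTensor.
Variables (k : fieldType) (Q F T : comNzRingType).
Variables (iQ : {rmorphism k -> Q}) (iF : {rmorphism k -> F}) (t : tensor_product iQ iF T).
Variables (N : nat) (e : 'I_N -> Q) (mu : 'I_N -> Q -> k).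
Hypothesis emu : finite_basis iQ e mu.

Let muD b x y : mu b (x + y) = mu b x + mu b y.
Proof. by case: emu => h _ _; case: (h b). Qed.
Let muZ b c x : mu b (iQ c * x) = c * mu b x.
Proof. by case: emu => h _ _; case: (h b). Qed.

Lemma contract_expand z : z = \sum_b tens t (e b) (contract t (mu b) z).
Proof.
have [_ _ span] := emu.
elim/(@tens_ind _ _ _ _ _ _ t): z => [|x y hx hy|a f].
- by rewrite big1 // => b _; rewrite (contract0 t (muD b) (muZ b)) tens0r.
- rewrite {1}hx {1}hy -big_split; apply: eq_bigr => b _.
  by rewrite (contractD t (muD b) (muZ b)) tensDr.
- rewrite {1}[a]span (big_morph (fun a => tens t a f) (fun x y => tensDl t x y f) (tens0l t f)).
  by apply: eq_bigr => b _; rewrite (contractT t (muD b) (muZ b)) tens_constl tens_constr.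
Qed.

Lemma contract_ext z z' : (forall b, contract t (mu b) z = contract t (mu b) z') -> z = z'.
Proof.
by move=> zz; rewrite [z]contract_expand [z']contract_expand; apply: eq_bigr => b _; rewrite zz.
Qed.
End FiniteTensor.

Section LevelDescent.
Variables (k : fieldType) (Q : comNzRingType) (Ls C : fieldType) (T T' : comNzRingType).
Variables (iQ : {rmorphism k -> Q}) (iLs : {rmorphism k -> Ls}) (iC : {rmorphism k -> C}).
Variables (t : tensor_product iQ iLs T) (t' : tensor_product iQ iC T').
Variables (j : {rmorphism Ls -> C}) (h : {rmorphism T -> T'}).
Hypothesis jc : forall c, j (iLs c) = iC c.
Hypothesis hT : forall a f, h (tens t a f) = tens t' a (j f).
Variables (N : nat) (e : 'I_N -> Q) (mu : 'I_N -> Q -> k).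
Hypothesis emu : finite_basis iQ e mu.

Let muD b x y : mu b (x + y) = mu b x + mu b y.
Proof. by case: emu => h' _ _; case: (h' b). Qed.
Let muZ b c x : mu b (iQ c * x) = c * mu b x.
Proof. by case: emu => h' _ _; case: (h' b). Qed.

Let contract_map b z : contract t' (mu b) (h z) = j (contract t (mu b) z).
Proof. exact: contract_tensor_map (muD b) (muZ b) jc hT z. Qed.

Lemma level_inj : injective h.
Proof.
move=> x y xy; apply: (contract_ext (t := t) emu) => b; apply: (fmorph_inj j).
by rewrite -!contract_map xy.
Qed.

Lemma level_range z' : (forall b, exists y, contract t' (mu b) z' = j y) -> exists z, h z = z'.
Proof.
move=> H; have [y yP] := choice H; exists (\sum_b tens t (e b) (y b)).
rewrite rmorph_sum [RHS](contract_expand t' emu); apply: eq_bigr => b _.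
by rewrite hT yP.
Qed.

(* Multiplication by z on A/p^(n+1) \otimes Ls has a matrix over Ls, which is
   invertible as soon as it is invertible over C. *)
Lemma level_unit z : (exists s, s * h z = 1) -> exists w, w * z = 1.
Proof.
move=> [s shz].
pose M (F : fieldType) (iF : {rmorphism k -> F}) (S : comNzRingType)
  (tS : tensor_product iQ iF S) (x : S) : 'M[F]_N :=
  \matrix_(a, b) contract tS (mu b) (tens tS (e a) 1 * x).
have ME (F : fieldType) (iF : {rmorphism k -> F}) (S : comNzRingType) (tS : tensor_product iQ iF S) x a : tens tS (e a) 1 * x = \sum_b tens tS (e b) (@M F iF S tS x a b).
  by rewrite [LHS](contract_expand tS emu); apply: eq_bigr => b _; rewrite mxE.
have tE (F : fieldType) (iF : {rmorphism k -> F}) (S : comNzRingType) (tS : tensor_product iQ iF S) a f :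
    tens tS a f = tensr tS f * tens tS a 1.
  by rewrite /tens rmorph1 mulr1 mulrC.
have MM : M _ _ _ t' s *m M _ _ _ t' (h z) = 1%:M.
  apply/matrixP => a b; rewrite !mxE.
  under eq_bigr => c _ do rewrite [M _ _ _ t' (h z) c b]mxE -(contractZ t' (muD b) (muZ b)) mulrA -tE.
  rewrite -(contract_sum t' (muD b) (muZ b)) -mulr_suml -ME -mulrA shz mulr1.
  have [_ mue _] := emu.
  by rewrite (contractT t' (muD b) (muZ b)) mue mulr1 eq_sym; case: eqP; rewrite ?rmorph1 ?rmorph0.
have Mh : M _ _ _ t' (h z) = map_mx j (M _ _ _ t z).
  apply/matrixP => a b; rewrite !mxE -contract_map rmorphM hT rmorph1.
  by [].
have Mu : M _ _ _ t z \in unitmx.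
  rewrite -(map_unitmx j) -Mh.
  by case/mulmx1_unit: MM.
pose v : 'rV[Ls]_N := \row_b contract t (mu b) 1.
pose w := v *m invmx (M _ _ _ t z).
exists (\sum_a tens t (e a) (w 0 a)).
apply: (contract_ext (t := t) emu) => b.
rewrite mulr_suml (contract_sum t (muD b) (muZ b)).
transitivity ((w *m M _ _ _ t z) 0 b); last by rewrite mulmxKV // mxE.
rewrite mxE; apply: eq_bigr => a _.
by rewrite [M _ _ _ t z a b]mxE -(contractZ t (muD b) (muZ b)) mulrA -tE.
Qed.

Variables (L : fieldType) (i : {rmorphism L -> Ls}).
Hypothesis separable_in : forall x : C, (exists2 f : {poly L}, separable_poly f &
  root (map_poly (j \o i) f) x) -> exists y, x = j y.
Variables (q : nat) (phiL : {rmorphism L -> L}) (phiC : {rmorphism C -> C}).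
Hypothesis q0 : q%:R = 0 :> L.
Hypothesis phiLE : forall x, phiL x = x ^+ q.
Hypothesis phiCE : forall x, phiC x = x ^+ q.
Variable iL : {rmorphism k -> L}.
Hypothesis ic : forall c, i (iL c) = iLs c.
Variable tau : {rmorphism T' -> T'}.
Hypothesis tauT : forall a f, tau (tens t' a f) = tens t' a (phiC f).

(** The image of [Q \otimes L], spelled out in sums since no such tensor product is among the data
    at this level. *)
Definition rational (z : T') : Prop :=
  exists s : seq (Q * L), z = \sum_(x <- s) tens t' x.1 (j (i x.2)).

(** Frobenius fixes the basis [e] and acts on coordinates alone. In coordinates the equation is an
    etale system of size [r * N] whose matrix has entries in [L]. *)
Lemma level_lift (r : nat) (u : 'rV[T']_r) (Theta : 'M[T']_r) :
  (forall a b, rational (Theta a b)) -> u = map_mx tau u *m Theta ->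
  forall l, exists z, h z = u 0 l.
Proof.
move=> rat uE.
have H (x : ('I_r * 'I_N) * ('I_r * 'I_N)) : exists y : L,
    contract t' (mu x.2.2) (tens t' (e x.1.2) 1 * Theta x.1.1 x.2.1) = j (i y).
  have [s ->] := rat x.1.1 x.2.1; have D := contract_sum t' (muD x.2.2) (muZ x.2.2).
  exists (\sum_(y <- s) iL (mu x.2.2 (e x.1.2 * y.1)) * y.2).
  rewrite mulr_sumr D !rmorph_sum; apply: eq_bigr => y _.
  by rewrite tensM mul1r (contractT t' (muD _) (muZ _)) !rmorphM ic jc.
have [D DP] := choice H.
pose U : 'rV[C]_#|{: 'I_r * 'I_N}| := \row_x contract t' (mu (enum_val x).2) (u 0 (enum_val x).1).
pose D' : 'M[L]_#|{: 'I_r * 'I_N}| := \matrix_(x, y) D (enum_val x, enum_val y).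
have UE : U = map_mx phiC U *m map_mx (j \o i) D'.
  apply/rowP => y; rewrite [LHS]mxE [RHS]mxE.
  rewrite (reindex (@enum_rank _)) /=; last by apply: onW_bij; exact: enum_rank_bij.
  case ey: (enum_val y) => [l b] /=.
  transitivity (\sum_m \sum_a phiC (contract t' (mu a) (u 0 m)) * j (i (D ((m, a), (l, b))))).
    rewrite {1}uE mxE (contract_sum t' (muD b) (muZ b)).
    apply: eq_bigr => m _; rewrite mxE {1}[u 0 m](contract_expand t' emu).
    rewrite rmorph_sum mulr_suml (contract_sum t' (muD b) (muZ b)); apply: eq_bigr => a _.
    rewrite -DP /= -(contractZ t' (muD b) (muZ b)).
    by rewrite mulrA tauT -tens1l tensM mul1r mulr1.
  rewrite pair_big /=; apply: eq_bigr => -[m a] _.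
  by rewrite !mxE enum_rankK /= ey.
move=> l; apply: level_range => b.
have [y yE] := etale_system separable_in q0 phiLE phiCE UE (enum_rank (l, b)).
by exists y; rewrite -yE mxE enum_rankK.
Qed.
End LevelDescent.

Section AdicDescent.
Variables (k : fieldType) (A : comNzRingType) (iA : {rmorphism k -> A}) (p : idealr A).
Variables (Ls C : fieldType) (iLs : {rmorphism k -> Ls}) (iC : {rmorphism k -> C}).
Variables (Y Y' : comUnitRingType) (t : adic_tensor iA p iLs Y) (t' : adic_tensor iA p iC Y').
Variables (j : {rmorphism Ls -> C}) (G : {rmorphism Y -> Y'}).
Variable h : forall n, {rmorphism level t n -> level t' n}.
Hypothesis jc : forall c, j (iLs c) = iC c.
Hypothesis hG : levelwise (t := t) (t' := t') j G h.
Hypothesis fin : forall n, exists N (e : 'I_N -> quo p n) (mu : 'I_N -> quo p n -> k),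
  finite_basis (quo_const iA p n) e mu.

Let hT n a f : h n (tens (level_tensor t n) a f) = tens (level_tensor t' n) a (j f).
Proof. by case: (hG n) => ->. Qed.

Let h_inj n : injective (h n).
Proof.
have [N [e [mu emu]]] := fin n.
exact: (level_inj (t := level_tensor t n) (t' := level_tensor t' n) jc (hT (n := n)) emu).
Qed.

Lemma adic_map_inj : injective G.
Proof.
move=> x y xy; apply: (lim_ext (l := level_limit t)) => n; apply: h_inj.
by case: (hG n) => _ GE; rewrite -!GE xy.
Qed.

(** The preimages are unique at every level, so they form a compatible family. *)
Lemma adic_map_range y' : (forall n, exists z, h n z = lim_proj (level_limit t') n y') ->
  exists y, G y = y'.
Proof.
move=> /dependent_choice [z zP].
have [r rP] := adic_trans_rmorph t; have [r' rP'] := adic_trans_rmorph t'.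
have [n|y [yP _]] := @lim_universal _ _ _ (level_limit t) z.
  rewrite (rP n).1; apply: h_inj; rewrite zP -(lim_compat (level_limit t')) (rP' n).1 -zP.
  apply: (tens_rmorph_ext (t := level_tensor t n.+1) (g := h n \o r n) (h := r' n \o h n.+1)) => a f.
  by rewrite /= (rP n).2 !hT (rP' n).2.
exists y; apply: (lim_ext (l := level_limit t')) => n.
by case: (hG n) => _ ->; rewrite yP zP.
Qed.

Lemma adic_map_unit y : G y \is a GRing.unit -> y \is a GRing.unit.
Proof.
move=> Gy; apply: (adic_unit (t := t)) => n; have [N [e [mu emu]]] := fin n.
apply: (level_unit (t := level_tensor t n) (t' := level_tensor t' n) jc (hT (n := n)) emu).
exists (lim_proj (level_limit t') n (G y)^-1).
by case: (hG n) => _ <-; rewrite -rmorphM mulVr // rmorph1.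
Qed.
End AdicDescent.

(** * Duality between K_p / A_p and A_p *)

Section Residue.
Variables (k : fieldType) (A : comNzRingType) (iA : {rmorphism k -> A}) (p : idealr A).
Variables (Ap : idomainType) (l : adic_ring p Ap).
Variable P : Ap.
Hypothesis P0 : P != 0.
Hypothesis PE : forall n y, lim_proj l n y = 0 <-> exists z, y = P ^+ n.+1 * z.
Hypothesis unitE : forall y, lim_proj l 0 y != 0 -> y \is a GRing.unit.

Local Notation Kp := {fraction Ap}.
Local Notation ad := (to_adic l).

Let tP n : tofrac (P ^+ n) != 0.
Proof. by rewrite tofrac_eq0 expf_neq0. Qed.

Lemma adic_decompose y : y != 0 -> exists n u, u \is a GRing.unit /\ y = P ^+ n * u.
Proof.
move=> y0; have ex : exists n, lim_proj l n y != 0.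
  apply: contrapT => ny; case/eqP: y0; apply: (lim_ext (l := l)) => n.
  by rewrite rmorph0; apply/eqP; apply: contrapT => /negP yn; apply: ny; exists n.
case: (ex_minnP ex) => -[|n] yn nmin.
  by exists 0%N, y; rewrite expr0 mul1r; split=> //; exact: unitE.
have /PE [z yz] : lim_proj l n y = 0.
  by apply/eqP; apply: contraT => /nmin; rewrite ltnn.
exists n.+1, z; split=> //; apply: unitE; apply: contra yn => /eqP /PE [w zw].
by apply/eqP/PE; exists w; rewrite yz zw expr1 mulrA -exprSr.
Qed.

(** This says that x is in P^-(n+1) A_p, so that y |-> lam (y x) depends only on y modulo
    p^(n+1). *)
Definition fits n (x : Kp) : Prop := exists y, x = tofrac y / tofrac (P ^+ n.+1).

Lemma fits_exists x : exists n, fits n x.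
Proof.
have [a [b [b0 ->]]] := frac_repr x; have [n [u [uu bE]]] := adic_decompose b0.
exists n, (a * u^-1 * P).
apply/eqP; rewrite eqr_div ?tP ?tofrac_eq0 // -!rmorphM bE; apply/eqP; congr tofrac.
rewrite exprSr -!mulrA; congr (_ * _).
by rewrite [P ^+ n * u]mulrC !mulrA [u^-1 * P]mulrC -[P * u^-1 * u]mulrA mulVr // mulr1 mulrC.
Qed.

Lemma fitsS n x : fits n x -> fits n.+1 x.
Proof.
move=> [y ->]; exists (y * P); apply/eqP; rewrite eqr_div ?tP // -!rmorphM.
by rewrite -mulrA -exprS.
Qed.

Lemma fits_le n m x : (n <= m)%N -> fits n x -> fits m x.
Proof.
elim: m => [|m IH]; first by rewrite leqn0 => /eqP ->.
rewrite leq_eqVlt => /predU1P [->//|]; rewrite ltnS => nm fx.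
exact/fitsS/IH.
Qed.

Lemma fitsD n (x y : Kp) : fits n x -> fits n y -> fits n (x + y).
Proof. by move=> [a ->] [b ->]; exists (a + b); rewrite rmorphD mulrDl. Qed.

Lemma fitsM n c (x : Kp) : fits n x -> fits n (tofrac c * x).
Proof. by move=> [a ->]; exists (c * a); rewrite rmorphM mulrA. Qed.

(* Being nonzero on the socle P^-1 A_p / A_p, such a functional generates the dual
   of K_p / A_p. *)
Lemma residue_exists : exists lam : Kp -> k,
  [/\ forall x y : Kp, lam (x + y) = lam x + lam y,
      forall c (x : Kp), lam (tofrac (ad (iA c)) * x) = c * lam x,
      forall y, lam (tofrac y) = 0 & lam (tofrac P)^-1 = 1].
Proof.
have [h [hE hP]] := to_adic_rmorph l.
pose V : lmodType k := restrict_scalars (@tofrac Ap \o (h \o iA)) Kp^o.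
have [||||lam [lamD lamZ lamH lam1]] := @separating_functional k V
  [set x | exists y, x = tofrac y]%classic (tofrac P)^-1.
- by move=> _ _ [y ->] [z ->]; exists (y + z); rewrite rmorphD.
- by move=> c _ [y ->]; exists (h (iA c) * y); rewrite rmorphM.
- by exists 0; rewrite rmorph0.
- move=> [y e]; have : P * y = 1.
    apply/eqP; rewrite -(tofrac_eq (R := Ap)) rmorphM /= -e rmorph1 mulfV // tofrac_eq0 //.
  move=> e1; have : lim_proj l 0 (P * y) = 0 by apply/PE; exists y; rewrite expr1.
  by move/eqP; rewrite e1 rmorph1 oner_eq0.
exists lam; split=> //; first by move=> c x; rewrite hE; exact: lamZ.
by move=> y; apply: lamH; exists y.
Qed.

Variable lam : Kp -> k.
Hypothesis lamD : forall x y : Kp, lam (x + y) = lam x + lam y.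
Hypothesis lamZ : forall c (x : Kp), lam (tofrac (ad (iA c)) * x) = c * lam x.
Hypothesis lam_int : forall y, lam (tofrac y) = 0.
Hypothesis lam1 : lam (tofrac P)^-1 = 1.

(** Defined through a representative of [b]; by [lam_quoE] any lift to A_p gives the same value when
    [fits n x]. *)
Definition lam_quo n (x : Kp) (b : quo p n) : k := lam (tofrac (ad (repr b)) * x).

Lemma lam_quoE n (x : Kp) y : fits n x -> lam_quo x (lim_proj l n y) = lam (tofrac y * x).
Proof.
move=> [w ->]; rewrite /lam_quo.
have /PE [z yz] : lim_proj l n (y - ad (repr (lim_proj l n y))) = 0.
  by rewrite rmorphB to_adicE to_quo_repr subrr.
rewrite -{2}[y](subrK (ad (repr (lim_proj l n y)))) yz rmorphD mulrDl lamD.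
suff -> : lam (tofrac (P ^+ n.+1 * z) * (tofrac w / tofrac (P ^+ n.+1))) = 0 by rewrite add0r.
rewrite mulrCA [tofrac (_ * z)]rmorphM [_ * tofrac z]mulrC mulfK; last exact: tP.
by rewrite -(rmorphM (@tofrac Ap)) lam_int.
Qed.

Lemma quo_lift n (b : quo p n) : exists y, b = lim_proj l n y.
Proof. by exists (ad (repr b)); rewrite to_adicE to_quo_repr. Qed.

Lemma lam_quoD n x : fits n x -> forall b b' : quo p n,
  lam_quo x (b + b') = lam_quo x b + lam_quo x b'.
Proof.
move=> fx b b'; have [y ->] := quo_lift b; have [y' ->] := quo_lift b'.
by rewrite -rmorphD !lam_quoE // rmorphD mulrDl lamD.
Qed.

Lemma lam_quoZ n x : fits n x -> forall c (b : quo p n),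
  lam_quo x (quo_const iA p n c * b) = c * lam_quo x b.
Proof.
move=> fx c b; have [y ->] := quo_lift b.
rewrite -[quo_const _ _ _ _]/(to_quo p n (iA c)) -(to_adicE l) -rmorphM !lam_quoE //.
by rewrite rmorphM -mulrA lamZ.
Qed.

Lemma lam_quo_trans n x (b : quo p n.+1) : fits n x -> lam_quo x (quo_trans b) = lam_quo x b.
Proof.
move=> fx; have [y ->] := quo_lift b; rewrite (lim_compat l) !lam_quoE //.
exact: fitsS.
Qed.

Let pin n := (tofrac (P ^+ n.+1))^-1.

(** A nonzero class is P^m times a unit with m <= n. A suitable multiple of it is P^n, which is
    paired with P^-(n+1) to lam (P^-1) = 1. *)
Lemma lam_quo_nondegenerate n (b : quo p n) :
  (forall b', lam_quo (pin n) (b * b') = 0) -> b = 0.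
Proof.
move=> h; apply: contrapT => b0; have [y by_] := quo_lift b.
have y0 : y != 0 by apply/eqP => y0; apply: b0; rewrite by_ y0 rmorph0.
have [m [u [uu yE]]] := adic_decompose y0.
have mn : (m <= n)%N.
  rewrite leqNgt; apply/negP => nm; apply: b0; rewrite by_; apply/PE.
  exists (P ^+ (m - n.+1) * u); rewrite mulrA -exprD subnKC //.
have := h (lim_proj l n (P ^+ (n - m) * u^-1)).
rewrite by_ -rmorphM lam_quoE; last by exists 1; rewrite rmorph1 mul1r.
have -> : y * (P ^+ (n - m) * u^-1) = P ^+ n.
  by rewrite yE mulrACA mulrV // mulr1 -exprD subnKC.
rewrite /pin exprSr rmorphM invfM mulrA mulfV // mul1r lam1.
by move/eqP; rewrite oner_eq0.
Qed.

Section Pairing.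
Variables (F : fieldType) (iF : {rmorphism k -> F}).
Variables (Y : comUnitRingType) (t : adic_tensor iA p iF Y).
Hypothesis fin : forall n, exists N (e : 'I_N -> quo p n) (mu : 'I_N -> quo p n -> k),
  finite_basis (quo_const iA p n) e mu.

Local Notation ct n x := (contract (level_tensor t n) (@lam_quo n x)).

Lemma ctD n x : fits n x -> forall z z', ct n x (z + z') = ct n x z + ct n x z'.
Proof. move=> fx; exact: contractD (lam_quoD fx) (lam_quoZ fx). Qed.
Lemma ctT n x : fits n x -> forall b f, ct n x (tens (level_tensor t n) b f) = iF (lam_quo x b) * f.
Proof. move=> fx; exact: contractT (lam_quoD fx) (lam_quoZ fx). Qed.

Lemma ctDl n (x x' : Kp) z : fits n x -> fits n x' -> ct n (x + x') z = ct n x z + ct n x' z.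
Proof.
move=> fx fx'; have fD := fitsD fx fx'.
apply: (tens_ext (t := level_tensor t n) (g := ct n (x + x')) (h := fun z => ct n x z + ct n x' z)).
- exact: ctD.
- by move=> a b; rewrite !ctD // addrACA.
- move=> b f; rewrite !ctT //; have [y ->] := quo_lift b.
  by rewrite !lam_quoE // mulrDr lamD rmorphD mulrDl.
Qed.

Lemma ctM n c (x : Kp) z : fits n x -> ct n (tofrac c * x) z = ct n x (tensl (level_tensor t n) (lim_proj l n c) * z).
Proof.
move=> fx; have fM := fitsM c fx.
apply: (tens_ext (t := level_tensor t n) (g := ct n (tofrac c * x)) (h := fun z => ct n x (tensl (level_tensor t n) (lim_proj l n c) * z))).
- exact: ctD.
- by move=> a b; rewrite mulrDr ctD.
- move=> b f; rewrite -tens1r tensM mul1r !ctT //; have [y ->] := quo_lift b.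
  by rewrite -rmorphM !lam_quoE // rmorphM mulrCA mulrA.
Qed.

Lemma ct_const n c (x : Kp) z : fits n x -> ct n (tofrac (ad (iA c)) * x) z = iF c * ct n x z.
Proof.
move=> fx; rewrite ctM // to_adicE -[to_quo _ _ _]/(quo_const iA p n c).
by rewrite tens_balanced (contractZ _ (lam_quoD fx) (lam_quoZ fx)).
Qed.

Lemma ct_trans n x (z : level t n.+1) : fits n x ->
  ct n.+1 x z = ct n x (tensor_map (level_tensor t n.+1) (level_tensor t n) (@quo_trans A p n) id z).
Proof.
move=> fx; have fS := fitsS fx; have [r rP] := adic_trans_rmorph t; rewrite (rP n).1.
apply: (tens_ext (t := level_tensor t n.+1) (g := ct n.+1 x) (h := ct n x \o r n)).
- exact: ctD.
- by move=> a b; rewrite /= rmorphD ctD.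
- by move=> b f; rewrite /= (rP n).2 !ctT // lam_quo_trans.
Qed.

Lemma ct_int n y z : fits n (tofrac y) -> ct n (tofrac y) z = 0.
Proof.
move=> fy; apply: (tens_ext (t := level_tensor t n) (g := ct n (tofrac y)) (h := fun=> 0)).
- exact: ctD.
- by rewrite addr0.
- move=> b f; rewrite ctT //; have [w ->] := quo_lift b.
  by rewrite lam_quoE // -rmorphM lam_int rmorph0 mul0r.
Qed.

(** This is [(lambda_x \otimes id) (Z)], computed at some level where x fits; [pairingE] shows that
    every such level gives the same value. *)
Definition pairing (x : Kp) (Z : Y) : F :=
  let n := projT1 (cid (fits_exists x)) in ct n x (lim_proj (level_limit t) n Z).

Lemma pairingE n x Z : fits n x -> pairing x Z = ct n x (lim_proj (level_limit t) n Z).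
Proof.
move=> fn; rewrite /pairing; case: (cid _) => m fm /=.
have H a b : fits a x -> (a <= b)%N ->
    ct a x (lim_proj (level_limit t) a Z) = ct b x (lim_proj (level_limit t) b Z).
  move=> fa; elim: b => [|b IH]; first by rewrite leqn0 => /eqP ->.
  rewrite leq_eqVlt => /predU1P [->//|]; rewrite ltnS => ab; rewrite (IH ab).
  rewrite ct_trans; last exact: fits_le ab fa.
  by congr (ct b x _); rewrite -[LHS](lim_compat (level_limit t)).
by case: (leqP n m) => [|/ltnW] nm; [rewrite -(H n m) | rewrite (H m n)].
Qed.

Lemma pairingDl (x x' : Kp) Z : pairing (x + x') Z = pairing x Z + pairing x' Z.
Proof.
have [n fn] := fits_exists x; have [m fm] := fits_exists x'.
have {}fn := fits_le (leq_maxl n m) fn; have {}fm := fits_le (leq_maxr n m) fm.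
by rewrite !(pairingE (n := maxn n m)) ?ctDl //; exact: fitsD.
Qed.

Lemma pairingDr x Z Z' : pairing x (Z + Z') = pairing x Z + pairing x Z'.
Proof. by have [n fn] := fits_exists x; rewrite !(pairingE _ fn) rmorphD ctD. Qed.

Lemma pairing_int y Z : pairing (tofrac y) Z = 0.
Proof.
have fy : fits 0 (tofrac y) by exists (y * P); rewrite rmorphM expr1 mulfK // tofrac_eq0.
by rewrite (pairingE _ fy) ct_int.
Qed.

Lemma pairingMl c (x : Kp) Z : pairing (tofrac c * x) Z = pairing x (adic_incl l t c * Z).
Proof.
have [n fn] := fits_exists x; have [h [-> hP]] := adic_incl_rmorph t l.
by rewrite !(pairingE (n := n)) ?ctM ?rmorphM ?hP //; exact: fitsM.
Qed.

Lemma pairing_scalar f s x Z : (forall n, lim_proj (level_limit t) n s = tensr (level_tensor t n) f) ->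
  pairing x (s * Z) = f * pairing x Z.
Proof.
move=> sf; have [n fn] := fits_exists x; rewrite !(pairingE _ fn) rmorphM sf.
exact: contractZ (lam_quoD fn) (lam_quoZ fn) _ _.
Qed.

(** Applied twice: to Frobenius, which makes Tate vectors out of equivariant maps, and to Galois
    automorphisms. *)
Lemma pairing_map (g : {rmorphism F -> F}) (G : {rmorphism Y -> Y})
    (h : forall n, {rmorphism level t n -> level t n}) x Z :
  (forall c, g (iF c) = iF c) -> levelwise (t := t) (t' := t) g G h ->
  pairing x (G Z) = g (pairing x Z).
Proof.
move=> gc hG; have [n fn] := fits_exists x; rewrite !(pairingE _ fn).
have [hT ->] := hG n.
apply: (tens_ext (t := level_tensor t n) (g := ct n x \o h n) (h := g \o ct n x)).
- by move=> a b; rewrite /= rmorphD ctD.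
- by move=> a b; rewrite /= ctD // rmorphD.
- by move=> b f; rewrite /= hT !ctT // rmorphM gc.
Qed.

Section Gram.
Variables (n N : nat) (e : 'I_N -> quo p n) (mu : 'I_N -> quo p n -> k).
Hypothesis emu : finite_basis (quo_const iA p n) e mu.

Let fpin : fits n (pin n). Proof. by exists 1; rewrite rmorph1 mul1r. Qed.
Let G : 'M[k]_N := \matrix_(a, b) lam_quo (pin n) (e a * e b).
Let xa a : Kp := tofrac (ad (repr (e a))) * pin n.

(** [G] is the Gram matrix of the form lam (b b' P^-(n+1)) on A / p^(n+1). A vector in its kernel
    gives an element orthogonal to everything, hence 0. *)
Let G_unit : G \in unitmx.
Proof.
have lam_sum (s : 'I_N -> quo p n) : lam_quo (pin n) (\sum_a s a) = \sum_a lam_quo (pin n) (s a).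
  have l0 : lam_quo (pin n) (0 : quo p n) = 0.
    exact/additive0/lam_quoD.
  exact: (big_morph _ (lam_quoD fpin) l0).
have [_ mue span] := emu.
rewrite -row_free_unit -kermx_eq0; apply/eqP/row_matrixP => i; rewrite row0.
set c := row i _; have /sub_kermxP cG : (c <= kermx G)%MS by exact: row_sub.
have : \sum_a quo_const iA p n (c 0 a) * e a = 0.
  apply: lam_quo_nondegenerate => b.
  rewrite [b]span mulr_sumr lam_sum big1 // => b' _.
  rewrite mulrCA lam_quoZ // mulr_suml lam_sum.
  rewrite [X in _ * X](_ : _ = (c *m G) 0 b'); first by rewrite cG mxE mulr0.
  rewrite [RHS]mxE; apply: eq_bigr => a _; rewrite -mulrA lam_quoZ //.
  by rewrite [G _ _]mxE.
move=> c0; apply/rowP => a; rewrite [RHS]mxE.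
have [mulin _ _] := emu.
have mu0 : mu a 0 = 0 by exact: additive0 (mulin a).1.
have := congr1 (mu a) c0; rewrite (big_morph _ (mulin a).1 mu0) mu0 => <-.
rewrite (bigD1 a) //= (mulin a).2 mue eqxx mulr1 big1 ?addr0 // => b ba.
by rewrite (mulin a).2 mue eq_sym (negPf ba) mulr0.
Qed.

Let ct_basis a (z : 'I_N -> F) :
  ct n (xa a) (\sum_b tens (level_tensor t n) (e b) (z b)) = \sum_b iF (G a b) * z b.
Proof.
have fx : fits n (xa a) by exact: fitsM.
have ct0 : ct n (xa a) 0 = 0 by exact/additive0/ctD.
rewrite (big_morph _ (ctD fx) ct0); apply: eq_bigr => b _.
rewrite ctT // mxE; congr (iF _ * _).
have wE c : lim_proj l n (ad (repr (e c))) = e c by rewrite to_adicE to_quo_repr.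
have -> : e a * e b = lim_proj l n (ad (repr (e a)) * ad (repr (e b))) by rewrite rmorphM !wE.
rewrite lam_quoE // rmorphM mulrAC mulrC -(@lam_quoE n); last exact: fitsM.
by rewrite wE.
Qed.

(** The elements [xa a] span P^-(n+1) A_p over [k] modulo A_p, so it is enough to prescribe the
    values there; this is a linear system with the invertible matrix [G]. *)
Lemma level_perfect (v : Kp -> F) :
  (forall x y : Kp, v (x + y) = v x + v y) ->
  (forall c (x : Kp), v (tofrac (ad (iA c)) * x) = iF c * v x) ->
  (forall y, v (tofrac y) = 0) ->
  exists z : level t n, forall x, fits n x -> ct n x z = v x.
Proof.
move=> vD vZ v0.
pose w : 'cV[F]_N := map_mx iF (invmx G) *m \col_a v (xa a).
exists (\sum_b tens (level_tensor t n) (e b) (w b 0)) => x [y ->].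
set z := \sum_b _.
have H a : ct n (xa a) z = v (xa a).
  rewrite ct_basis; transitivity ((map_mx iF G *m w) a 0).
    by rewrite mxE; apply: eq_bigr => b _; rewrite !mxE.
  by rewrite /w mulmxA -map_mxM mulmxV // map_mx1 mul1mx mxE.
have [_ _ span] := emu.
(* [y1] is the combination of lifted basis vectors with the class of [y]. The difference y - y1 is
   divisible by P^(n+1) and contributes an integral element, on which both sides vanish. *)
pose y1 := \sum_a ad (iA (mu a (lim_proj l n y))) * ad (repr (e a)).
have /PE [y2 yE] : lim_proj l n (y - y1) = 0.
  rewrite rmorphB {1}[lim_proj l n y]span /y1 rmorph_sum -sumrB big1 // => a _.
  by rewrite rmorphM !to_adicE to_quo_repr subrr.
have -> : tofrac y / tofrac (P ^+ n.+1) = tofrac y2 + tofrac y1 * pin n.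
  rewrite -{1}(subrK y1 y) yE rmorphD mulrDl; congr (_ + _).
  by rewrite rmorphM mulrAC mulfV ?mul1r //; exact: tP.
have fy2 : fits n (tofrac y2).
  by exists (y2 * P ^+ n.+1); rewrite rmorphM mulfK //; exact: tP.
have fy1 : fits n (tofrac y1 * pin n) by exact: fitsM.
have key (u : Kp) : u = tofrac y1 * pin n -> ct n u z = v u.
  move=> ->; rewrite /y1 rmorph_sum mulr_suml.
  under eq_bigr => a _ do rewrite rmorphM -mulrA.
  have : forall r : seq 'I_N,
     let x := \sum_(a <- r) tofrac (ad (iA (mu a (lim_proj l n y)))) * xa a in
     fits n x /\ ct n x z = v x.
    elim=> [|a r [fr IH]] /=.
      have f0 : fits n (tofrac (0 : Ap)) by exists 0; rewrite rmorph0 mul0r.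
      by rewrite big_nil -(rmorph0 (@tofrac Ap)) v0 ct_int.
    have fx : fits n (xa a) by exact: fitsM.
    rewrite big_cons vD ctDl //; last exact: fitsM.
    by split; [apply: fitsD => //; exact: fitsM | rewrite ct_const // vZ H IH].
  by move=> /(_ (index_enum _)) [_].
by rewrite ctDl // vD v0 ct_int // (key _ erefl).
Qed.

Lemma level_nondegenerate (z : level t n) : (forall x, fits n x -> ct n x z = 0) -> z = 0.
Proof.
move=> h; rewrite (contract_expand (level_tensor t n) emu z).
pose w b := contract (level_tensor t n) (mu b) z.
pose W : 'cV[F]_N := \col_b w b.
have GW : map_mx iF G *m W = 0.
  apply/colP => a; rewrite !mxE -[RHS](h (xa a)); last exact: fitsM.
  rewrite [X in ct n _ X](contract_expand (level_tensor t n) emu z) ct_basis.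
  by apply: eq_bigr => b _; rewrite !mxE.
have W0 : W = 0.
  have Gu : map_mx iF G \in unitmx by rewrite map_unitmx.
  by apply: (can_inj (mulKmx Gu)); rewrite GW mulmx0.
rewrite big1 // => b _; have := congr1 (fun M : 'cV_N => M b 0) W0.
by rewrite !mxE /w => ->; rewrite tens0r.
Qed.
End Gram.

Lemma pairing_nondegenerate Z : (forall x, pairing x Z = 0) -> Z = 0.
Proof.
move=> h; apply: (lim_ext (l := level_limit t)) => n; rewrite rmorph0.
have [N [e [mu emu]]] := fin n; apply: (level_nondegenerate emu) => x fx.
by rewrite -(pairingE _ fx).
Qed.

(** Nondegeneracy makes the solution at each level unique, so the solutions are compatible. *)
Lemma pairing_perfect (v : Kp -> F) :
  (forall x y : Kp, v (x + y) = v x + v y) ->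
  (forall c (x : Kp), v (tofrac (ad (iA c)) * x) = iF c * v x) ->
  (forall y, v (tofrac y) = 0) ->
  exists Z, forall x, pairing x Z = v x.
Proof.
move=> vD vZ v0.
have H n : exists z : level t n, forall x, fits n x -> ct n x z = v x.
  by have [N [e [mu emu]]] := fin n; exact: (level_perfect emu).
have [z zP] := dependent_choice H.
have [n|Z [ZP _]] := @lim_universal _ _ _ (level_limit t) z.
  have [N [e [mu emu]]] := fin n.
  apply/eqP; rewrite -subr_eq0; apply/eqP; apply: (level_nondegenerate emu) => x fx.
  have ct0 : ct n x 0 = 0 by exact/additive0/ctD.
  have ctN z' : ct n x (- z') = - ct n x z'.
    by apply: (addrI (ct n x z')); rewrite -ctD // !subrr ct0.
  rewrite ctD // ctN -ct_trans // !zP ?subrr //.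
  exact: fitsS.
exists Z => x; have [n fn] := fits_exists x.
by rewrite (pairingE _ fn) ZP zP.
Qed.
End Pairing.
End Residue.

(** * Fq-linear polynomials and the motive *)

Section Mmap.
Variables (n : nat) (R : nzRingType) (S S' : comNzRingType).

Lemma rmorph_mmap (phi : {rmorphism S -> S'}) (g : {rmorphism R -> S}) (h : 'I_n -> S)
    (f : {mpoly R[n]}) : phi (mmap g h f) = mmap (phi \o g) (phi \o h) f.
Proof.
rewrite /mmap rmorph_sum; apply: eq_bigr => m _; rewrite rmorphM /mmap1 rmorph_prod.
by congr (_ * _); apply: eq_bigr => i _; rewrite rmorphXn.
Qed.

Lemma eq_mmap (g g' : R -> S) (h h' : 'I_n -> S) (f : {mpoly R[n]}) :
  g =1 g' -> h =1 h' -> mmap g h f = mmap g' h' f.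
Proof.
move=> gg hh; rewrite /mmap; apply: eq_bigr => m _; rewrite gg /mmap1.
by congr (_ * _); apply: eq_bigr => i _; rewrite hh.
Qed.
End Mmap.

Lemma mmap_comp (n m : nat) (R S : comNzRingType) (g : {rmorphism R -> S}) (y : 'I_m -> S)
    (f : {mpoly R[n]}) (lq : n.-tuple {mpoly R[m]}) :
  mmap g y (f \mPo lq) = mmap g (fun j => mmap g y (tnth lq j)) f.
Proof.
rewrite /comp_mpoly (rmorph_mmap (mmap g y)); apply: eq_mmap => [c|j] //=.
exact: mmapC.
Qed.

Lemma mmap_id (n : nat) (R : comNzRingType) (f : {mpoly R[n]}) :
  mmap (@mpolyC n R) (fun i => 'X_i) f = f.
Proof.
rewrite {2}[f]mpolyE /mmap; apply: eq_bigr => m _.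
by rewrite mmap1_id mul_mpolyC.
Qed.

(* Writing n = p^e m with m prime to p, the coefficient of X^(p^e) in
   (1 + X)^n = (1 + X^(p^e))^m is m. *)
Lemma prime_power_of_bin (L : fieldType) (p n : nat) : p \in [pchar L] -> (0 < n)%N ->
  (forall i, (0 < i < n)%N -> 'C(n, i)%:R = 0 :> L) -> exists e, n = (p ^ e)%N.
Proof.
move=> pL n0 hn; have pp := pcharf_prime pL.
exists (logn p n); have nE := partnC p n0; rewrite p_part in nE.
set m := (n`_(p^'))%N in nE; rewrite -{1}nE.
suff -> : m = 1%N by rewrite muln1.
have m0 : (0 < m)%N by exact: part_gt0.
apply/eqP; rewrite eqn_leq m0 andbT leqNgt; apply/negP => m1.
have pm : ~~ (p %| m)%N by rewrite -p'natE // part_pnat.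
have pe0 : (0 < p ^ logn p n)%N by rewrite expn_gt0 prime_gt0.
have pen : (0 < p ^ logn p n < n)%N by rewrite pe0 -{2}nE -{1}[(p ^ _)%N]muln1 ltn_pmul2l.
case/negP: pm; rewrite (dvdn_pcharf pL).
have pX : p \in [pchar {poly L}] by rewrite (rmorph_pchar (@polyC L)).
have : (1 + 'X : {poly L}) ^+ n = (1 + 'X^(p ^ logn p n)) ^+ m.
  rewrite -{1}nE exprM exprDn_pchar ?expr1n //.
  by rewrite (eq_pnat _ (pcharf_eq pX)) pnatX pnat_id.
rewrite ![1 + _]addrC !exprD1n => /(congr1 (fun f : {poly L} => f`_(p ^ logn p n))).
rewrite !coef_sum (bigD1 (Ordinal (ltnW (andP pen).2 : (p ^ logn p n < n.+1)%N))) //=.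
rewrite coefMn coefXn eqxx hn // big1 ?addr0 => [|i /eqP ie]; last first.
  rewrite coefMn coefXn; case: eqP => [e|_]; last by rewrite mul0rn.
  by case: ie; apply: val_inj; rewrite /= -e.
rewrite (bigD1 (Ordinal (ltnW m1 : (1 < m.+1)%N))) //= coefMn expr1 coefXn eqxx bin1.
rewrite big1 ?addr0 => [<-//|i /eqP ie].
rewrite coefMn -exprM coefXn; case: eqP => [e|_]; last by rewrite mul0rn.
case: ie; apply: val_inj => /=; apply/eqP.
by rewrite -(eqn_pmul2l pe0) muln1 -e.
Qed.

(** With q = p^f and v the remainder of n modulo f, all c satisfy c^(p^v) = c. Since p^v < q, the
    polynomial X^(p^v) - X has too many roots unless v = 0. *)
Lemma power_of_card (k : finFieldType) (p n : nat) : p \in [pchar k] ->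
  (forall c : k, c ^+ (p ^ n) = c) -> exists e, (p ^ n)%N = (#|k| ^ e)%N.
Proof.
move=> pk hc; have pp := pcharf_prime pk.
have [p' [f [_ p'k f0 kE]]] := card_finField k.
have {p' p'k}kE : #|k| = (p ^ f)%N.
  by rewrite kE; congr (_ ^ _)%N; apply/eqP; move: p'k; rewrite (pcharf_eq pk).
have qX (c : k) u : c ^+ (#|k| ^ u) = c.
  by elim: u => [|u IH]; rewrite ?expr1 // expnS exprM expf_card.
have hv (c : k) : c ^+ (p ^ (n %% f)) = c.
  by rewrite -{2}(hc c) {2}(divn_eq n f) expnD mulnC [(n %/ f * f)%N]mulnC expnM -kE mulnC exprM qX.
exists (n %/ f)%N; rewrite {1}(divn_eq n f) mulnC expnD expnM -kE.
have [->|nz] := eqVneq (n %% f)%N 0%N; first by rewrite muln1.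
have vlt : (p ^ (n %% f) < #|k|)%N by rewrite kE ltn_exp2l ?prime_gt1 // ltn_pmod.
have v1 : (1 < p ^ (n %% f))%N by rewrite -{1}(expn0 p) ltn_exp2l ?prime_gt1 // lt0n.
have sz : size ('X^(p ^ (n %% f)) - 'X : {poly k}) = (p ^ (n %% f)).+1.
  by rewrite size_polyDl size_polyXn // size_polyN size_polyX.
have : (#|k| < size ('X^(p ^ (n %% f)) - 'X : {poly k})%R)%N.
  rewrite cardE; apply: max_poly_roots; last exact: enum_uniq.
    by rewrite -size_poly_gt0 sz.
  by apply/allP => c _; rewrite /root !hornerE hv subrr.
by rewrite sz ltnS leqNgt vlt.
Qed.

Section FqLinear.
Variables (Fq : finFieldType) (L : fieldType) (iL : {rmorphism Fq -> L}).
Local Notation q := #|Fq|.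

(** Additivity kills the mixed terms of g(X + Y), so all inner binomial coefficients of an exponent
    n that occurs vanish and n is a power of p; homogeneity under Fq then makes it a power of q. *)
Lemma additive_poly (g : {poly L}) :
  (forall (S : comNzRingType) (r : {rmorphism L -> S}) (x y : S),
     (map_poly r g).[x + y] = (map_poly r g).[x] + (map_poly r g).[y]) ->
  (forall (S : comNzRingType) (r : {rmorphism L -> S}) c (x : S),
     (map_poly r g).[r (iL c) * x] = r (iL c) * (map_poly r g).[x]) ->
  forall n, g`_n != 0 -> exists e, n = (q ^ e)%N.
Proof.
move=> gD gZ n gn.
have bin i j : (0 < i)%N -> (0 < j)%N -> g`_(i + j) * 'C(i + j, i)%:R = 0.
  move=> i0 j0.
  (* The identity is tested at the generic pair: 'X is the outer and 'X%:P the inner variable, and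
     the coefficients with i > 0 and j > 0 are compared. *)
  pose r : {rmorphism L -> {poly {poly L}}} := polyC \o polyC.
  have := gD _ r ('X%:P) 'X => /(congr1 (fun f : {poly {poly L}} => f`_i`_j)).
  have E (y : {poly {poly L}}) : (map_poly r g).[y] = \sum_(m < size g) (g`_m)%:P%:P * y ^+ m.
    rewrite horner_coef size_map_inj_poly ?rmorph0 //; last exact: inj_comp polyC_inj polyC_inj.
    by apply: eq_bigr => m _; rewrite coef_map.
  have XY m : (('X%:P + 'X : {poly {poly L}}) ^+ m)`_i = 'X^(m - i) *+ 'C(m, i).
    rewrite exprDn coef_sum; have [im|mi] := leqP i m; last first.
      rewrite bin_small // big1 // => s _.
      rewrite coefMn -rmorphXn coefCM coefXn gtn_eqF ?mulr0 ?mul0rn //.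
      exact: leq_trans (ltn_ord s) mi.
    rewrite (bigD1 (Ordinal (im : (i < m.+1)%N))) //= big1 ?addr0 => [|s /eqP si].
      by rewrite coefMn -rmorphXn coefCM coefXn eqxx mulr1.
    rewrite coefMn -rmorphXn coefCM coefXn; case: eqP => [e|_]; last by rewrite mulr0 mul0rn.
    by case: si; apply: val_inj.
  rewrite coefD coefD !E.
  have -> : (\sum_(m < size g) (g`_m)%:P%:P * 'X%:P ^+ m : {poly {poly L}})`_i = 0.
    by rewrite coef_sum big1 // => m _; rewrite -rmorphXn -rmorphM coefC gtn_eqF.
  have -> : (\sum_(m < size g) (g`_m)%:P%:P * 'X ^+ m : {poly {poly L}})`_i`_j = 0.
    rewrite coef_sum coef_sum big1 // => m _; rewrite coefCM coefXn.
    by case: (i == m); rewrite ?mulr0 ?coef0 // mulr1 coefC gtn_eqF.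
  rewrite coef0 addr0 coef_sum coef_sum => e; rewrite -[RHS]e {e}.
  have T m : ((g`_m)%:P%:P * ('X%:P + 'X) ^+ m : {poly {poly L}})`_i`_j =
     g`_m * ((j == m - i)%N%:R *+ 'C(m, i)).
    by rewrite coefCM XY coefCM coefMn coefXn.
  under eq_bigr => m _ do rewrite T.
  have [ij|ij] := ltnP (i + j)%N (size g); last first.
    rewrite nth_default // mul0r big1 // => m _.
    case: eqP => [e|_]; last by rewrite mul0rn mulr0.
    have := ltn_ord m; rewrite ltnNge (leq_trans ij) // e.
    by case: (leqP i m) => [im|mi]; [rewrite subnKC | move: j0; rewrite e (eqP (ltnW mi : (m - i == 0)%N))].
  rewrite (bigD1 (Ordinal ij)) //= addKn eqxx big1 ?addr0 // => m /eqP mij.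
  case: eqP => [e|_]; last by rewrite mul0rn mulr0.
  case: (leqP i m) => [im|mi]; last by move: j0; rewrite e (eqP (ltnW mi : (m - i == 0)%N)).
  by case: mij; apply: val_inj; rewrite /= e subnKC.
have [p [f [pp pk f0 qE]]] := card_finField Fq.
have pL : p \in [pchar L] by rewrite (fmorph_pchar iL).
have n0 : (0 < n)%N.
  rewrite lt0n; apply: contraNneq gn => ->.
  have := gD L idfun 0 0; rewrite map_poly_id // addr0 => /(congr1 (fun x => x - g.[0])).
  by rewrite addrK subrr horner_coef0 => /esym ->.
have [|e nE] := @prime_power_of_bin L p n pL n0.
  move=> i /andP[i0 ilt]; apply/eqP.
  have := @bin i (n - i)%N i0; rewrite subn_gt0 subnKC ?(ltnW ilt) // => /(_ ilt) /eqP.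
  by rewrite mulf_eq0 (negPf gn).
rewrite nE; apply: power_of_card pk _ => c; rewrite -nE.
(* The coefficient of X^n in g(c X) = c g(X) gives c^n = c. *)
have := gZ {poly L} polyC c 'X.
have E (y : {poly L}) : (map_poly polyC g).[y] = \sum_(m < size g) (g`_m)%:P * y ^+ m.
  rewrite horner_coef size_map_inj_poly ?rmorph0 //; last exact: polyC_inj.
  by apply: eq_bigr => m _; rewrite coef_map.
have nsz : (n < size g)%N by rewrite ltnNge; apply: contra gn => h; rewrite nth_default.
have B (a : nat -> L) : (\sum_(m < size g) (a m)%:P * 'X ^+ m)`_n = a n.
  rewrite coef_sum (bigD1 (Ordinal nsz)) //= coefCM coefXn eqxx mulr1.
  rewrite big1 ?addr0 // => m /eqP mn; rewrite coefCM coefXn.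
  by case: eqP => [e1|_]; [case: mn; apply: val_inj | rewrite mulr0].
rewrite !E => /(congr1 (fun h : {poly L} => h`_n)); rewrite coefCM B.
under eq_bigr => m _ do rewrite exprMn mulrA -rmorphXn -rmorphM.
rewrite (B (fun m => g`_m * iL c ^+ m)) mulrC => /(mulIf gn).
by rewrite -rmorphXn => /fmorph_inj.
Qed.

Variable d : nat.

(* [mmap] sends f to the polynomial f (0, ..., 0, X, 0, ..., 0). *)
Let slice (l : 'I_d) (f : {mpoly L[d]}) : {poly L} :=
  mmap polyC (fun i => if i == l then 'X else 0) f.

Let sliceE l f (S : comNzRingType) (r : {rmorphism L -> S}) (x : S) :
  (map_poly r (slice l f)).[x] = mmap r (fun i => if i == l then x else 0) f.
Proof.
have cxr : commr_rmorph r x by move=> c; exact: mulrC.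
rewrite -[LHS]/(horner_morph cxr (slice l f)) rmorph_mmap; apply: eq_mmap => [c|i] /=.
  by rewrite horner_morphC.
by case: eqP => _; rewrite ?horner_morphX ?rmorph0.
Qed.

(** Additivity at the generic point (X_1, ..., X_d) splits f into its restrictions to the coordinate
    axes, which are additive polynomials in one variable. *)
Lemma Fq_linear_decomp (f : {mpoly L[d]}) : Fq_linear iL f ->
  exists s : seq (L * ('I_d * nat)), f = \sum_(x <- s) x.1 *: 'X_x.2.1 ^+ (q ^ x.2.2).
Proof.
move=> fl; pose P h := exists s : seq (L * ('I_d * nat)),
  h = \sum_(x <- s) x.1 *: 'X_x.2.1 ^+ (q ^ x.2.2) :> {mpoly L[d]}.
have P0 : P 0 by exists [::]; rewrite big_nil.
have PD x y : P x -> P y -> P (x + y).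
  by move=> [s ->] [s' ->]; exists (s ++ s'); rewrite big_cat.
have fE : f = \sum_l (map_poly (@mpolyC d L) (slice l f)).['X_l].
  rewrite -{1}(mmap_id f).
  (* [r] lists the coordinates not set to 0; they are added one at a time. *)
  have H (r : seq 'I_d) : uniq r -> mmap (@mpolyC d L) (fun i => if i \in r then 'X_i else 0) f =
     \sum_(l <- r) (map_poly (@mpolyC d L) (slice l f)).['X_l].
    elim: r => [_|l r IH /= /andP[lr ur]].
      have [e _] := fl _ (@mpolyC d L) (fun=> 0) (fun=> 0) 0.
      rewrite big_nil; apply: (addrI (mmap (@mpolyC d L) (fun=> 0) f)).
      rewrite addr0 -[RHS](eq_mmap f (frefl _) (fun i : 'I_d => addr0 0)) e.
      by congr (_ + _); apply: eq_mmap.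
    rewrite big_cons -IH // sliceE -(fl _ _ _ _ 0).1; apply: eq_mmap => // i.
    rewrite inE; case: eqP => [->|_] /=; last by rewrite add0r.
    by rewrite (negPf lr) addr0.
  rewrite -H ?index_enum_uniq //; apply: eq_mmap => // i.
  by rewrite mem_index_enum.
suff : P f by [].
rewrite fE; elim/big_ind: _ => // l _.
have gl : forall n, (slice l f)`_n != 0 -> exists e, n = (q ^ e)%N.
  apply: additive_poly => S r => [x y|c x]; rewrite !sliceE.
    by rewrite -(fl S r _ _ 0).1; apply: eq_mmap => // i; case: eqP; rewrite ?addr0.
  by rewrite -(fl S r _ (fun=> 0) c).2; apply: eq_mmap => // i; case: eqP; rewrite ?mulr0.
rewrite horner_poly; elim/big_ind: _ => // n _.
have [->|/gl [e ->]] := eqVneq (slice l f)`_n 0; first by rewrite rmorph0 mul0r.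
exists [:: ((slice l f)`_(q ^ e), (l, e))].
by rewrite big_seq1 /= mul_mpolyC.
Qed.

Lemma Fq_linearX (l : 'I_d) : Fq_linear iL ('X_l : {mpoly L[d]}).
Proof. by move=> S g x y c; rewrite !mmapX !mmap1U. Qed.

Lemma Fq_linear_exp (f : {mpoly L[d]}) : Fq_linear iL f -> Fq_linear iL (f ^+ q).
Proof.
move=> fl S g x y c; have [e1 e2] := fl S g x y c; rewrite !rmorphXn /= e1 e2.
have [p [n [pp pk _ qE]]] := card_finField Fq.
have pS : p \in [pchar S] by rewrite (rmorph_pchar g) // (fmorph_pchar iL).
split; last by rewrite exprMn -!rmorphXn expf_card.
by apply: exprDn_pchar; rewrite (eq_pnat _ (pcharf_eq pS)) qE pnatX pnat_id.
Qed.
End FqLinear.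

Section MotiveEvaluation.
Variables (Fq : finFieldType) (A : comNzRingType) (iA : {rmorphism Fq -> A}).
Variables (L : fieldType) (iL : {rmorphism Fq -> L}) (l : {rmorphism A -> L}).
Variables (d : nat) (E : anderson_module iL l d).
Variables (AL : idomainType) (tAL : tensor_product iA iL AL).
Variables (M : lmodType AL) (H : motive E tAL M).
Local Notation q := #|Fq|.
Local Notation frob := (motive_frob H).

Lemma motive_frobE m : mot_hom H (frob m) = mot_hom H m ^+ q.
Proof.
rewrite /motive_frob; case: xgetP => // ne.
have [x xE] := (mot_range H _).1 (Fq_linear_exp ((mot_range H _).2 (ex_intro _ m erefl))).
by case: (ne x).
Qed.

Let qL (R : comNzRingType) (r : {rmorphism L -> R}) : [pchar R].-nat q.
Proof.
have [p [n [pp pk _ qE]]] := card_finField Fq.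
have pR : p \in [pchar R] by rewrite (rmorph_pchar r) // (fmorph_pchar iL).
by rewrite (eq_pnat _ (pcharf_eq pR)) qE pnatX pnat_id.
Qed.

Lemma motive_frobD m m' : frob (m + m') = frob m + frob m'.
Proof.
apply: (mot_inj (m0 := H)); rewrite motive_frobE !mot_add !motive_frobE.
by apply: exprDn_pchar; exact: (qL (@mpolyC d L)).
Qed.

Lemma motive_frob_semilinear s m : frob (s *: m) = tens_frob tAL s *: frob m.
Proof.
have [phi [phiE phic]] := frobenius_rmorph iL.
have [||tf [tfE tfT]] := tensor_map_rmorph tAL tAL (u := idfun) (v := phi) => //.
rewrite /tens_frob phiE tfE.
have f0 : frob 0 = 0 by exact/additive0/motive_frobD.
elim/(@tens_ind _ _ _ _ _ _ tAL): s => [|s s' hs hs'|a c].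
- by rewrite scale0r rmorph0 scale0r.
- by rewrite scalerDl motive_frobD hs hs' rmorphD scalerDl.
- apply: (mot_inj (m0 := H)); rewrite tfT motive_frobE /tens -!scalerA !mot_actA !mot_actL.
  by rewrite motive_frobE -phiE -exprZn rmorphXn.
Qed.

Variables (Ls : fieldType) (iLLs : {rmorphism L -> Ls}).

Definition motive_eval (m : M) (y : 'rV[Ls]_d) : Ls := mmap iLLs (y 0) (mot_hom H m).

Lemma motive_evalD m m' y : motive_eval (m + m') y = motive_eval m y + motive_eval m' y.
Proof. by rewrite /motive_eval mot_add rmorphD. Qed.

Lemma motive_eval_actL c m y : motive_eval (tensr tAL c *: m) y = iLLs c * motive_eval m y.
Proof. by rewrite /motive_eval mot_actL mmapZ. Qed.

Lemma motive_eval_actA a m y :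
  motive_eval (tensl tAL a *: m) y = motive_eval m (am_act E iLLs a y).
Proof.
rewrite /motive_eval mot_actA mmap_comp; apply: eq_mmap => // j.
by rewrite tnth_mktuple mxE.
Qed.

Lemma motive_eval_frob m y : motive_eval (frob m) y = motive_eval m y ^+ q.
Proof. by rewrite /motive_eval motive_frobE rmorphXn. Qed.

Lemma motive_evalDr m y y' : motive_eval m (y + y') = motive_eval m y + motive_eval m y'.
Proof.
have /(mot_range H _) fl : exists m', mot_hom H m' = mot_hom H m by exists m.
rewrite /motive_eval -((fl _ iLLs _ _ 0).1); apply: eq_mmap => // j.
by rewrite mxE.
Qed.

Definition motive_coord (j : 'I_d) : M := xget 0 [set m | mot_hom H m = 'X_j]%classic.

Lemma motive_coordE j : mot_hom H (motive_coord j) = 'X_j.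
Proof.
rewrite /motive_coord; case: xgetP => // ne.
by have [m /ne] := (mot_range H _).1 (Fq_linearX iL j).
Qed.

Lemma motive_eval_coord j y : motive_eval (motive_coord j) y = y 0 j.
Proof. by rewrite /motive_eval motive_coordE mmapX mmap1U. Qed.

(* E(Ls) = Hom_L^tau (M, Ls). *)
Lemma motive_eval_point (theta : M -> Ls) :
  (forall m m', theta (m + m') = theta m + theta m') ->
  (forall c m, theta (tensr tAL c *: m) = iLLs c * theta m) ->
  (forall m, theta (frob m) = theta m ^+ q) ->
  forall m, theta m = motive_eval m (\row_j theta (motive_coord j)).
Proof.
move=> thD thL thF m; set y := \row_j _.
have [s sE] := Fq_linear_decomp ((mot_range H _).2 (ex_intro _ m erefl)).
have homE e j : mot_hom H (iter e frob (motive_coord j)) = 'X_j ^+ (q ^ e).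
  elim: e => [|e IH]; first by rewrite expr1 motive_coordE.
  by rewrite iterS motive_frobE IH -exprM expnSr.
have hom0 : mot_hom H 0 = 0 by exact/additive0/mot_add.
(* The coordinate functions generate the motive under [L] and Frobenius, so [theta] is determined by
   its values on them. *)
have -> : m = \sum_(x <- s) tensr tAL x.1 *: iter x.2.2 frob (motive_coord x.2.1).
  apply: (mot_inj (m0 := H)); rewrite sE (big_morph _ (mot_add H) hom0).
  by apply: eq_bigr => x _; rewrite mot_actL homE.
have th0 : theta 0 = 0 by exact/additive0/thD.
have ev0 : motive_eval 0 y = 0.
  by apply: (addrI (motive_eval 0 y)); rewrite -motive_evalD !addr0.
rewrite (big_morph _ thD th0) (big_morph _ (fun m m' => motive_evalD m m' y) ev0).
apply: eq_bigr => x _; rewrite thL motive_eval_actL; congr (_ * _).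
elim: x.2.2 => [|e IH]; first by rewrite motive_eval_coord mxE.
by rewrite iterS thF motive_eval_frob IH.
Qed.
End MotiveEvaluation.

Lemma base_change_ext (R S : nzRingType) (f : R -> S) (M : lmodType R) (N V : lmodType S)
    (mu : M -> N) (h h' : N -> V) : is_base_change f mu ->
  (forall s x y, h (s *: x + y) = s *: h x + h y) ->
  (forall s x y, h' (s *: x + y) = s *: h' x + h' y) ->
  (forall x, h (mu x) = h' (mu x)) -> forall x, h x = h' x.
Proof.
move=> [muD muZ univ] hl hl' hh x.
have hD (g : N -> V) : (forall s x y, g (s *: x + y) = s *: g x + g y) ->
    forall x y, g (x + y) = g x + g y.
  by move=> gl y z; rewrite -[y]scale1r gl !scale1r.
have h0 : h 0 = 0 by exact/additive0/hD.
have [||k [_ ku]] := univ V (h \o mu).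
- by move=> y z; rewrite /= muD (hD h hl).
- by move=> r y; rewrite /= muZ -[f r *: mu y]addr0 hl h0 addr0.
have <- : k = h by exact: ku.
by have -> : k = h' by apply: ku; split=> // y; rewrite /= hh.
Qed.

(** * The Tate module of a motive with a Frobenius-invariant basis *)

Section TateModule.
Variables (Fq : finFieldType) (A : comNzRingType) (iA : {rmorphism Fq -> A}).
Variables (L : fieldType) (iL : {rmorphism Fq -> L}) (l : {rmorphism A -> L}).
Variables (d : nat) (E : anderson_module iL l d).
Variables (p : idealr A) (Ap : idomainType) (lAp : adic_ring p Ap).
Variables (Ls : fieldType) (iLLs : {rmorphism L -> Ls}).
Variables (AL : idomainType) (tAL : tensor_product iA iL AL).
Variables (M : lmodType AL) (H : motive E tAL M).
Local Notation q := #|Fq|.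
Local Notation Kp := {fraction Ap}.
Local Notation frob := (motive_frob H).
Local Notation ev := (motive_eval H iLLs).
Local Notation xk := (motive_coord H).

Variables (S : comNzRingType) (f : {rmorphism AL -> S}).
Variables (Mp : lmodType S) (mu : M -> Mp).
Hypothesis hmu : is_base_change f mu.
Variables (sigma : {rmorphism S -> S}) (T : Mp -> Mp).
Hypothesis TD : forall x y, T (x + y) = T x + T y.
Hypothesis TZ : forall s x, T (s *: x) = sigma s *: T x.
Hypothesis Tmu : forall m, T (mu m) = mu (frob m).
Variables (r : nat) (m : 'I_r -> Mp).
Hypothesis hm : is_module_basis m.
Variables (Y : comUnitRingType) (rho : {rmorphism S -> Y}) (tau : {rmorphism Y -> Y}).
Hypothesis rho_tau : forall s, rho (sigma s) = tau (rho s).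
Variable inc : {rmorphism Ap -> Y}.
Hypothesis inc_ad : forall a, inc (to_adic lAp a) = rho (f (tensl tAL a)).
Hypothesis inc_inj : injective inc.
Hypothesis inc_fixed : forall z, tau z = z -> exists c, z = inc c.
Variable pr : Kp -> Y -> Ls.
Hypothesis prDl : forall (x x' : Kp) z, pr (x + x') z = pr x z + pr x' z.
Hypothesis prDr : forall x z z', pr x (z + z') = pr x z + pr x z'.
Hypothesis pr_int : forall y z, pr (tofrac y) z = 0.
Hypothesis prM : forall c (x : Kp) z, pr (tofrac c * x) z = pr x (inc c * z).
Hypothesis pr_scalar : forall c x z, pr x (rho (f (tensr tAL c)) * z) = iLLs c * pr x z.
Hypothesis pr_tau : forall x z, pr x (tau z) = pr x z ^+ q.
Hypothesis pr_nondegenerate : forall z, (forall x, pr x z = 0) -> z = 0.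
Hypothesis pr_perfect : forall v : Kp -> Ls,
  (forall x y : Kp, v (x + y) = v x + v y) ->
  (forall c (x : Kp), v (tofrac (to_adic lAp (iA c)) * x) = iLLs (iL c) * v x) ->
  (forall y, v (tofrac y) = 0) -> exists z, forall x, pr x z = v x.
Variables (Us : 'M[Y]_r) (Theta : 'M[S]_r).
Hypothesis Us_unit : Us \in unitmx.
Hypothesis T_basis : forall i, T (m i) = \sum_j Theta i j *: m j.
Hypothesis Us_frob : map_mx tau Us *m map_mx rho Theta = Us.

Let V := invmx Us.

Let pr0 x : pr x 0 = 0. Proof. exact/additive0/prDr. Qed.
Let pr_sum x (I : Type) (s : seq I) (g : I -> Y) :
  pr x (\sum_(i <- s) g i) = \sum_(i <- s) pr x (g i).
Proof. exact: (big_morph (pr x) (prDr x) (pr0 x)). Qed.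
Let pr_ext z z' : (forall x, pr x z = pr x z') -> z = z'.
Proof.
move=> zz; apply/eqP; rewrite -subr_eq0; apply/eqP/pr_nondegenerate => x.
rewrite prDr zz; suff -> : pr x (- z') = - pr x z' by rewrite subrr.
by apply: (addrI (pr x z')); rewrite -prDr !subrr pr0.
Qed.

Let map_unit (g : {rmorphism Y -> Y}) : map_mx g Us \in unitmx.
Proof. by rewrite unitmxE det_map_mx rmorph_unit // -unitmxE. Qed.

Let map_inv (g : {rmorphism Y -> Y}) : map_mx g V = invmx (map_mx g Us).
Proof.
have gg : map_mx g V *m map_mx g Us = 1%:M by rewrite -map_mxM mulVmx // map_mx1.
by rewrite -[LHS]mulmx1 -(mulmxV (map_unit g)) mulmxA gg mul1mx.
Qed.

Let tauV : map_mx tau V = map_mx rho Theta *m V.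
Proof.
rewrite map_inv -[RHS](mulKmx (map_unit tau)) [_ *m (_ *m V)]mulmxA Us_frob.
by rewrite mulmxV // mulmx1.
Qed.

Definition basis_coordinates (z : Mp) : 'rV[S]_r :=
  xget 0 [set c : 'rV[S]_r | z = \sum_i c 0 i *: m i]%classic.
Local Notation crd := basis_coordinates.

Let crdE z : z = \sum_i crd z 0 i *: m i.
Proof.
rewrite /crd; case: xgetP => // ne; have [c [cz _]] := hm z.
by case: (ne c).
Qed.

Let crd_eq z (c : 'rV[S]_r) : z = \sum_i c 0 i *: m i -> crd z = c.
Proof.
have [c0 [_ cu]] := hm z.
by move=> /cu <-; rewrite (cu (crd z)) //; exact: crdE.
Qed.

(** This is the i-th coordinate with respect to the invariant basis [Us m]. It commutes with
    Frobenius because [V], the inverse of [Us], satisfies tau(V) = Theta V ([tauV]). *)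
Definition dual_coord (i : 'I_r) (z : Mp) : Y := \sum_j rho (crd z 0 j) * V j i.
Local Notation a_ := dual_coord.

Let a_lin i s x y : a_ i (s *: x + y) = rho s * a_ i x + a_ i y.
Proof.
rewrite /a_; have -> : crd (s *: x + y) = s *: crd x + crd y.
  apply: crd_eq; rewrite {1}[x]crdE {1}[y]crdE scaler_sumr -big_split.
  by apply: eq_bigr => j _; rewrite !mxE scalerDl scalerA.
rewrite mulr_sumr -big_split; apply: eq_bigr => j _.
by rewrite !mxE rmorphD rmorphM mulrDl mulrA.
Qed.

Let a_D i x y : a_ i (x + y) = a_ i x + a_ i y.
Proof. by rewrite -[x]scale1r a_lin rmorph1 mul1r scale1r. Qed.

Let a_0 i : a_ i 0 = 0. Proof. exact/additive0/a_D. Qed.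

Let a_Z i s x : a_ i (s *: x) = rho s * a_ i x.
Proof. by rewrite -[s *: x]addr0 a_lin a_0 addr0. Qed.

Let a_basis i j : a_ i (m j) = V j i.
Proof.
rewrite /a_; have -> : crd (m j) = \row_k (k == j)%:R.
  apply: crd_eq; rewrite (bigD1 j) //= mxE eqxx scale1r big1 ?addr0 // => k kj.
  by rewrite mxE (negPf kj) scale0r.
rewrite (bigD1 j) //= mxE eqxx rmorph1 mul1r big1 ?addr0 // => k kj.
by rewrite mxE (negPf kj) rmorph0 mul0r.
Qed.

Let T0 : T 0 = 0. Proof. exact/additive0/TD. Qed.

Let a_T i z : a_ i (T z) = tau (a_ i z).
Proof.
rewrite {1}[z]crdE (big_morph T TD T0) (big_morph (a_ i) (a_D i) (a_0 i)).
rewrite /a_ rmorph_sum; apply: eq_bigr => j _; rewrite -/(a_ i _) TZ a_Z rmorphM rho_tau.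
congr (_ * _); have := congr1 (fun X : 'M_r => X j i) tauV; rewrite !mxE => ->.
rewrite T_basis (big_morph (a_ i) (a_D i) (a_0 i)); apply: eq_bigr => k _.
by rewrite a_Z a_basis mxE.
Qed.

Let hmuD x y : mu (x + y) = mu x + mu y. Proof. by case: hmu. Qed.
Let hmuZ s x : mu (s *: x) = f s *: mu x. Proof. by case: hmu. Qed.

(** The point of E(Ls) that corresponds to the equivariant functional m |-> pr x (a_i m); its
    coordinates are the values of that functional on the coordinate functions. *)
Definition tate_point (i : 'I_r) (x : Kp) : 'rV[Ls]_d := \row_k pr x (a_ i (mu (xk k))).

Let tate_pointE i x mm : ev mm (tate_point i x) = pr x (a_ i (mu mm)).
Proof.
symmetry; apply: (motive_eval_point (iLLs := iLLs) (H := H) (theta := fun mm => pr x (a_ i (mu mm)))).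
- by move=> *; rewrite hmuD a_D prDr.
- by move=> *; rewrite hmuZ a_Z pr_scalar.
- by move=> *; rewrite -Tmu a_T pr_tau.
Qed.

Fact tate_pointD i (x y : Kp) : tate_point i (x + y) = tate_point i x + tate_point i y.
Proof. by apply/rowP => k; rewrite !mxE prDl. Qed.

Fact tate_point_lin i a (x : Kp) :
  tate_point i (tofrac (to_adic lAp a) * x) = am_act E iLLs a (tate_point i x).
Proof.
apply/rowP => k; rewrite mxE prM inc_ad -a_Z -hmuZ -tate_pointE.
by rewrite motive_eval_actA motive_eval_coord.
Qed.

Fact tate_point_int i (x : Ap) : tate_point i (tofrac x) = 0.
Proof. by apply/rowP => k; rewrite !mxE pr_int. Qed.

Definition tate_vector (i : 'I_r) : tate_module E lAp iLLs :=
  TateModule (@tate_pointD i) (@tate_point_lin i) (@tate_point_int i).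

Let ev_sum mm (I : Type) (s : seq I) (g : I -> 'rV[Ls]_d) :
  ev mm (\sum_(i <- s) g i) = \sum_(i <- s) ev mm (g i).
Proof.
have e0 : ev mm 0 = 0 by exact/additive0/motive_evalDr.
exact: (big_morph (ev mm) (motive_evalDr H iLLs mm) e0).
Qed.

Let ext (W : lmodType S) (h h' : Mp -> W) :=
  @base_change_ext AL S f M Mp W mu h h' hmu.

(** Nondegeneracy turns equal Tate vectors into equal combinations of the [a_ i] on [M], hence on
    [Mp]. On the basis [m] these combinations have coefficients V c^T, and [V] is invertible. *)
Lemma tate_vector_free (c c' : 'rV[Ap]_r) :
  (forall x, \sum_i tate_vector i (tofrac (c 0 i) * x) =
             \sum_i tate_vector i (tofrac (c' 0 i) * x)) -> c = c'.
Proof.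
move=> cc.
pose w (c : 'rV[Ap]_r) (z : Mp) : restrict_scalars rho Y^o := \sum_i inc (c 0 i) * a_ i z.
have w_lin (b : 'rV_r) s x y : w b (s *: x + y) = s *: w b x + w b y.
  rewrite /w restrict_scalarsE scaler_sumr -big_split; apply: eq_bigr => i _.
  by rewrite a_lin mulrDr mulrCA.
have ww : forall z, w c z = w c' z.
  apply: (ext (w_lin c) (w_lin c')) => mm; apply: pr_ext => x.
  have E' b : pr x (w b (mu mm)) = ev mm (\sum_i tate_vector i (tofrac (b 0 i) * x)).
    by rewrite ev_sum /w pr_sum; apply: eq_bigr => i _; rewrite tate_pointE prM.
  by rewrite !E' cc.
have VV : V *m (map_mx inc c)^T = V *m (map_mx inc c')^T.
  apply/colP => j; have := ww (m j); rewrite /w !mxE => e.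
  transitivity (\sum_i inc (c 0 i) * a_ i (m j)).
    by apply: eq_bigr => i _; rewrite !mxE a_basis mulrC.
  by rewrite e; apply: eq_bigr => i _; rewrite !mxE a_basis mulrC.
have Vu : V \in unitmx by rewrite unitmx_inv.
have /trmx_inj e := can_inj (mulKmx Vu) VV.
apply/rowP => i; apply: inc_inj.
by have := congr1 (fun X : 'rV_r => X 0 i) e; rewrite !mxE.
Qed.

(** Perfectness represents x |-> m(s x) by an element [Z m], and [Z] extends to an equivariant
    linear map h on [Mp]. Its coordinates [Us *m zeta] in the basis of the [a_ i] are fixed by tau,
    hence come from A_p. *)
Lemma tate_vector_span (s : tate_module E lAp iLLs) : exists c : 'rV[Ap]_r,
  forall x, s x = \sum_i tate_vector i (tofrac (c 0 i) * x).
Proof.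
have Zex mm : exists z, forall x, pr x z = ev mm (s x).
  apply: pr_perfect => [x y|c x|y].
  - by rewrite tate_add motive_evalDr.
  - by rewrite tate_lin -motive_eval_actA tens_balanced motive_eval_actL.
  - rewrite tate_int; apply: (addrI (ev mm 0)).
    by rewrite -motive_evalDr !addr0.
have [Z ZP] := choice Zex.
have ZD x y : Z (x + y) = Z x + Z y.
  by apply: pr_ext => b; rewrite prDr !ZP motive_evalD.
have Z0 : Z 0 = 0 by exact/additive0/ZD.
have ZZ b mm : Z (b *: mm) = rho (f b) * Z mm.
  elim/(@tens_ind _ _ _ _ _ _ tAL): b => [|b b' hb hb'|a c].
  - by rewrite scale0r Z0 !rmorph0 mul0r.
  - by rewrite scalerDl ZD hb hb' !rmorphD mulrDl.
  - apply: pr_ext => x; rewrite ZP /tens -scalerA motive_eval_actA motive_eval_actL.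
    by rewrite -tate_lin -ZP prM inc_ad -pr_scalar !rmorphM mulrCA mulrA.
have Zfrob mm : Z (frob mm) = tau (Z mm).
  by apply: pr_ext => x; rewrite ZP motive_eval_frob -ZP pr_tau.
have [_ _ univ] := hmu.
have [||h [[hl hZ] _]] := univ (restrict_scalars rho Y^o) Z.
- exact: ZD.
- exact: ZZ.
have {}hl b x y : h (b *: x + y) = rho b * h x + h y by rewrite hl.
have hD x y : h (x + y) = h x + h y by rewrite -[x]scale1r hl rmorph1 mul1r scale1r.
have h0 : h 0 = 0 by exact/additive0/hD.
have hZ' b x : h (b *: x) = rho b * h x by rewrite -[b *: x]addr0 hl h0 addr0.
have hT : forall z, h (T z) = tau (h z).
  apply: (@ext (restrict_scalars (rho \o sigma) Y^o) (h \o T) (tau \o h)) => [b x y|b x y|mm] /=.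
  - by rewrite TD TZ hl.
  - by rewrite hl rmorphD rmorphM -rho_tau.
  - by rewrite Tmu !hZ Zfrob.
pose zeta : 'cV[Y]_r := \col_j h (m j).
have tz : map_mx tau zeta = map_mx rho Theta *m zeta.
  apply/colP => j; rewrite !mxE -hT T_basis (big_morph h hD h0).
  by apply: eq_bigr => k _; rewrite hZ' !mxE.
pose c' := Us *m zeta.
have tc : map_mx tau c' = c' by rewrite /c' map_mxM tz mulmxA Us_frob.
have cex i : exists c, c' i 0 = inc c.
  by apply: inc_fixed; have := congr1 (fun X : 'cV_r => X i 0) tc; rewrite mxE.
have [c cP] := choice cex.
have zE : zeta = V *m c' by rewrite /c' mulKmx.
exists (\row_i c i) => x; apply/rowP => k.
rewrite -(motive_eval_coord H iLLs) -ZP -hZ summxE.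
rewrite {1}[mu (xk k)]crdE (big_morph h hD h0).
transitivity (pr x (\sum_i inc (c i) * a_ i (mu (xk k)))); last first.
  by rewrite pr_sum; apply: eq_bigr => i _; rewrite !mxE prM.
congr (pr x _).
rewrite [RHS](eq_bigr (fun i => \sum_j inc (c i) * (rho (crd (mu (xk k)) 0 j) * V j i))); last first.
  by move=> i _; rewrite mulr_sumr.
rewrite exchange_big; apply: eq_bigr => j _; rewrite hZ'.
have -> : h (m j) = zeta j 0 by rewrite mxE.
rewrite zE mxE mulr_sumr; apply: eq_bigr => i _.
by rewrite cP [LHS]mulrA [RHS]mulrC.
Qed.

Lemma tate_vector_basis : tate_basis tate_vector.
Proof.
move=> s; have [c cP] := tate_vector_span s; exists c; split=> // c' c'P.
by apply: tate_vector_free => x; rewrite -cP -c'P.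
Qed.

(** Theta has entries over [L], so gY(Us) satisfies the same Frobenius equation as [Us]. The
    quotient of the two solutions is fixed by tau and thus has entries in A_p. *)
Lemma tate_vector_galois (g : {rmorphism Ls -> Ls}) (gY : {rmorphism Y -> Y}) :
  (forall x z, pr x (gY z) = g (pr x z)) -> (forall z, gY (tau z) = tau (gY z)) ->
  (forall s, gY (rho s) = rho s) ->
  map_mx gY Us \in unitmx /\ exists P : 'M[Ap]_r,
    [/\ P \in unitmx, galois_matrix tate_vector g P &
        map_mx inc P = Us *m invmx (map_mx gY Us)].
Proof.
move=> prg gtau grho; split; first exact: map_unit.
have lift (X : 'M[Y]_r) : map_mx tau X = X -> exists P : 'M[Ap]_r, map_mx inc P = X.
  move=> Xt; have ex (ij : 'I_r * 'I_r) : exists c, X ij.1 ij.2 = inc c.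
    by apply: inc_fixed; have := congr1 (fun Z : 'M_r => Z ij.1 ij.2) Xt; rewrite mxE.
  have [c cP] := choice ex; exists (\matrix_(i, j) c (i, j)).
  by apply/matrixP => i j; rewrite !mxE -cP.
have gtU : map_mx tau (map_mx gY Us) = map_mx gY (map_mx tau Us).
  by apply/matrixP => i j; rewrite !mxE gtau.
have gTheta : map_mx gY (map_mx rho Theta) = map_mx rho Theta.
  by apply/matrixP => i j; rewrite !mxE grho.
have gtV : map_mx tau (map_mx gY V) = map_mx rho Theta *m map_mx gY V.
  rewrite -{1}gTheta -map_mxM -tauV.
  by apply/matrixP => i j; rewrite !mxE gtau.
have gtU' : map_mx tau (map_mx gY Us) *m map_mx rho Theta = map_mx gY Us.
  by rewrite gtU -{1}gTheta -map_mxM Us_frob.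
have [P PE] : exists P : 'M[Ap]_r, map_mx inc P = Us *m map_mx gY V.
  by apply: lift; rewrite map_mxM gtV mulmxA Us_frob.
(* The inverse quotient is fixed as well; [P'] shows that [P] is invertible over A_p and not only
   over [Y]. *)
have [P' PE'] : exists P : 'M[Ap]_r, map_mx inc P = map_mx gY Us *m V.
  by apply: lift; rewrite map_mxM tauV mulmxA gtU'.
exists P; split; last by rewrite PE map_inv.
- have : P *m P' = 1%:M.
    have e : map_mx inc (P *m P') = 1%:M.
      rewrite map_mxM PE PE' -mulmxA [map_mx gY V *m _]mulmxA -map_mxM mulVmx // map_mx1.
      by rewrite mul1mx mulmxV.
    apply/matrixP => i j; apply: inc_inj.
    have := congr1 (fun X : 'M_r => X i j) e; rewrite !mxE => ->.
    by rewrite rmorph_nat.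
  by case/mulmx1_unit.
- move=> j x; apply/rowP => k; rewrite !mxE -prg summxE.
  (* Since [gY] fixes coordinates over [L], it acts on [a_ j] only through column j of [V], and
     gY(V) = V P turns this column into the combination with coefficients P i j. *)
  have VP : map_mx gY V = V *m map_mx inc P by rewrite PE mulKmx.
  rewrite /a_ rmorph_sum.
  transitivity (pr x (\sum_i inc (P i j) * a_ i (mu (xk k)))); last first.
    by rewrite pr_sum; apply: eq_bigr => i _; rewrite !mxE prM.
  congr (pr x _).
  rewrite [RHS](eq_bigr (fun i => \sum_n inc (P i j) * (rho (crd (mu (xk k)) 0 n) * V n i))); last first.
    by move=> i _; rewrite mulr_sumr.
  rewrite exchange_big; apply: eq_bigr => n _; rewrite rmorphM grho.
  have := congr1 (fun X : 'M_r => X n j) VP; rewrite !mxE => ->.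
  rewrite mulr_sumr; apply: eq_bigr => i _.
  by rewrite mxE [LHS]mulrA [RHS]mulrC.
Qed.
End TateModule.

(** * Base change and Frobenius-fixed elements *)

Lemma tensor_map_inj (k : fieldType) (A : comNzRingType) (F F' : fieldType)
    (T T' : comNzRingType) (iA : {rmorphism k -> A}) (iF : {rmorphism k -> F})
    (iF' : {rmorphism k -> F'}) (t : tensor_product iA iF T) (t' : tensor_product iA iF' T')
    (j : {rmorphism F -> F'}) (h : {rmorphism T -> T'}) (B : set A) :
  is_basis iA B -> (forall c, j (iF c) = iF' c) ->
  (forall a f, h (tens t a f) = tens t' a (j f)) -> injective h.
Proof.
move=> hB jc hT; have [coord BP] := basis_coord_exists hB.
apply: raddf_inj => z hz; have [s [_ sB ->]] := tens_basis_sum t BP z.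
rewrite big_seq big1 // => b /sB Bb.
have [lin _ _] := BP; have [D Z] := lin b Bb.
suff -> : contract t (coord b) z = 0 by exact: tens0r.
apply: (fmorph_inj j); rewrite -(contract_tensor_map D Z jc hT) hz rmorph0.
exact: contract0 D Z.
Qed.

(** The polynomial X^q - X has at most q roots in F, and the image of k already provides q of
    them. *)
Lemma fixed_frobenius (k : finFieldType) (F : fieldType) (iF : {rmorphism k -> F}) (c : F) :
  c ^+ #|k| = c -> exists x, c = iF x.
Proof.
move=> cq; apply: contrapT => nc.
have szX : size ('X^#|k| - 'X : {poly F}) = #|k|.+1.
  by rewrite size_polyDl size_polyXn // size_polyN size_polyX ltnS finNzRing_gt1.
have : (#|k|.+1 < size ('X^#|k| - 'X : {poly F})%R)%N.
  have -> : #|k|.+1 = size (c :: [seq iF x | x : k]) by rewrite /= size_image.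
  apply: max_poly_roots.
  - by rewrite -size_poly_gt0 szX.
  - rewrite /= /root !hornerE cq subrr eqxx; apply/allP => _ /mapP [x _ ->].
    by rewrite !hornerE -rmorphXn /= expf_card subrr.
  - rewrite /= map_inj_uniq ?enum_uniq; last exact: fmorph_inj.
    by rewrite andbT; apply/negP => /mapP [x _ cx]; apply: nc; exists x.
by rewrite szX ltnn.
Qed.

Section AdicTools.
Variables (k : fieldType) (A : comNzRingType) (iA : {rmorphism k -> A}) (p : idealr A).

Lemma adic_tensor_ext (F F0 : comNzRingType) (iF : {rmorphism k -> F})
    (iF0 : {rmorphism k -> F0}) (Y T0 : comNzRingType) (t : adic_tensor iA p iF Y)
    (t0 : tensor_product iA iF0 T0) (f g : {rmorphism T0 -> Y}) :
  (forall n a c, lim_proj (level_limit t) n (f (tens t0 a c)) =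
     lim_proj (level_limit t) n (g (tens t0 a c))) -> forall x, f x = g x.
Proof.
move=> fg x; apply: (tens_rmorph_ext (t := t0) (g := f) (h := g)) => a c.
by apply: (lim_ext (l := level_limit t)) => n.
Qed.

Lemma tens_to_adic (F F0 : comNzRingType) (iF : {rmorphism k -> F})
    (iF0 : {rmorphism k -> F0}) (Y T0 : comNzRingType) (t : adic_tensor iA p iF Y)
    (t0 : tensor_product iA iF0 T0) (g : {rmorphism F0 -> F}) :
  (forall c, g (iF0 c) = iF c) ->
  exists eta : {rmorphism T0 -> Y}, forall n a c,
    lim_proj (level_limit t) n (eta (tens t0 a c)) = tens (level_tensor t n) (to_quo p n a) (g c).
Proof.
move=> gc; have H n : exists P : {rmorphism T0 -> level t n},
    forall a c, P (tens t0 a c) = tens (level_tensor t n) (to_quo p n a) (g c).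
  have [||P [_ PP]] := tensor_map_rmorph t0 (level_tensor t n) (u := to_quo p n) (v := g) => //.
  by exists P.
have [P PP] := dependent_choice H.
have [r rP] := adic_trans_rmorph t.
have [||eta [_ etaP]] := @lim_lift_rmorph _ _ _ (level_limit t) T0 P P.
- by [].
- move=> n x; rewrite (rP n).1.
  apply: (tens_rmorph_ext (t := t0) (g := r n \o P n.+1) (h := P n)) => a c.
  by rewrite /= !PP (rP n).2 quo_trans_to_quo.
by exists eta => n a c; rewrite etaP PP.
Qed.

Lemma adic_nilpotent (F S Y : comNzRingType) (iF : {rmorphism k -> F})
    (t : adic_tensor iA p iF Y) (i : A -> S) (eta : {rmorphism S -> Y}) :
  (forall n a, lim_proj (level_limit t) n (eta (i a)) = tensl (level_tensor t n) (to_quo p n a)) ->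
  forall n z, generated_ideal (ideal_image i p) z ->
    lim_proj (level_limit t) n (eta z) ^+ n.+1 = 0.
Proof.
move=> etai n z.
apply: (@generated_ideal_nilpotent A S _ p i (lim_proj (level_limit t) n \o eta) n
  (tensl (level_tensor t n) \o to_quo p n)); first exact: etai.
by move=> a ap; apply/eqP; rewrite /= (_ : to_quo p n a = 0) ?rmorph0 //; apply/eqP; rewrite to_quo_eq0.
Qed.

(** At every level 1 - b becomes nilpotent, so a finite geometric series inverts b. This is the unit
    condition of [semilocal_extend]. *)
Lemma adic_one_plus_unit (F S : comNzRingType) (Y : comUnitRingType) (iF : {rmorphism k -> F})
    (t : adic_tensor iA p iF Y) (i : A -> S) (eta : {rmorphism S -> Y}) :
  (forall n a, lim_proj (level_limit t) n (eta (i a)) = tensl (level_tensor t n) (to_quo p n a)) ->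
  forall b, generated_ideal (ideal_image i p) (1 - b) -> eta b \is a GRing.unit.
Proof.
move=> etai b gb; apply: (adic_unit (t := t)) => n.
have := adic_nilpotent etai n gb.
rewrite rmorphB rmorph1 rmorphB rmorph1; set y := lim_proj _ _ _ => nil.
exists (\sum_(i < n.+1) (1 - y) ^+ i).
have := subrX1 (1 - y) n.+1; rewrite nil sub0r addrAC subrr add0r mulNr => /oppr_inj e.
by rewrite mulrC -e.
Qed.

Section Compose.
Variables (F F' F'' : comNzRingType) (iF : {rmorphism k -> F}) (iF' : {rmorphism k -> F'})
  (iF'' : {rmorphism k -> F''}).
Variables (Y Y' Y'' : comNzRingType) (t : adic_tensor iA p iF Y) (t' : adic_tensor iA p iF' Y')
  (t'' : adic_tensor iA p iF'' Y'').

Lemma levelwise_comp (g : F -> F') (g' : F' -> F'') G G' h h' :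
  levelwise (t := t) (t' := t') g G h -> levelwise (t := t') (t' := t'') g' G' h' ->
  levelwise (t := t) (t' := t'') (g' \o g) (G' \o G) (fun n => h' n \o h n).
Proof.
by move=> hG hG' n; split=> [a f|y] /=; rewrite ?(hG n).1 ?(hG' n).1 // (hG' n).2 (hG n).2.
Qed.

Lemma levelwise_ext (g : F -> F') (G G' : Y -> Y') (h h' : forall n, {rmorphism level t n -> level t' n}) :
  levelwise (t := t) (t' := t') g G h -> levelwise (t := t) (t' := t') g G' h' ->
  forall y, G y = G' y.
Proof.
move=> hG hG' y; apply: (lim_ext (l := level_limit t')) => n.
rewrite (hG n).2 (hG' n).2.
apply: (tens_rmorph_ext (t := level_tensor t n) (g := h n) (h := h' n)) => a f.
by rewrite (hG n).1 (hG' n).1.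
Qed.
End Compose.
End AdicTools.

Section AdicFixed.
Variables (k : finFieldType) (A : comNzRingType) (iA : {rmorphism k -> A}) (p : idealr A).
Variables (F : fieldType) (iF : {rmorphism k -> F}) (Y : comNzRingType) (t : adic_tensor iA p iF Y).
Variables (Ap : comNzRingType) (l : adic_ring p Ap).
Hypothesis fin : forall n, exists N (e : 'I_N -> quo p n) (mu : 'I_N -> quo p n -> k),
  finite_basis (quo_const iA p n) e mu.

Let tensl_inj n : injective (tensl (level_tensor t n)).
Proof.
have [N [e [mu [lin mue span]]]] := fin n.
apply: raddf_inj => x tx; rewrite [x]span big1 // => b _.
suff -> : mu b x = 0 by rewrite rmorph0 mul0r.
apply: (fmorph_inj iF); rewrite rmorph0 -[LHS]mulr1.
rewrite -(contractT (level_tensor t n) (lin b).1 (lin b).2) tens1r tx.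
exact: contract0 (lin b).1 (lin b).2.
Qed.

Lemma adic_incl_inj : injective (adic_incl l t).
Proof.
have [h [-> hP]] := adic_incl_rmorph t l => x y xy.
by apply: (lim_ext (l := l)) => n; apply: (tensl_inj (n := n)); rewrite -!hP xy.
Qed.

(** In a basis of A / p^(n+1) over k, being fixed means that each coordinate equals its q-th power,
    so it lies in k. *)
Lemma adic_fixed (tau : {rmorphism Y -> Y}) (h : forall n, {rmorphism level t n -> level t n}) :
  levelwise (t := t) (t' := t) (fun c => c ^+ #|k|) tau h ->
  forall z, tau z = z -> exists c, z = adic_incl l t c.
Proof.
move=> htau z tz; have [phi [phiE phic]] := frobenius_rmorph iF.
have H n : exists y : quo p n, tensl (level_tensor t n) y = lim_proj (level_limit t) n z.
  have [N [e [mu emu]]] := fin n; have [lin mue span] := emu.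
  set zn := lim_proj _ _ _.
  have hz : h n zn = zn by rewrite /zn -(htau n).2 tz.
  have hT a f : h n (tens (level_tensor t n) a f) = tens (level_tensor t n) a (phi f).
    by rewrite (htau n).1 -phiE.
  have cE b : exists x, contract (level_tensor t n) (mu b) zn = iF x.
    apply: fixed_frobenius; rewrite -[RHS]/(contract (level_tensor t n) (mu b) zn).
    rewrite -{2}hz (contract_tensor_map (lin b).1 (lin b).2 phic hT).
    by rewrite -phiE.
  have [x xP] := choice cE.
  exists (\sum_b quo_const iA p n (x b) * e b).
  rewrite [RHS](contract_expand (level_tensor t n) emu) rmorph_sum; apply: eq_bigr => b _.
  by rewrite xP rmorphM tens_balanced -tens1l -tens1r tensM mul1r mulr1.
have [y yP] := dependent_choice H.
have [r rP] := adic_trans_rmorph t.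
have [n|c [cP _]] := @lim_universal _ _ _ l y.
  apply: (tensl_inj (n := n)); rewrite yP -(lim_compat (level_limit t)) (rP n).1 -yP.
  by rewrite -!tens1r (rP n).2.
exists c; have [i [-> iP]] := adic_incl_rmorph t l.
by apply: (lim_ext (l := level_limit t)) => n; rewrite iP cP yP.
Qed.
End AdicFixed.

Lemma base_change_frob_spec (R S : nzRingType) (f : R -> S) (M : lmodType R)
    (N : lmodType S) (mu : M -> N) (sigma : {rmorphism S -> S}) (tau : M -> M) (tauR : R -> R) :
  is_base_change f mu -> (forall x y, tau (x + y) = tau x + tau y) ->
  (forall r x, tau (r *: x) = tauR r *: tau x) -> (forall r, sigma (f r) = f (tauR r)) ->
  [/\ forall x y, base_change_frob mu sigma tau (x + y) =
        base_change_frob mu sigma tau x + base_change_frob mu sigma tau y,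
      forall s x, base_change_frob mu sigma tau (s *: x) = sigma s *: base_change_frob mu sigma tau x &
      forall x, base_change_frob mu sigma tau (mu x) = mu (tau x)].
Proof.
move=> [muD muZ univ] tauD tauZ sf.
rewrite /base_change_frob; case: xgetP => // ne; exfalso.
have [||h [[hl hmu] _]] := univ (restrict_scalars sigma N) (mu \o tau).
- by move=> x y; rewrite /= tauD muD.
- by move=> r x; rewrite /= tauZ muZ restrict_scalarsE sf.
have hD x y : h (x + y) = h x + h y by rewrite -[x]scale1r hl !scale1r.
have h0 : h 0 = 0 by exact/additive0/hD.
apply: (ne h); split=> // s x.
by rewrite -[s *: x]addr0 hl h0 addr0.
Qed.

Lemma semilocal_rmorph_ext_inj (S S' : idomainType) (P : set S) (P' : set S')
    (e : {rmorphism S -> S'}) (f g : {rmorphism semilocal P -> semilocal P'}) : injective e ->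
  (forall s, f (to_semilocal P s) = to_semilocal P' (e s)) ->
  (forall s, g (to_semilocal P s) = to_semilocal P' (e s)) -> forall x, f x = g x.
Proof.
move=> ei fe ge x; have [a [b [b0 _ xE]]] := semilocal_frac x.
have eb : tofrac (e b) != 0.
  by rewrite tofrac_eq0; apply: contra b0 => /eqP eb; apply/eqP/ei; rewrite eb rmorph0.
have xb := semilocal_mul_denom b0 xE.
have E (u : {rmorphism semilocal P -> semilocal P'}) :
   (forall s, u (to_semilocal P s) = to_semilocal P' (e s)) -> val (u x) * tofrac (e b) = tofrac (e a).
  by move=> ue; have := congr1 (val \o u) xb; rewrite /= rmorphM !ue.
by apply: val_inj; apply: (mulIf eb); rewrite !E.
Qed.

(** The coordinate map M -> S^r extends to N by the universal property, and the extension recovers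
    the coefficients of a combination of the [mu (m i)]. *)
Lemma base_change_basis_free (R S : nzRingType) (f : {rmorphism R -> S}) (M : lmodType R)
    (N : lmodType S) (mu : M -> N) (r : nat) (m : 'I_r -> M) (c c' : 'rV[S]_r) :
  is_base_change f mu -> is_module_basis m ->
  \sum_i c 0 i *: mu (m i) = \sum_i c' 0 i *: mu (m i) -> c = c'.
Proof.
move=> [muD muZ univ] hm cc.
have [crd crdP] := choice hm.
have crd_eq z (b : 'rV[R]_r) : z = \sum_i b 0 i *: m i -> crd z = b.
  by move=> zb; have [_ u] := crdP z; apply: u.
have crdE z : z = \sum_i crd z 0 i *: m i by case: (crdP z).
have [||h [[hl hmu] _]] := univ 'rV[S]_r (fun z => map_mx f (crd z)).
- move=> x y; rewrite -map_mxD; congr map_mx; apply: crd_eq.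
  rewrite {1}[x]crdE {1}[y]crdE -big_split; apply: eq_bigr => i _.
  by rewrite !mxE scalerDl.
- move=> s x; rewrite -map_mxZ; congr map_mx; apply: crd_eq.
  rewrite {1}[x]crdE scaler_sumr; apply: eq_bigr => i _.
  by rewrite !mxE scalerA.
have hD x y : h (x + y) = h x + h y by rewrite -[x]scale1r hl !scale1r.
have h0 : h 0 = 0 by exact/additive0/hD.
have hb (b : 'rV[S]_r) : h (\sum_i b 0 i *: mu (m i)) = b.
  rewrite (big_morph h hD h0); apply/rowP => j; rewrite summxE (bigD1 j) //= big1 ?addr0.
    rewrite -[b 0 j *: _]addr0 hl h0 addr0 hmu mxE (crd_eq (m j) (delta_mx 0 j)).
      by rewrite !mxE !eqxx rmorph1 mulr1.
    rewrite (bigD1 j) //= mxE !eqxx scale1r big1 ?addr0 // => i ij.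
    by rewrite mxE (negPf ij) andbF scale0r.
  move=> i ij; rewrite -[b 0 i *: _]addr0 hl h0 addr0 hmu mxE (crd_eq (m i) (delta_mx 0 i)).
    by rewrite !mxE eq_sym (negPf ij) andbF rmorph0 mulr0.
  rewrite (bigD1 i) //= mxE !eqxx scale1r big1 ?addr0 // => i' ij'.
  by rewrite mxE (negPf ij') andbF scale0r.
by rewrite -(hb c) cc hb.
Qed.

(** A fraction with denominator 1 modulo p has a unit under [psi] as denominator, so the condition
    in the definition has [rho x] as its only solution. *)
Lemma tate_semilocal_to_adicE (R : realType) (k : finFieldType) (A : comNzRingType)
    (iA : k -> A) (C : fieldType) (iC : k -> C) (abs : C -> R) (AC : comNzRingType)
    (tAC : tensor_product iA iC AC) (TT : idomainType) (normT : TT -> R)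
    (jT : {rmorphism AC -> TT}) (p : idealr A) (ACp : comUnitRingType)
    (tACp : adic_tensor iA p iC ACp) (psi : {rmorphism TT -> ACp})
    (rho : {rmorphism semilocal (tate_prime tAC jT p) -> ACp}) :
  tate_to_adic abs tAC normT jT tACp = psi ->
  (forall b, generated_ideal (tate_prime tAC jT p) (1 - b) -> psi b \is a GRing.unit) ->
  (forall (x : semilocal (tate_prime tAC jT p)) (a b : TT), b != 0 ->
    val x = tofrac a / tofrac b -> rho x * psi b = psi a) ->
  forall x, @tate_semilocal_to_adic R k A iA C iC abs AC tAC TT normT jT p ACp tACp x = rho x.
Proof.
move=> psiE psiu rhoP x; rewrite /tate_semilocal_to_adic psiE.
have [a [b [b0 gb xE]]] := semilocal_frac x.
case: xgetP => [y _ yP|ne]; last by case: (ne (rho x)) => c d; exact: rhoP.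
by apply: (mulIr (psiu b gb)); rewrite (yP a b b0 xE) (rhoP x a b b0 xE).
Qed.

Local Close Scope classical_set_scope.

Theorem theorem9p6
  (R : realType)
  (* the curve and the ring A = affine_ring oo *)
  (Fq : finFieldType) (K : fieldType) (iK : {rmorphism Fq -> K})
  (hK : is_function_field iK) (oo : place iK)
  (* K <= L <= Ls <= C = C_oo *)
  (L Ls C : fieldType) (iKL : {rmorphism K -> L}) (iLLs : {rmorphism L -> Ls})
  (iLsC : {rmorphism Ls -> C}) (abs : C -> R)
  (hC : is_C_infty oo (iLsC \o iLLs \o iKL) abs)
  (hLs : is_separable_closure_in iLLs iLsC)
  (* A (x) L, A (x) C and the completion TT of the latter *)
  (AL : idomainType)
  (tAL : tensor_product (@affine_const Fq K iK oo) (iKL \o iK) AL)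
  (AC : comNzRingType)
  (tAC : tensor_product (@affine_const Fq K iK oo) (iLsC \o iLLs \o iKL \o iK) AC)
  (B : set (affine_ring oo)) (hB : is_basis (@affine_const Fq K iK oo) B)
  (TT : idomainType) (normT : TT -> R) (jT : {rmorphism AC -> TT})
  (hT : is_completion (gauss_norm tAC abs B) normT jT)
  (* the prime p, A_p, (A (x) Ls)_p and (A (x) C)_p *)
  (p : prime_idealr (affine_ring oo)) (hp : exists2 a, a \in p & a != 0)
  (Ap : idomainType) (lAp : adic_ring p Ap)
  (ALsp : comUnitRingType)
  (tALsp : adic_tensor (@affine_const Fq K iK oo) p (iLLs \o iKL \o iK) ALsp)
  (ACp : comUnitRingType)
  (tACp : adic_tensor (@affine_const Fq K iK oo) p (iLsC \o iLLs \o iKL \o iK) ACp)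
  (* the Anderson module and its motive *)
  (d : nat) (E : anderson_module (iKL \o iK) (iKL \o \val) d)
  (M : lmodType AL) (hM : motive E tAL M)
  (Mp : lmodType (semilocal (ideal_image (tensl tAL) p))) (muMp : M -> Mp)
  (hMp : is_base_change (@to_semilocal AL (ideal_image (tensl tAL) p)) muMp)
  (hfree : exists (n : nat) (b : 'I_n -> Mp), is_module_basis b)
  (r : nat) (hr : motive_rank M r)
  (* the basis m and the trivialization U *)
  (m : 'I_r -> Mp) (hm : is_module_basis m)
  (U : 'M[semilocal (tate_prime tAC jT p)]_r) (hU : U \in unitmx)
  (htriv : is_trivialization
     (semilocal_map (tate_prime tAC jT p)
        (jT \o tensor_map tAL tAC id (iLsC \o iLLs)))
     (semilocal_map (tate_prime tAC jT p) (tate_frob tAC normT jT))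
     (base_change_frob muMp
        (semilocal_map (ideal_image (tensl tAL) p) (tens_frob tAL))
        (motive_frob hM))
     m U) :
  let UC := map_mx (@tate_semilocal_to_adic R Fq _ _ _ _ abs AC tAC TT normT jT p ACp tACp) U in
  (forall i j, exists y : ALsp, UC i j = adic_map tALsp tACp iLsC y) /\
  (forall Us : 'M[ALsp]_r, map_mx (adic_map tALsp tACp iLsC) Us = UC ->
   exists t : 'I_r -> tate_module E lAp iLLs, tate_basis t /\
   forall g : {rmorphism Ls -> Ls}, is_galois iLLs g ->
   map_mx (adic_map tALsp tALsp g) Us \in unitmx /\
   exists P : 'M[Ap]_r,
     [/\ P \in unitmx, galois_matrix t g P &
         map_mx (adic_incl lAp tALsp) P =
           Us *m invmx (map_mx (adic_map tALsp tALsp g) Us)]).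
Proof.
have [absM _ [_ [_ [_ [_ _ _ [absU _ _ absC]]]]]] := hC.
have [a ap a0] := hp.
pose iA : {rmorphism Fq -> affine_ring oo} := @affine_const Fq K iK oo.
pose fin := quo_finite_basis (iA := iA) (v := val) val_inj ap a0 (affine_ring_bound hK).
have hfin n : exists s : seq (quo p n), uniq s /\ is_basis (quo_const iA p n) [set` s]%classic.
  by have [N [e [mu emu]]] := fin n; exact: finite_basis_is_basis emu.
pose q := #|Fq|.
have [phiL [phiLE phiLc]] := frobenius_rmorph (iKL \o iK).
have [phiLs [phiLsE phiLsc]] := frobenius_rmorph (iLLs \o iKL \o iK).
have [phiC [phiCE phiCc]] := frobenius_rmorph (iLsC \o iLLs \o iKL \o iK).
have [tauT [tauTE tauT_inj tauTj _]] := tate_frob_rmorph absU absM hB hT.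
have [psi [psiE psiP psi_tau]] := tate_to_adic_rmorph tACp absU absM absC hB hT hfin.
have jT_inj := tate_inj absU hB hT.
have [||h0 [h0E h0T]] := tensor_map_rmorph tAL tAC (u := idfun) (v := iLsC \o iLLs) => //.
have [||tf [tfE tfT]] := tensor_map_rmorph tAL tAL (u := idfun) (v := phiL) => //.
have {}h0E : tensor_map tAL tAC id (iLsC \o iLLs) = h0 := h0E.
have h0_inj : injective h0.
  by apply: (tensor_map_inj (t := tAL) (t' := tAC) (j := iLsC \o iLLs) hB).
have tf_inj : injective tf.
  by apply: (tensor_map_inj (t := tAL) (t' := tAL) (j := phiL) hB).
have tens_frobE : tens_frob tAL = tf by rewrite /tens_frob phiLE.
have [frobC [frobCE frobCT]] := tens_frob_rmorph tAC.
pose P := ideal_image (tensl tAL) p.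
pose P' := tate_prime tAC jT p.
have jh_inj : injective (jT \o h0) by exact: inj_comp.
have [|im [imE imP]] := semilocal_map_rmorph (P := P) (P' := P') (f := jT \o h0) jh_inj.
  by move=> _ [b bp ->]; exists b; rewrite //= -tens1r h0T rmorph1 tens1r.
have [|sS [sSE sSP]] := semilocal_map_rmorph (P := P) (P' := P) (f := tf) tf_inj.
  by move=> _ [b bp ->]; exists b; rewrite // -tens1r tfT rmorph1 tens1r.
have [|sT [sTE sTP]] := semilocal_map_rmorph (P := P') (P' := P') (f := tauT) tauT_inj.
  move=> _ [b bp ->]; exists b; rewrite //= tauTj frobCE -tens1r frobCT expr1n //.
have [eta etaP] := tens_to_adic tALsp tAL (g := iLLs) (fun c => erefl).
have eta_i n b : lim_proj (level_limit tALsp) n (eta (tensl tAL b)) =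
    tensl (level_tensor tALsp n) (to_quo p n b).
  by rewrite -!tens1r etaP rmorph1.
have psi_i n b : lim_proj (level_limit tACp) n (psi ((jT \o tensl tAC) b)) =
    tensl (level_tensor tACp n) (to_quo p n b).
  by rewrite /= -!tens1r psiP.
have etaU := adic_one_plus_unit eta_i.
have psiU := adic_one_plus_unit psi_i.
have [rho rhoP] := semilocal_extend etaU.
have [rhoT rhoTP] := semilocal_extend psiU.
have rhoE s : rho (to_semilocal P s) = eta s.
  have := rhoP (to_semilocal P s) s 1 (oner_neq0 _).
  by rewrite rmorph1 mulr1; apply; rewrite /= rmorph1 divr1.
have rhoTE s : rhoT (to_semilocal P' s) = psi s.
  have := rhoTP (to_semilocal P' s) s 1 (oner_neq0 _).
  by rewrite rmorph1 mulr1; apply; rewrite /= rmorph1 divr1.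
have toAdicE := tate_semilocal_to_adicE psiE psiU rhoTP.
have [//|G [hG [GE GP]]] := adic_map_rmorph tALsp tACp (g := iLsC).
have [//|tauY [htY [_ tauYP]]] := adic_map_rmorph tALsp tALsp (g := phiLs).
have [//|tauC [htC [_ tauCP]]] := adic_map_rmorph tACp tACp (g := phiC).
(* The two routes from (A \otimes L)_(p) to (A \otimes C)_p, through [Ls] and through the Tate
   algebra, agree; it suffices to check pure tensors. *)
have Grho : forall x, G (rho x) = rhoT (im x).
  apply: (semilocal_rmorph_ext (f := G \o rho) (g := rhoT \o im)) => [b gb|s] /=.
    by rewrite rhoE rmorph_unit // etaU.
  rewrite rhoE imP rhoTE.
  apply: (adic_tensor_ext (t := tACp) (t0 := tAL) (f := G \o eta) (g := psi \o (jT \o h0))) => n b c /=.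
  by rewrite (GP n).2 etaP (GP n).1 h0T psiP.
have rho_tau : forall x, rho (sS x) = tauY (rho x).
  apply: (semilocal_rmorph_ext (f := rho \o sS) (g := tauY \o rho)) => [b gb|s] /=.
    rewrite sSP rhoE; apply: etaU; rewrite -(rmorph1 tf) -rmorphB.
    apply: (generated_ideal_map (P := P)) gb => _ [b' b'p ->].
    by exists b'; rewrite // -tens1r tfT rmorph1 tens1r.
  rewrite sSP !rhoE.
  apply: (adic_tensor_ext (t := tALsp) (t0 := tAL) (f := eta \o tf) (g := tauY \o eta)) => n b c /=.
  by rewrite tfT !etaP (tauYP n).2 etaP (tauYP n).1 -phiLE -phiLsE rmorphXn.
have psi_tau' x : psi (tauT x) = tauC (psi x).
  by rewrite -tauTE (psi_tau tauC htC) // phiCE.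
have rhoT_tau : forall x, rhoT (sT x) = tauC (rhoT x).
  apply: (semilocal_rmorph_ext (f := rhoT \o sT) (g := tauC \o rhoT)) => [b gb|s] /=.
    by rewrite sTP rhoTE psi_tau' rmorph_unit // psiU.
  by rewrite sTP !rhoTE psi_tau'.
have im_tau : forall x, sT (im x) = im (sS x).
  apply: (semilocal_rmorph_ext_inj (f := sT \o im) (g := im \o sS) (e := jT \o (h0 \o tf))) => [|s|s].
  - apply: inj_comp => //; exact: inj_comp.
  - rewrite /= imP sTP /= tauTj frobCE; congr (to_semilocal _ (jT _)).
    apply: (tens_rmorph_ext (t := tAL) (g := frobC \o h0) (h := h0 \o tf)) => b c.
    by rewrite /= h0T frobCT tfT h0T -phiLE !rmorphXn.
  - by rewrite /= sSP imP.
have [TD TZ Tmu] : let T := base_change_frob muMp (semilocal_map P (tens_frob tAL)) (motive_frob hM) in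
    [/\ forall x y, T (x + y) = T x + T y, forall s x, T (s *: x) = sS s *: T x &
        forall x, T (muMp x) = muMp (motive_frob hM x)].
  rewrite /= tens_frobE sSE; apply: (base_change_frob_spec (tauR := tf) hMp).
  - exact: motive_frobD.
  - by move=> s x; rewrite motive_frob_semilinear tens_frobE.
  - exact: sSP.
have [W [w [hW wU]]] := htriv.
move: TD TZ Tmu hW wU; rewrite h0E imE tauTE sTE.
set T := base_change_frob muMp _ _ => TD TZ Tmu hW wU.
have [Theta_ ThetaP] := choice (fun i => hm (T (m i))).
pose Theta : 'M_r := \matrix_(i, j) Theta_ i 0 j.
have T_basis i : T (m i) = \sum_j Theta i j *: m j.
  have [e _] := ThetaP i; rewrite [LHS]e; apply: eq_bigr => j _; rewrite mxE //.
(* The [w (m j)] stay linearly independent after base change, so invariance of the rows of U m can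
   be compared coefficient by coefficient. *)
have U_frob : map_mx sT U *m map_mx im Theta = U.
  apply/row_matrixP => i; apply: (base_change_basis_free (m := m) hW hm).
  have [wD wZ _] := hW.
  have w0 : w 0 = 0 by exact/additive0/wD.
  have [SD SZ Sw] := base_change_frob_spec hW TD TZ im_tau.
  set B' := base_change_frob w _ _ in SD SZ Sw.
  have S0 : B' 0 = 0 by exact/additive0/SD.
  transitivity (\sum_j U i j *: w (m j)); last by apply: eq_bigr => j _; rewrite !mxE.
  rewrite -wU -/B' (big_morph B' SD S0).
  transitivity (\sum_k \sum_j (sT (U i j) * im (Theta j k)) *: w (m k)).
    apply: eq_bigr => k _; rewrite !mxE scaler_suml; apply: eq_bigr => j _.
    by rewrite !mxE.
  rewrite exchange_big; apply: eq_bigr => j _.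
  rewrite SZ Sw T_basis (big_morph w wD w0) scaler_sumr; apply: eq_bigr => k _.
  by rewrite wZ scalerA.
move=> UC.
have UCE : UC = map_mx rhoT U by apply/matrixP => i j; rewrite !mxE toAdicE.
clearbody UC.
have UC_frob : map_mx tauC UC *m map_mx (rhoT \o im) Theta = UC.
  rewrite UCE -{2}U_frob map_mxM; congr (_ *m _); apply/matrixP => i j; rewrite !mxE.
    by rewrite rhoT_tau.
  by [].
have q0 : q%:R = 0 :> L.
  have [l [n [_ lFq n0 qE]]] := card_finField Fq.
  have lL : l \in [pchar L] by rewrite (fmorph_pchar (iKL \o iK)).
  by rewrite /q qE -(prednK n0) expnS natrM (pcharf0 lL) mul0r.
have sep (x : C) : (exists2 f : {poly L}, separable_poly f & root (map_poly (iLsC \o iLLs) f) x) ->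
    exists y, x = iLsC y by move=> /hLs.
have lift i j : exists y, G y = UC i j.
  apply: (adic_map_range (t := tALsp) (t' := tACp) (j := iLsC) (h := hG) (fun c => erefl) GP fin) => n.
  have [N [e [mu emu]]] := fin n.
  pose u : 'rV_r := \row_l lim_proj (level_limit tACp) n (UC i l).
  pose Th : 'M_r := map_mx (lim_proj (level_limit tACp) n \o (rhoT \o im)) Theta.
  have uE : u = map_mx (htC n) u *m Th.
    apply/rowP => l; rewrite !mxE -{1}UC_frob mxE rmorph_sum; apply: eq_bigr => l' _.
    by rewrite rmorphM !mxE (tauCP n).2.
  have -> : lim_proj (level_limit tACp) n (UC i j) = u 0 j by rewrite mxE.
  apply: (level_lift (t := level_tensor tALsp n) (t' := level_tensor tACp n)
    (j := iLsC) (h := hG n) (i := iLLs) (phiL := phiL) (phiC := phiC) (q := q)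
    (iL := iKL \o iK) (tau := htC n) (u := u) (Theta := Th)
    (fun c => erefl) (GP n).1 emu sep q0 _ _ _ _ _ uE).
  - by move=> x; rewrite -phiLE.
  - by move=> x; rewrite -phiCE.
  - by [].
  - exact: (tauCP n).1.
  - move=> b c; rewrite mxE.
    have big s : rhoT (im (to_semilocal P s)) = psi (jT (h0 s)) by rewrite imP rhoTE.
    (* Modulo p^(n+1) the denominators of Theta disappear: each entry is the image of some s in A
       \otimes L, which makes it rational over [L]. *)
    have [z gz|s ->] := semilocal_approx (h := lim_proj (level_limit tACp) n \o (rhoT \o im))
        (n := n.+1) _ (Theta b c).
      rewrite /= big; apply: (adic_nilpotent (i := tensl tAL) (eta := psi \o (jT \o h0))) gz => n' b'.
      by rewrite /= -!tens1r h0T psiP rmorph1.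
    rewrite /= big; elim/(@tens_ind _ _ _ _ _ _ tAL): s => [|s s' [r1 e1] [r2 e2]|b' c'].
    + by exists [::]; rewrite big_nil !rmorph0.
    + by exists (r1 ++ r2); rewrite big_cat !rmorphD /= e1 e2.
    + by exists [:: (to_quo p n b', c')]; rewrite big_seq1 h0T psiP.
split; first by move=> i j; have [y yE] := lift i j; exists y; rewrite GE.
rewrite GE => Us UsE.
have G_inj : injective G.
  exact: (adic_map_inj (t := tALsp) (t' := tACp) (j := iLsC) (h := hG) (fun c => erefl) GP fin).
(* The determinant is invertible over [C], and invertibility descends to [Ls] at each level. *)
have Us_unit : Us \in unitmx.
  rewrite unitmxE.
  apply: (adic_map_unit (t := tALsp) (t' := tACp) (j := iLsC) (h := hG) (fun c => erefl) GP fin).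
  by rewrite -det_map_mx UsE UCE det_map_mx rmorph_unit // -unitmxE.
have G_tau : forall y, G (tauY y) = tauC (G y).
  have c1 := levelwise_comp tauYP GP.
  have c2 := levelwise_comp GP tauCP.
  have e : iLsC \o phiLs = phiC \o iLsC.
    by apply/funext => c; rewrite /= -phiLsE -phiCE rmorphXn.
  rewrite e in c1.
  exact: (levelwise_ext (t := tALsp) (t' := tACp) (h := fun n => hG n \o htY n)
    (h' := fun n => htC n \o hG n) c1 c2).
(* [G] is injective and commutes with Frobenius, so the equation for [UC] is inherited by [Us]. *)
have Us_frob : map_mx tauY Us *m map_mx rho Theta = Us.
  apply/matrixP => i j; apply: G_inj.
  suff e : map_mx G (map_mx tauY Us *m map_mx rho Theta) = map_mx G Us.
    by have := congr1 (fun X : 'M_r => X i j) e; rewrite !mxE.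
  rewrite map_mxM UsE -[RHS]UC_frob -UsE; congr (_ *m _); apply/matrixP => i' j'.
    by rewrite !mxE G_tau.
  by rewrite !mxE Grho.
have [inc [incE incP]] := adic_incl_rmorph tALsp lAp.
have [Pi [Pi0 PiE]] := adic_uniformizer (iA := iA) val_inj ap a0 (affine_ring_bound hK)
  (@affine_ring_closed _ _ _ oo) lAp.
have Piu (x : Ap) : lim_proj lAp 0 x != 0 -> x \is a GRing.unit.
  exact: (adic_unit_of_notin (iA := iA) ap a0 (affine_ring_bound hK)).
have [lam [lamD lamZ lam_int lam1]] := residue_exists iA Pi0 PiE.
pose pr := pairing Pi0 PiE Piu lam tALsp.
have prDl := pairingDl Pi0 PiE Piu lamD lamZ lam_int tALsp.
have prDr := pairingDr Pi0 PiE Piu lamD lamZ lam_int tALsp.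
have pr_int := pairing_int Pi0 PiE Piu lamD lamZ lam_int tALsp.
have prM c (x : {fraction Ap}) z : pr (tofrac c * x) z = pr x (inc c * z).
  by rewrite -incE; exact: pairingMl.
have pr_scalar c x z : pr x (rho (to_semilocal P (tensr tAL c)) * z) = iLLs c * pr x z.
  apply: pairing_scalar => // n.
  by rewrite rhoE -tens1l etaP rmorph1 tens1l.
have pr_tau x z : pr x (tauY z) = pr x z ^+ q.
  have -> : pr x z ^+ q = phiLs (pr x z) by rewrite -phiLsE.
  by apply: pairing_map tauYP.
have pr0 : forall z, (forall x, pr x z = 0) -> z = 0.
  exact: (pairing_nondegenerate lamD lamZ lam_int lam1 fin).
have pr_perfect : forall v : {fraction Ap} -> Ls,
    (forall x y : {fraction Ap}, v (x + y) = v x + v y) ->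
    (forall c (x : {fraction Ap}),
       v (tofrac (to_adic lAp (iA c)) * x) = iLLs ((iKL \o iK) c) * v x) ->
    (forall y, v (tofrac y) = 0) -> exists z, forall x, pr x z = v x.
  move=> v vD vZ v0.
  exact: (pairing_perfect Pi0 PiE Piu lamD lamZ lam_int lam1 tALsp fin vD vZ v0).
have inc_ad b : inc (to_adic lAp b) = rho (to_semilocal P (tensl tAL b)).
  apply: (lim_ext (l := level_limit tALsp)) => n.
  by rewrite incP to_adicE rhoE eta_i.
have inc_inj : injective inc by rewrite -incE; exact: (adic_incl_inj fin).
have inc_fixed z : tauY z = z -> exists c, z = inc c.
  by rewrite -incE; apply: (@adic_fixed _ _ _ _ _ _ _ tALsp _ lAp fin tauY htY); rewrite phiLsE.
exists (tate_vector (H := hM) hMp TD TZ Tmu hm rho_tau inc_ad prDl prDr pr_int prM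
  pr_scalar pr_tau Us_unit T_basis Us_frob).
split; first exact: tate_vector_basis.
move=> g [_ gL].
have [|gY [hgY [gYE gYP]]] := adic_map_rmorph tALsp tALsp (g := g).
  by move=> c; rewrite /= gL.
rewrite gYE incE; apply: tate_vector_galois => //.
- by move=> x z; apply: pairing_map gYP => // c; rewrite /= gL.
- have c1 := levelwise_comp tauYP gYP; have c2 := levelwise_comp gYP tauYP.
  have e : g \o phiLs = phiLs \o g by apply/funext => c; rewrite /= -phiLsE rmorphXn.
  rewrite e in c1.
  exact: (levelwise_ext (t := tALsp) (t' := tALsp) (h := fun n => hgY n \o htY n)
    (h' := fun n => htY n \o hgY n) c1 c2).
(* A Galois automorphism is the identity on [L], hence on the image of (A \otimes L)_(p). *)
- apply: (semilocal_rmorph_ext (f := gY \o rho) (g := rho)) => [b gb|s] /=.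
    by rewrite rhoE rmorph_unit // etaU.
  rewrite rhoE.
  apply: (adic_tensor_ext (t := tALsp) (t0 := tAL) (f := gY \o eta) (g := eta)) => n b c /=.
  by rewrite (gYP n).2 etaP (gYP n).1 gL.
Qed.
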